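(* Let $B=\begin{bmatrix}0&b\\-c&0\end{bmatrix}$ with $b,c\in\mathbb{Z}_{\ge0}$, and consider the cluster algebra of rank $2$ with principal coefficients at $t_0$ and initial exchange matrix $B$. Let $\mathbf{d}=\begin{bmatrix}d_1\\d_2\end{bmatrix}$ be the $d$-vector of a cluster variable, and let $x_{\mathbf{d}}$ be the cluster variable (with principal coefficients) corresponding to $\mathbf{d}$, i.e. having $d$-vector $\mathbf{d}$. Then $$x_{\mathbf{d}}=x_1^{-d_1}x_2^{-d_2}\sum_{(S_1,S_2)}y_1^{[d_1]_+-|S_1|}\,y_2^{|S_2|}\,x_1^{b|S_2|}\,x_2^{c|S_1|},$$ where the sum is over all compatible pairs $(S_1,S_2)$ in the maximal Dyck path $\mathcal{D}^{[d_1]_+\times[d_2]_+}$.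
   Context: Notation: $[a]_+=\max(a,0)$ for an integer $a$. Cluster pattern with principal coefficients (rank 2): $\mathbb{P}=\mathrm{Trop}(y_1,y_2)$ is the free abelian multiplicative group on $y_1,y_2$ with the addition $\prod y_j^{a_j}\oplus\prod y_j^{b_j}=\prod y_j^{\min(a_j,b_j)}$. Let $\mathbb{Q}(\mathbb{P})$ be the fraction field of the group ring $\mathbb{Z}\mathbb{P}$ and $\mathcal{F}$ the field of rational functions in two indeterminates over $\mathbb{Q}(\mathbb{P})$. A labeled seed is a triple $(\mathbf{x},\mathbf{y},B)$ with $\mathbf{x}=(x_1,x_2)$ a free generating set of $\mathcal{F}$ over $\mathbb{Q}(\mathbb{P})$, $\mathbf{y}\in\mathbb{P}^2$ and $B=(b_{ij})$ a $2\times2$ skew-symmetrizable integer matrix ($SB$ is skew-symmetric for some positive integer diagonal $S$). The mutation $\mu_k$ ($k=1,2$) sends it to $(\mathbf{x}',\mathbf{y}',B')$ with $b'_{ij}=-b_{ij}$ if $i=k$ or $j=k$, and $b'_{ij}=b_{ij}+[b_{ik}]_+b_{kj}+b_{ik}[-b_{kj}]_+$ otherwise; $y'_k=y_k^{-1}$ and $y'_j=y_jy_k^{[b_{kj}]_+}(y_k\oplus1)^{-b_{kj}}$ for $j\neq k$; $x'_k=\dfrac{y_k\prod_i x_i^{[b_{ik}]_+}+\prod_i x_i^{[-b_{ik}]_+}}{(y_k\oplus1)x_k}$ and $x'_j=x_j$ for $j\ne k$. $\mathbb{T}_2$ is the $2$-regular tree with edges labeled $1,2$, the two edges at each vertex having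 distinct labels. The cluster pattern assigns to each $t\in\mathbb{T}_2$ a labeled seed, with cluster $(x_{1;t},x_{2;t})$, so that seeds joined by an edge labeled $k$ are related by $\mu_k$; at the initial vertex $t_0$ the seed is $((x_1,x_2),(y_1,y_2),B)$, where $y_1,y_2$ are the generators of $\mathbb{P}$. The $x_{i;t}$ are the cluster variables. $d$-vectors: by the Laurent phenomenon each cluster variable is uniquely $\dfrac{N(x_1,x_2)}{x_1^{d_1}x_2^{d_2}}$ with $d_1,d_2\in\mathbb{Z}$ and $N$ a polynomial over $\mathbb{Z}\mathbb{P}$ divisible by neither $x_1$ nor $x_2$; its $d$-vector is $\begin{bmatrix}d_1\\d_2\end{bmatrix}$. (A cluster variable is determined by its $d$-vector.) Dyck paths: for integers $a_1,a_2\ge0$, a Dyck path of type $a_1\times a_2$ is a lattice path (unit steps right and up) from $(0,0)$ to $(a_1,a_2)$ that does not go above the diagonal joining $(0,0)$ and $(a_1,a_2)$. The maximal Dyck path $\mathcal{D}=\mathcal{D}^{a_1\times a_2}$ is the one closest to the diagonal: every lattice point strictly above $\mathcal{D}$ is strictly above the diagonal. Let $\mathcal{D}_1=\{u_1,\dots,u_{a_1}\}$ be its set of horizontal edges (left to right) and $\mathcal{D}_2=\{v_1,\dots,v_{a_2}\}$ its set of vertical edges (bottom to top). For lattice points $A,B$ on $\mathcal{D}$, $AB$ is the subpath of $\mathcal{D}$ starting at $A$ and going in the upper-right direction along $\mathcal{D}$ until it reaches $B$; if $(a_1,a_2)$ is reached before $B$, one restarts from $(0,0)$. The points $(0,0)$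 and $(a_1,a_2)$ are regarded as the same point, and if $A=B$ then $AA$ is the full closed loop starting at $A$, passing $(a_1,a_2)$, and ending at $A$ (of length $a_1+a_2$). $(AB)_1$ and $(AB)_2$ are the sets of horizontal, respectively vertical, edges in $AB$, and $AB^\circ$ is the set of lattice points on $AB$ other than the endpoints $A$ and $B$. Compatibility: for $S_1\subseteq\mathcal{D}_1$, $S_2\subseteq\mathcal{D}_2$, the pair $(S_1,S_2)$ is compatible if for every $u\in S_1$ and $v\in S_2$, with $E$ the left endpoint of $u$ and $F$ the upper endpoint of $v$, there is a lattice point $A\in EF^\circ$ such that $$|(AF)_1|=b\,|(AF)_2\cap S_2|\quad\text{or}\quad|(EA)_2|=c\,|(EA)_1\cap S_1|.$$ *)

(* Defs.v *)
From HB Require Import structures.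
From mathcomp Require Import all_boot all_order all_algebra.
From mathcomp Require Import fraction mpoly.

Set Implicit Arguments.
Unset Strict Implicit.
Unset Printing Implicit Defensive.

Import Order.TTheory GRing.Theory Num.Theory.
Local Open Scope ring_scope.

(* The indices 1 and 2 of the mathematical text. *)
Notation ix1 := (ord0 : 'I_2).
Notation ix2 := (ord_max : 'I_2).

Definition pos_part (a : int) : int := Num.max a 0.

(** * The tropical semifield Trop(y_1, y_2) *)

(* An element y_1^(a_1) y_2^(a_2) is represented by its exponents (a_1, a_2),
   so the multiplicative group law of Trop(y_1, y_2) is the pointwise addition
   of exponents and its auxiliary addition is the pointwise minimum. *)
Definition trop := {ffun 'I_2 -> int}.

Definition trop_one : trop := [ffun=> 0].
Definition trop_gen (i : 'I_2) : trop := [ffun j => (i == j : nat)%:Z].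
Definition trop_mul (p q : trop) : trop := [ffun j => p j + q j].
Definition trop_exp (p : trop) (n : int) : trop := [ffun j => p j * n].
Definition trop_oplus (p q : trop) : trop := [ffun j => Num.min (p j) (q j)].

(** * The ambient field *)

(* The group ring of Trop(y_1, y_2) over the integers is the ring of Laurent
   polynomials in y_1, y_2; it has the same fraction field as Z[y_1, y_2]. *)
Definition QP : fieldType := {fraction {mpoly int[2]}}.

Definition trop_QP (p : trop) : QP :=
  \prod_(j < 2) (tofrac ('X_j : {mpoly int[2]}) : QP) ^ (p j).

(* The group ring of Trop(y_1, y_2), as a subset of its fraction field. *)
Definition in_ZP (f : QP) : Prop :=
  exists (p : {mpoly int[2]}) (a : trop), f = tofrac p * trop_QP a.

Definition FF : fieldType := {fraction {mpoly QP[2]}}.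

Definition QP_FF (f : QP) : FF := tofrac (f%:MP : {mpoly QP[2]}).
Definition trop_FF (p : trop) : FF := QP_FF (trop_QP p).

Definition xvar (i : 'I_2) : FF := tofrac ('X_i : {mpoly QP[2]}).
Definition yvar (i : 'I_2) : FF := trop_FF (trop_gen i).

Definition mpoly_eval (x : {ffun 'I_2 -> FF}) (p : {mpoly QP[2]}) : FF :=
  mmap QP_FF x p.

Definition free_generating (x : {ffun 'I_2 -> FF}) : Prop :=
  (forall p : {mpoly QP[2]}, mpoly_eval x p = 0 -> p = 0) /\
  (forall f : FF, exists p q : {mpoly QP[2]},
     q != 0 /\ f = mpoly_eval x p / mpoly_eval x q).

(** * Seeds, mutations and cluster patterns *)

Definition skew_symmetrizable (B : 'M[int]_2) : Prop :=
  exists s : 'rV[int]_2,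
    (forall i, 0 < s 0 i) /\ (diag_mx s *m B)^T = - (diag_mx s *m B).

Record seed := Seed {
  cluster : {ffun 'I_2 -> FF};
  coeffs : {ffun 'I_2 -> trop};
  exchange : 'M[int]_2
}.

Definition labeled_seed (s : seed) : Prop :=
  free_generating (cluster s) /\ skew_symmetrizable (exchange s).

Definition mutate_exchange (k : 'I_2) (B : 'M[int]_2) : 'M[int]_2 :=
  \matrix_(i, j)
    if (i == k) || (j == k) then - B i j
    else B i j + pos_part (B i k) * B k j + B i k * pos_part (- B k j).

Definition mutate_coeffs (k : 'I_2) (B : 'M[int]_2) (y : {ffun 'I_2 -> trop}) :
    {ffun 'I_2 -> trop} :=
  [ffun j =>
    if j == k then trop_exp (y k) (- 1)
    else trop_mul (trop_mul (y j) (trop_exp (y k) (pos_part (B k j))))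
           (trop_exp (trop_oplus (y k) trop_one) (- B k j))].

Definition mutate_cluster (k : 'I_2) (B : 'M[int]_2) (y : {ffun 'I_2 -> trop})
    (x : {ffun 'I_2 -> FF}) : {ffun 'I_2 -> FF} :=
  [ffun j =>
    if j == k then
      (trop_FF (y k) * \prod_(i < 2) x i ^ pos_part (B i k)
         + \prod_(i < 2) x i ^ pos_part (- B i k))
      / (trop_FF (trop_oplus (y k) trop_one) * x k)
    else x j].

Definition mutate (k : 'I_2) (s : seed) : seed :=
  Seed (mutate_cluster k (exchange s) (coeffs s) (cluster s))
       (mutate_coeffs k (exchange s) (coeffs s))
       (mutate_exchange k (exchange s)).

(* The 2-regular tree T_2 is the doubly infinite path on the integers; the edge
   joining n and n + 1 is labeled 1 if n is even and 2 if n is odd. *)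
Definition T2_label (n : int) : 'I_2 := if odd `|n|%N then ix2 else ix1.

Definition T2_edge (k : 'I_2) (t t' : int) : Prop :=
  (t' = t + 1 /\ k = T2_label t) \/ (t = t' + 1 /\ k = T2_label t').

Definition initial_seed (B : 'M[int]_2) : seed :=
  Seed [ffun i => xvar i] [ffun i => trop_gen i] B.

Definition principal_cluster_pattern (B : 'M[int]_2) (t0 : int)
    (Sigma : int -> seed) : Prop :=
  [/\ forall t, labeled_seed (Sigma t),
      Sigma t0 = initial_seed B
    & forall k t t', T2_edge k t t' -> Sigma t' = mutate k (Sigma t)].

Definition cluster_variable (Sigma : int -> seed) (z : FF) : Prop :=
  exists (t : int) (i : 'I_2), z = cluster (Sigma t) i.

Definition exchange_matrix (b c : nat) : 'M[int]_2 :=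
  \matrix_(i, j)
    if (i == ix1) && (j == ix2) then b%:Z
    else if (i == ix2) && (j == ix1) then - c%:Z
    else 0.

(** * d-vectors *)

Definition over_ZP (N : {mpoly QP[2]}) : Prop := forall m, in_ZP N@_m.

Definition x_divides (i : 'I_2) (N : {mpoly QP[2]}) : Prop :=
  exists M : {mpoly QP[2]}, over_ZP M /\ N = 'X_i * M.

Definition has_dvector (z : FF) (d1 d2 : int) : Prop :=
  exists N : {mpoly QP[2]},
    [/\ over_ZP N, forall i, ~ x_divides i N
      & z = tofrac N / (xvar ix1 ^ d1 * xvar ix2 ^ d2)].

(** * Maximal Dyck paths *)

Section DyckPaths.

Variables a1 a2 : nat.

(* A lattice path from (0,0) to (a1,a2) is the word of its steps, where [true]
   is a step to the right and [false] a step up.  Edges are the positions in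
   this word: edge e joins the e-th to the (e+1)-st lattice point. *)
Definition lattice_path := (a1 + a2).-tuple bool.

Implicit Types (D : lattice_path) (k : nat).

Definition path_x D k : nat := count id (take k D).
Definition path_y D k : nat := count negb (take k D).

Definition above_diagonal (x y : nat) : bool := (a2 * x < a1 * y)%N.

Definition dyck_path D : Prop :=
  [/\ path_x D (a1 + a2) = a1, path_y D (a1 + a2) = a2
    & forall k, (k <= a1 + a2)%N -> ~~ above_diagonal (path_x D k) (path_y D k)].

(* A point (x,y) is strictly above D if it lies over all points of D of
   abscissa x. Only points of the rectangle [0,a1] x [0,a2] are considered. *)
Definition above_path D (x y : nat) : Prop :=
  forall k, (k <= a1 + a2)%N -> path_x D k = x -> (path_y D k < y)%N.

Definition maximal_dyck_path D : Prop :=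
  dyck_path D /\
  (forall x y, (x <= a1)%N -> (y <= a2)%N ->
     above_path D x y -> above_diagonal x y).

(* Since (0,0) and (a1,a2) are identified, the lattice points on D are indexed
   by 'I_(a1 + a2), with 0 for both endpoints; edge e goes from point e to its
   cyclic successor [ordS e]. *)
Implicit Types (A B E F e u v : 'I_(a1 + a2)).

Definition horizontal D : {set 'I_(a1 + a2)} := [set e | tnth D e].
Definition vertical D : {set 'I_(a1 + a2)} := [set e | ~~ tnth D e].

(* Number of steps from A to X along the closed loop. *)
Definition offset A (X : 'I_(a1 + a2)) : nat :=
  ((X + (a1 + a2) - A) %% (a1 + a2))%N.

Definition subpath_length A B : nat :=
  if A == B then (a1 + a2)%N else offset A B.

Definition subpath A B : {set 'I_(a1 + a2)} :=
  [set e | (offset A e < subpath_length A B)%N].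

Definition subpath_interior A B : {set 'I_(a1 + a2)} :=
  [set X | [&& (offset A X <= subpath_length A B)%N, X != A & X != B]].

Definition compatible (b c : nat) D (S1 S2 : {set 'I_(a1 + a2)}) : bool :=
  [forall u in S1, forall v in S2,
    let E := u in let F := ordS v in
    [exists A in subpath_interior E F,
      (#|subpath A F :&: horizontal D| == b * #|subpath A F :&: vertical D :&: S2|)%N
      || (#|subpath E A :&: vertical D| == c * #|subpath E A :&: horizontal D :&: S1|)%N]].

End DyckPaths.

(* Main.v *)
Require Import Defs.
From HB Require Import structures.
From mathcomp Require Import all_boot all_order all_algebra.
From mathcomp Require Import fraction mpoly.
From mathcomp Require Import boolp zify ring.

(** Fix the set of selected vertical edges of a maximal Dyck path and look at
    the horizontal edges that may be selected with it. Read from left to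
    right, the path becomes a word of parentheses: each horizontal edge
    leading to the foot of an unselected vertical edge opens one, and a
    selected vertical edge, with the m <= b horizontal edges leading to its
    foot, closes b - m of them. Three kinds of horizontal edges appear. Those
    leading to the foot of a selected vertical edge can never be selected
    (blocked). The open parentheses that are never closed can be selected at
    will (free). For the matched ones, compatibility says that below every arc
    with a selected left end, before its closing edge, the number of vertical
    edges is at least c times the number of selected horizontal edges
    ([normal_to_unrolled], [unrolled_to_normal]): it depends only on the
    lengths of the arcs and on how they are nested.

    Now reverse the word and complement the set of selected vertical edges.
    Openers and closers are exchanged, the arcs are the same, and the word is
    that of the path of type (bp - q) x p instead of q x p.  Hence the matched
    edges of both paths admit the same selections, while the numbers of free
    edges differ by a known amount ([flip_sum]).  Summed over the vertical
    selections, this says that the generating polynomial [greedy] of compatible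
    pairs obeys
      w1 ^ p * greedy(q, p)(w3, w2) = (1 + w2) ^ q * greedy(bp - q, p)(w1, w2)
    whenever w1 * w3 = (1 + w2) ^ b ([greedy_mutation]).

    This is the identity needed to move the initial cluster.  Let x_0, x_1, ...
    be the successive cluster variables in one direction of the tree.  An
    expansion of x_{m+2} in the cluster (x_1, x_2) with d-vector (p, q) becomes,
    on eliminating x_2 by the exchange relation between x_0 and x_2, an
    expansion in (x_0, x_1) with d-vector (bp - q, p); the weights w_i are the
    ratios of the two monomials of the exchange relations.  Induction on m gives
    the expansion of every x_{m+2} ([cluster_formula]), up to a coefficient
    monomial that is computed from the tropical coefficients: in one direction
    their exponent vectors are the d-vectors themselves ([right_form]), in the
    other direction the same holds, up to sign, after two first mutations
    ([left_form]).  The induction stays in the range of nonnegative d-vectors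
    for ever if bc >= 4.  If bc < 4 it does so until the pattern is about to
    return to where it started, and periodicity settles the remaining variables
    ([state_wrap]).

    Finally, in each of these expansions the numerator has a nonzero constant
    term in x_1, x_2, so that its exponents are the d-vector of the variable
    ([numerator_reduced], [dvector_unique]). *)

Set Implicit Arguments.
Unset Strict Implicit.
Unset Printing Implicit Defensive.

Import Order.TTheory GRing.Theory Num.Theory.
Local Open Scope ring_scope.

(** * Induction and counting on the integers *)
Lemma int_updown_ind (P : int -> Prop) :
  P 0 -> (forall z : int, P z -> P (z + 1)) -> (forall z : int, P (z + 1) -> P z) ->
  forall z : int, P z.
Proof.
move=> P0 PS PP; case=> n.
  by elim: n => // n /PS; rewrite -addn1 PoszD.
have PN : P (Negz 0) by apply: PP.
elim: n => // n IH; apply: PP.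
by have -> : Negz n.+1 + 1 = Negz n by lia.
Qed.

Lemma int_le_ind (P : int -> Prop) (z0 : int) :
  P z0 -> (forall z : int, z0 <= z -> P z -> P (z + 1)) -> forall z : int, z0 <= z -> P z.
Proof.
move=> P0 PS z le_z.
have -> : z = z0 + (`|z - z0|%N)%:Z by lia.
elim: (`|z - z0|%N) => [|m IH]; first by rewrite addr0.
have -> : z0 + m.+1%:Z = z0 + m%:Z + 1 by lia.
by apply: PS; first by lia.
Qed.

(** An antiderivative of the indicator of [f] that vanishes at 0: the number of
    true values on [z, z') is [scount f z' - scount f z], for integers of any
    sign.  Conditions on subpaths thereby become equalities between values of a
    potential at two points. *)
Definition scount (f : int -> bool) (z : int) : int :=
  match z with
  | Posz n => \sum_(i < n) (f i%:Z : nat)%:Z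
  | Negz n => - \sum_(i < n.+1) (f (Negz i) : nat)%:Z
  end.

Lemma scount0 f : scount f 0 = 0.
Proof. exact: big_ord0. Qed.

Lemma scountS f (z : int) : scount f (z + 1) = scount f z + (f z : nat)%:Z.
Proof.
case: z => [n|[|n]].
- by rewrite -PoszD addn1 /= big_ord_recr.
- by rewrite /= big_ord0 big_ord_recr big_ord0 /= add0r addNr.
- have -> : Negz n.+1 + 1 = Negz n by lia.
  by rewrite /= [in RHS]big_ord_recr /= opprD addrNK.
Qed.

Lemma scount_true (f : int -> bool) (z : int) : f z -> scount f (z + 1) = scount f z + 1.
Proof. by rewrite scountS => ->. Qed.

Lemma scount_false (f : int -> bool) (z : int) : ~~ f z -> scount f (z + 1) = scount f z.
Proof. by rewrite scountS => /negbTE->; rewrite addr0. Qed.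

Lemma scount_mono f (z z' : int) : z <= z' -> scount f z <= scount f z'.
Proof.
move: z'; apply: int_le_ind => // z' _ IH; rewrite scountS.
by case: (f z'); lia.
Qed.

Lemma scount_eq f g (z z' : int) : z <= z' -> (forall i : int, z <= i < z' -> f i = g i) ->
  scount f z' - scount f z = scount g z' - scount g z.
Proof.
move=> le_z; elim/int_le_ind: z' / le_z => [|z' le_z IH] fg; first by rewrite !subrr.
rewrite !scountS fg; last by lia.
suff: scount f z' - scount f z = scount g z' - scount g z by lia.
by apply: IH => i i_z; apply: fg; lia.
Qed.

Lemma scount_ext f g (z : int) : f =1 g -> scount f z = scount g z.
Proof.
move=> fg; elim/int_updown_ind: z => [|z IH|z].
- by rewrite !scount0.
- by rewrite !scountS IH fg.
- by rewrite !scountS fg => /addIr.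
Qed.

Lemma scount_period f (p z : int) : (forall i : int, f (i + p) = f i) ->
  scount f (z + p) = scount f z + scount f p.
Proof.
move=> fp; elim/int_updown_ind: z => [|z IH|z IH]; first by rewrite scount0 !add0r.
  by rewrite addrAC !scountS fp IH; lia.
by move: IH; rewrite addrAC !scountS fp [RHS]addrAC => /addIr.
Qed.

Lemma scount_opp f (z : int) : scount (fun i => f (- i - 1)) z = - scount f (- z).
Proof.
have E y : scount f (- y) = scount f (- y - 1) + (f (- y - 1) : nat)%:Z.
  by rewrite -scountS subrK.
elim/int_updown_ind: z => [|z IH|z]; first by rewrite oppr0 !scount0.
  by rewrite scountS IH E !opprD addrNK.
by rewrite scountS opprD => IH; rewrite E opprD -IH addrK.
Qed.

Lemma scount_neg f (z : int) : scount (fun i => ~~ f i) z = z - scount f z.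
Proof.
elim/int_updown_ind: z => [|z IH|z IH]; first by rewrite !scount0.
  by rewrite !scountS IH; case: (f z) => /=; lia.
by move: IH; rewrite !scountS; case: (f z) => /=; lia.
Qed.

Lemma scount_size f (z : int) (n : nat) : scount f (z + n%:Z) - scount f z =
  (size [seq x <- [seq z + i%:Z | i <- iota 0 n] | f x])%:Z.
Proof.
elim: n => [|n IH]; first by rewrite addr0 subrr.
have -> : z + n.+1%:Z = z + n%:Z + 1 by lia.
rewrite scountS -[n.+1]addn1 iotaD map_cat filter_cat size_cat PoszD -IH /= add0n.
by case: ifP => /=; lia.
Qed.

(** Discrete intermediate values: a function that never increases by more than
    one at a time cannot jump over [t]. *)
Lemma ivt (g : int -> int) (t u v : int) : u <= v ->
  (forall z : int, u <= z < v -> g (z + 1) <= g z + 1) -> g u < t -> t <= g v ->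
  exists2 w, u < w <= v & g w = t.
Proof.
move=> le_uv; elim/int_le_ind: v / le_uv => [|v le_uv IH] st gu gv; first by lia.
have [tg|gt] := leP t (g v).
  have [|w w1 w2] := IH _ gu tg; first by move=> z z_uv; apply: st; lia.
  by exists w => //; lia.
have sv : g (v + 1) <= g v + 1 by apply: st; lia.
by exists (v + 1); lia.
Qed.

Lemma first_true_between (f : int -> bool) (j k : int) : j <= k ->
  (forall i : int, j < i <= k -> ~~ f i) \/
  (exists i0, [/\ j <= i0 < k, f (i0 + 1) & forall i : int, j < i <= i0 -> ~~ f i]).
Proof.
move=> le_jk; elim/int_le_ind: k / le_jk => [|k le_jk IH]; first by left=> i; lia.
case: IH => [nf|[i0 [i01 i02 i03]]]; last by right; exists i0; split=> //; lia.
have [fk|nfk] := boolP (f (k + 1)).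
  by right; exists k; split=> //; lia.
left=> i i_jk; have [->//|ne] := eqVneq i (k + 1).
by apply: nf; lia.
Qed.

Lemma divz_uniq (m q d r : int) : m = q * d + r -> 0 <= r < d -> (m %/ d)%Z = q.
Proof.
move=> -> r_d; rewrite divzMDl; last by lia.
by rewrite divz_small ?addr0 //; lia.
Qed.

(** * The maximal Dyck path, repeated periodically *)
Section Path.

Variables a p : nat.
Hypothesis n_gt0 : (0 < a + p)%N.
Local Notation n := ((a + p)%:Z).

(** The path of type [a * p] is repeated along the whole diagonal, so that the
    closed loops of the compatibility condition become intervals.  The point
    number [m] lies on the line [x + y = m]; the path stays as close to the
    diagonal as possible, hence the floor. *)
Definition ycoord (m : int) : int := (m * p%:Z %/ n)%Z.
Definition xcoord (m : int) : int := m - ycoord m.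
Definition hor (m : int) : bool := xcoord m * p%:Z - ycoord m * a%:Z < a%:Z.

(** The points of the path are exactly the lattice points in this strip, which
    meets each line [x + y = m] once. *)
Lemma onpath (m : int) : 0 <= xcoord m * p%:Z - ycoord m * a%:Z < n.
Proof.
have := divz_eq (m * p%:Z) n; rewrite -/(ycoord m).
have := @modz_ge0 (m * p%:Z) n; have := @ltz_pmod (m * p%:Z) n.
set r := (_ %% _)%Z; rewrite /xcoord; move: (ycoord m) r => y r; nia.
Qed.

Lemma ycoord_uniq (x y : int) : 0 <= x * p%:Z - y * a%:Z < n -> ycoord (x + y) = y.
Proof. by move=> xy; apply: divz_uniq xy; nia. Qed.

Lemma xcoordD_ycoord (m : int) : xcoord m + ycoord m = m.
Proof. by rewrite /xcoord subrK. Qed.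

Lemma ycoord_hor (m : int) : hor m -> ycoord (m + 1) = ycoord m.
Proof.
rewrite /hor => hm; have := onpath m; have := xcoordD_ycoord m.
move: (xcoord m) (ycoord m) hm => x y hm <- o.
by rewrite addrAC ycoord_uniq //; nia.
Qed.

Lemma ycoord_ver (m : int) : ~~ hor m -> ycoord (m + 1) = ycoord m + 1.
Proof.
rewrite /hor => hm; have := onpath m; have := xcoordD_ycoord m.
move: (xcoord m) (ycoord m) hm => x y hm <- o.
by rewrite -addrA ycoord_uniq //; nia.
Qed.

Lemma xcoord_hor (m : int) : hor m -> xcoord (m + 1) = xcoord m + 1.
Proof. by move=> hm; rewrite /xcoord ycoord_hor //; lia. Qed.

Lemma xcoord_ver (m : int) : ~~ hor m -> xcoord (m + 1) = xcoord m.
Proof. by move=> hm; rewrite /xcoord ycoord_ver //; lia. Qed.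

Lemma ycoord_mono (m m' : int) : m <= m' -> ycoord m <= ycoord m'.
Proof.
move: m'; apply: int_le_ind => // m' _ IH.
by have [/ycoord_hor|/ycoord_ver] := boolP (hor m') => ->; lia.
Qed.

Lemma xcoord_mono (m m' : int) : m <= m' -> xcoord m <= xcoord m'.
Proof.
move: m'; apply: int_le_ind => // m' _ IH.
by have [/xcoord_hor|/xcoord_ver] := boolP (hor m') => ->; lia.
Qed.

Lemma ycoord_period (m : int) : ycoord (m + n) = ycoord m + p%:Z.
Proof.
by rewrite /ycoord mulrDl addrC (mulrC n) divzMDl 1?addrC //; lia.
Qed.

Lemma xcoord_period (m : int) : xcoord (m + n) = xcoord m + a%:Z.
Proof. by rewrite /xcoord ycoord_period; lia. Qed.

Lemma hor_period (m : int) : hor (m + n) = hor m.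
Proof. by rewrite /hor ycoord_period xcoord_period; congr (_ < _); nia. Qed.

(** [T] and [S] are the sets of abscissas and of heights of the selected
    horizontal and vertical edges.  A vertical edge lies after a given
    horizontal edge in exactly one way within one period.  The two alternatives
    say that one of the potentials [x - b * scount S y], [y - c * scount T x]
    takes the same value at both ends of a subpath: it counts the horizontal
    edges against [b] times the selected vertical ones, or the other way
    around. *)
Definition unrolled_compat (b c : nat) (T S : int -> bool) : Prop :=
  forall u v : int, u <= v < u + n -> hor u -> ~~ hor v -> T (xcoord u) -> S (ycoord v) ->
  exists2 A : int, u < A <= v &
      xcoord A - b%:Z * scount S (ycoord A) = xcoord (v + 1) - b%:Z * scount S (ycoord (v + 1))
   \/ ycoord A - c%:Z * scount T (xcoord A) = ycoord u - c%:Z * scount T (xcoord u).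

End Path.

Section Mirror.
Variables a p : nat.
Hypothesis n_gt0 : (0 < a + p)%N.

Lemma ycoord_mirror (m : int) : ycoord p a (- m) = - xcoord a p m.
Proof.
have := onpath n_gt0 m; have := xcoordD_ycoord a p m.
move: (xcoord a p m) (ycoord a p m) => x y <- o.
by rewrite opprD addrC ycoord_uniq //; lia.
Qed.

Lemma xcoord_mirror (m : int) : xcoord p a (- m) = - ycoord a p m.
Proof. by rewrite /xcoord ycoord_mirror /xcoord; lia. Qed.

Lemma hor_mirror (m : int) : hor p a (- m - 1) = ~~ hor a p m.
Proof.
have -> : - m - 1 = - (m + 1) by lia.
rewrite /hor ycoord_mirror xcoord_mirror.
have := onpath n_gt0 m.
case: (boolP (hor a p m)) => h.
  by rewrite xcoord_hor // ycoord_hor //; move: h; rewrite /hor /=; nia.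
by rewrite xcoord_ver // ycoord_ver //; move: h; rewrite /hor /=; nia.
Qed.

(** The reflection [(x, y) |-> (- y, - x)] reverses the path and exchanges
    horizontal and vertical edges, hence the two alternatives. *)
Lemma unrolled_compat_mirror b c (T S : int -> bool) : unrolled_compat a p b c T S ->
  unrolled_compat p a c b (fun i => S (- i - 1)) (fun i => T (- i - 1)).
Proof.
move=> H u v uv hu hv Su Tv.
have h1 : hor a p (- v - 1).
  have := hor_mirror (- v - 1).
  by rewrite (_ : - (- v - 1) - 1 = v) ?(negbTE hv); [case: (hor a p)|lia].
have h2 : ~~ hor a p (- u - 1).
  by rewrite -hor_mirror (_ : - (- u - 1) - 1 = u) //; lia.
have E m : xcoord a p m = - ycoord p a (- m) by rewrite ycoord_mirror opprK.
have E' m : ycoord a p m = - xcoord p a (- m) by rewrite xcoord_mirror opprK.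
have Ev : xcoord a p (- v - 1) = - ycoord p a v - 1.
  rewrite E; have -> : - (- v - 1) = v + 1 by lia.
  by rewrite ycoord_ver 1?addnC //; lia.
have Eu : ycoord a p (- u - 1) = - xcoord p a u - 1.
  rewrite E'; have -> : - (- u - 1) = u + 1 by lia.
  by rewrite xcoord_hor 1?addnC //; lia.
have uv' : - v - 1 <= - u - 1 < - v - 1 + (a + p)%N by lia.
have := H _ _ uv' h1 h2; rewrite Ev Eu => /(_ Tv Su) [A uA HA].
exists (- A); first by lia.
have Eu1 : xcoord p a u = - ycoord a p (- u - 1 + 1).
  by rewrite E' opprK; congr (xcoord p a _); lia.
have Eu2 : ycoord p a u = - xcoord a p (- u - 1 + 1).
  by rewrite E opprK; congr (ycoord p a _); lia.
have Ev1 : xcoord p a (v + 1) = - ycoord a p (- v - 1).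
  by rewrite E' opprK; congr (xcoord p a _); lia.
have Ev2 : ycoord p a (v + 1) = - xcoord a p (- v - 1).
  by rewrite E opprK; congr (ycoord p a _); lia.
rewrite -Ev in HA.
rewrite !scount_opp xcoord_mirror ycoord_mirror Eu1 Eu2 Ev1 Ev2 !opprK.
by case: HA => HA; [right|left]; rewrite !mulrN -[LHS]opprD HA opprD.
Qed.
End Mirror.

(** * Blocks, walks and arcs *)
Section Blocks.

Variables (b : nat) (C : int -> int) (S : int -> bool).

(** A path is recorded by its blocks: block [j] consists of the horizontal edges
    at height [j], of abscissas from [C j] to [C (j + 1) - 1], which are followed
    by vertical edge number [j].  The walk goes up by one along each horizontal edge
    and down by [b] at each selected vertical edge; [level x j] is its value just
    before the edge of abscissa [x] of block [j]. *)
Definition walk (i : int) : int := C i - b%:Z * scount S i.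
Definition level (x j : int) : int := x - b%:Z * scount S j.
Definition in_block (x j : int) : bool := C j <= x < C (j + 1).
(** The parenthesis opened by the edge of abscissa [x] is closed in the first
    later block [k] after which the walk has come down to the level at which the
    edge starts.  Only the values of the walk between blocks matter, because a
    selected block as a whole never goes up when blocks have length at most
    [b]. *)
Definition arc (x j k : int) : Prop :=
  [/\ in_block x j, j < k, walk (k + 1) <= level x j
    & forall i : int, j < i <= k -> level x j < walk i].

(** Compatibility in terms of arcs: [k - j] is the number of vertical edges
    below the arc, [C (k + 1)] the abscissa where the arc ends. *)
Definition normal_compat (c : nat) (T : int -> bool) : Prop :=
  forall x j : int, in_block x j -> T x -> ~~ S j /\
    forall k : int, arc x j k -> c%:Z * (scount T (C (k + 1)) - scount T x) <= k - j.

Definition staircase (a p : nat) : Prop :=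
  [/\ C 0 = 0, forall j : int, C j <= C (j + 1) <= C j + b%:Z
    & forall j : int, C (j + p%:Z) = C j + a%:Z].

Variables a p : nat.
Hypothesis C_stair : staircase a p.

Lemma stair_mono (i j : int) : i <= j -> C i <= C j.
Proof.
case: C_stair => _ Cs _; move: j; apply: int_le_ind => // j _ IH.
by have := Cs j; lia.
Qed.

Lemma in_block_lt (x i j : int) : in_block x i -> i < j -> x < C j.
Proof.
move=> /andP[_ x_lt] ij; apply: lt_le_trans x_lt _.
by apply: stair_mono; lia.
Qed.

Lemma in_block_ge (x i j : int) : in_block x j -> i <= j -> C i <= x.
Proof. by move=> /andP[+ _] ij; apply: le_trans; apply: stair_mono. Qed.

Lemma in_block_uniq (x i j : int) : in_block x i -> in_block x j -> i = j.
Proof.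
move=> xi xj; have [lt|lt|//] := ltgtP i j.
  by have := in_block_lt xi lt; case/andP: xj; lia.
by have := in_block_lt xj lt; case/andP: xi; lia.
Qed.

Lemma in_block_exists (x : int) : (0 < a)%N -> exists j : int, in_block x j.
Proof.
move=> a_gt0; case: C_stair => C0 Cs Cp.
have Cz (z : int) : C (z * p%:Z) = z * a%:Z.
  elim/int_updown_ind: z => [|z IH|z]; first by rewrite !mul0r.
    by rewrite !mulrDl !mul1r Cp IH.
  by rewrite !mulrDl !mul1r Cp => /addIr.
have [N xN] : exists N : nat, - N%:Z <= x <= N%:Z by exists `|x|%N; lia.
set lo := - N%:Z * p%:Z; set hi := (N%:Z + 1) * p%:Z.
have C1 : C lo <= x by rewrite Cz; nia.
have C2 : x < C hi by rewrite Cz; nia.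
have lohi : lo <= hi by rewrite /lo /hi; nia.
have [nof|[i [i_lo /= Ci Cm]]] := first_true_between (fun i => x < C i) lohi.
  have [E|ne] := eqVneq lo hi; first by move: C1; rewrite E; lia.
  by have := nof hi; rewrite C2 lexx lt_neqAle ne lohi => /(_ isT).
exists i; rewrite /in_block Ci andbT.
have [->//|ne] := eqVneq i lo.
by rewrite leNgt; apply: Cm; rewrite lexx lt_neqAle eq_sym ne; case/andP: i_lo => ->.
Qed.

Lemma walk_free (j : int) : ~~ S j -> walk j <= walk (j + 1).
Proof.
by case: C_stair => _ /(_ j) Cs _ Sj; rewrite /walk scount_false //; lia.
Qed.

Lemma walk_true (j : int) : S j -> walk (j + 1) <= walk j.
Proof.
by case: C_stair => _ /(_ j) Cs _ Sj; rewrite /walk scount_true //; lia.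
Qed.

Lemma walk_block (j x : int) : in_block x j -> walk j <= level x j.
Proof. by rewrite /walk /level /in_block; lia. Qed.

Lemma walk_block_free (j x : int) : in_block x j -> ~~ S j ->
  level x j < walk (j + 1).
Proof.
move=> xj Sj; rewrite /walk /level scount_false //.
by move: xj; rewrite /in_block; lia.
Qed.

Lemma arc_ends (x j k : int) : arc x j k -> ~~ S j /\ S k.
Proof.
case=> xj jk Wk kmin; have Wj := walk_block xj.
have h1 := kmin (j + 1) ltac:(lia); have h2 := kmin k ltac:(lia).
split; first by apply/negP => /walk_true; lia.
by apply: contraT => /walk_free; lia.
Qed.

(** A walk that comes down to the level of an open parenthesis has closed it. *)
Lemma arc_exists (x j k : int) : in_block x j -> ~~ S j -> j <= k ->
  walk (k + 1) <= level x j -> exists2 k0 : int, k0 <= k & arc x j k0.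
Proof.
move=> xj Sj jk Wk; have Wj := walk_block_free xj Sj.
have [nof|[k0 [k0_j /= Wk0 k0_m]]] :=
  @first_true_between (fun i => walk i <= level x j) j (k + 1) ltac:(lia).
  by have := nof (k + 1) ltac:(lia); rewrite -ltNge; lia.
have ne0 : k0 != j by apply: contraL Wk0 => /eqP->; rewrite -ltNge.
exists k0; first by lia.
by split=> //; [lia|move=> i /k0_m; rewrite -ltNge].
Qed.

Lemma arc_uniq (x j k j' k' : int) : arc x j k -> arc x j' k' -> j = j' /\ k = k'.
Proof.
move=> [xj jk Wk kmin] [xj' jk' Wk' kmin'].
have E := in_block_uniq xj xj'.
subst j'; split=> //; have [lt|lt|//] := ltgtP k k'.
  by have := kmin' (k + 1) ltac:(lia); lia.
by have := kmin (k' + 1) ltac:(lia); lia.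
Qed.

(** Arcs do not cross: within an arc the walk stays above the level of its left
    end, and coming down to that level closes everything opened in between. *)
Lemma arc_nested (x j k x' j' : int) : arc x j k -> in_block x' j' -> ~~ S j' ->
  x <= x' < C (k + 1) ->
  exists2 k' : int, k' <= k & arc x' j' k' /\ level x j <= level x' j'.
Proof.
move=> xjk xj' Sj' x'_xk; have [Sj Sk] := arc_ends xjk.
case: xjk => xj jk Wk kmin.
have jj' : j <= j'.
  have [//|lt] := leP j j'; have := in_block_lt xj' lt.
  by case/andP: xj; lia.
have j'k : j' <= k.
  have [//|lt] := leP j' k.
  by have := in_block_ge (i := k + 1) xj' ltac:(lia); lia.
have lev : level x j <= level x' j'.
  have [->|ne] := eqVneq j' j; first by rewrite /level; lia.
  have := kmin j' ltac:(lia); have := walk_block xj'; lia.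
have [k0 k0k ak0] := arc_exists xj' Sj' j'k (le_trans Wk lev).
by exists k0.
Qed.

Hypothesis p_gt0 : (0 < p)%N.

Lemma in_block_gt0 (x j : int) : in_block x j -> (0 < a)%N.
Proof.
move=> xj; have /andP[xj1 xj2] := xj; have := @stair_mono (j + 1) (j + p%:Z).
by move=> /(_ ltac:(lia)); case: C_stair => _ _ ->; lia.
Qed.

Hypothesis S_period : forall i : int, S (i + p%:Z) = S i.

Lemma walk_period (j : int) : walk (j + p%:Z) = walk j + walk p%:Z.
Proof.
case: C_stair => C0 _ Cp; rewrite /walk scount_period // Cp.
have := Cp 0; rewrite add0r C0 => ->; lia.
Qed.

(** If an arc lasted a period or more, the walk would be higher after its first
    period than at its start, so that its drift over a period would be positive.
    Then it could not come down at the end of the arc, being up one period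
    earlier. *)
Lemma arc_short (x j k : int) : arc x j k -> k < j + p%:Z.
Proof.
move=> xjk; have [Sj Sk] := arc_ends xjk; case: xjk => xj jk Wk kmin.
have [//|ge_k] := ltP k (j + p%:Z).
have Wjx := walk_block xj.
have [E|ne] := eqVneq k (j + p%:Z); first by rewrite E S_period (negbTE Sj) in Sk.
have [q Eq] : exists q : int, k + 1 = q + p%:Z by exists (k + 1 - p%:Z); lia.
have h1 := kmin q ltac:(lia).
have h2 := kmin (j + p%:Z) ltac:(lia).
rewrite walk_period in h2; rewrite Eq walk_period in Wk.
by clear -h1 h2 Wk Wjx; lia.
Qed.

End Blocks.

(** * Compatibility in terms of arcs *)
Section Normal.

Variables a p : nat.
Hypothesis p_gt0 : (0 < p)%N.
Local Notation n := ((a + p)%:Z).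

Let n_gt0 : (0 < a + p)%N. Proof. by rewrite addn_gt0 p_gt0 orbT. Qed.

(** [ceil j] is the least integer not below [j * a / p], the abscissa where the
    maximal Dyck path reaches height [j]. *)
Definition ceil (j : int) : int := - (- (j * a%:Z) %/ p%:Z)%Z.

Lemma ceil_le (j x : int) : (ceil j <= x) = (j * a%:Z <= x * p%:Z).
Proof. by rewrite /ceil lerNl lez_divRL ?ltz_nat // mulNr lerN2. Qed.

Lemma ceil0 : ceil 0 = 0.
Proof. by rewrite /ceil mul0r oppr0 div0z. Qed.

Lemma ceil_period (j : int) : ceil (j + p%:Z) = ceil j + a%:Z.
Proof.
apply/eqP; rewrite eq_le ceil_le -lerBrDr ceil_le.
have := ceil_le j (ceil j); rewrite lexx.
have := ceil_le (j + p%:Z) (ceil (j + p%:Z)); rewrite lexx.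
by move: (ceil _) (ceil _) => u v; nia.
Qed.

Lemma ceil_mono (i j : int) : i <= j -> ceil i <= ceil j.
Proof.
move=> ij; rewrite ceil_le.
have := ceil_le j (ceil j); rewrite lexx.
by move: (ceil _) => u; nia.
Qed.

Lemma ceil_step (b : nat) (j : int) : (a <= b * p)%N -> ceil (j + 1) <= ceil j + b%:Z.
Proof.
move=> abp; rewrite ceil_le.
have := ceil_le j (ceil j); rewrite lexx.
by move: (ceil _) => u; nia.
Qed.

Lemma ceil_staircase (b : nat) : (a <= b * p)%N -> staircase b ceil a p.
Proof.
move=> abp; split; [exact: ceil0| |exact: ceil_period].
by move=> j; rewrite ceil_mono ?ceil_step //; lia.
Qed.

Lemma ceil_interval (x y : int) : (0 <= x * p%:Z - y * a%:Z < n) =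
  (ceil y <= x <= ceil (y + 1)).
Proof.
have -> : (x <= ceil (y + 1)) = ~~ (ceil (y + 1) <= x - 1).
  by rewrite -ltNge; apply/idP/idP; lia.
rewrite !ceil_le mulrDl mulrBl !mul1r; lia.
Qed.

Lemma in_blockP (x j : int) : in_block ceil x j -> 
  [/\ hor a p (x + j), ycoord a p (x + j) = j & xcoord a p (x + j) = x].
Proof.
rewrite /in_block => xj.
have o : 0 <= x * p%:Z - j * a%:Z < n by rewrite ceil_interval; lia.
have ycj := ycoord_uniq n_gt0 o.
have xcj : xcoord a p (x + j) = x by rewrite /xcoord ycj; lia.
split=> //; rewrite /hor ycj xcj.
by have := ceil_le (j + 1) x; lia.
Qed.

(** Number, along the path, of the lower end of the vertical edge at height
    [k]. *)
Definition vpos (k : int) := ceil (k + 1) + k.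

Lemma vposP (k : int) : [/\ ~~ hor a p (vpos k), ycoord a p (vpos k) = k
   & xcoord a p (vpos k) = ceil (k + 1)].
Proof.
have o : 0 <= ceil (k + 1) * p%:Z - k * a%:Z < n.
  by rewrite ceil_interval lexx ceil_mono //; lia.
have ycj := ycoord_uniq n_gt0 o.
have xcj : xcoord a p (vpos k) = ceil (k + 1) by rewrite /xcoord ycj /vpos; lia.
split=> //; rewrite /hor ycj xcj.
by have := ceil_le (k + 1) (ceil (k + 1)); lia.
Qed.

Lemma hor_in_block (m : int) : hor a p m -> in_block ceil (xcoord a p m) (ycoord a p m).
Proof.
have := onpath n_gt0 m; rewrite ceil_interval /hor /in_block.
have := ceil_le (ycoord a p m + 1) (xcoord a p m).
by lia.
Qed.

Lemma ver_vpos (m : int) : ~~ hor a p m -> m = vpos (ycoord a p m).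
Proof.
have := onpath n_gt0 m; rewrite ceil_interval /hor /vpos.
have := ceil_le (ycoord a p m + 1) (xcoord a p m); have := xcoordD_ycoord a p m.
by lia.
Qed.

Lemma point_le (m : int) : ceil (ycoord a p m) <= xcoord a p m <= ceil (ycoord a p m + 1).
Proof. by have := onpath n_gt0 m; rewrite ceil_interval. Qed.

Lemma vpos_mono (i j : int) : i <= j -> vpos i <= vpos j.
Proof. by move=> ij; rewrite /vpos; have := @ceil_mono (i + 1) (j + 1); lia. Qed.

Variables (b c : nat) (T S : int -> bool).
Hypothesis b_gt0 : (0 < b)%N.
Hypothesis c_gt0 : (0 < c)%N.
Hypothesis abp : (a <= b * p)%N.
Hypothesis S_period : forall i, S (i + p%:Z) = S i.

Let C_stair := ceil_staircase abp.
Local Notation W := (walk b ceil S).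
Local Notation height m := (xcoord a p m - b%:Z * scount S (ycoord a p m)).
Local Notation depth m := (ycoord a p m - c%:Z * scount T (xcoord a p m)).

Lemma height_ver (m : int) : ~~ hor a p m -> S (ycoord a p m) ->
  height m = height (m + 1) + b%:Z.
Proof.
move=> vm Sm; rewrite xcoord_ver // ycoord_ver // scount_true //; lia.
Qed.

Lemma height_walk (m : int) : W (ycoord a p m) <= height m.
Proof. by rewrite /walk; have := point_le m; lia. Qed.

Lemma height_step (m : int) : height (m + 1) <= height m + 1.
Proof.
have [h|h] := boolP (hor a p m); first by rewrite xcoord_hor // ycoord_hor //; lia.
rewrite xcoord_ver // ycoord_ver //; have := @scount_mono S (ycoord a p m) (ycoord a p m + 1).
by move=> /(_ ltac:(lia)); nia.
Qed.

Lemma depth_step (m : int) : depth (m + 1) <= depth m + 1.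
Proof.
have [h|h] := boolP (hor a p m); last by rewrite xcoord_ver // ycoord_ver //; lia.
rewrite xcoord_hor // ycoord_hor //; have := @scount_mono T (xcoord a p m) (xcoord a p m + 1).
by move=> /(_ ltac:(lia)); nia.
Qed.

Lemma depth_hor (m : int) : hor a p m -> T (xcoord a p m) -> depth (m + 1) = depth m - c%:Z.
Proof. by move=> h t; rewrite xcoord_hor // ycoord_hor // scount_true //; lia. Qed.

(** Let [u] be a selected horizontal edge and [v] a selected vertical edge after
    it.  If [v] comes before the end of the arc of [u], or [u] has no arc, then
    the height after [v] is above the level of [u], at least its value just after
    [u]; since it falls by [b] along [v], it has been taken in between, and the
    first alternative holds.  If [v] comes at the end of the arc or later, the
    depth falls by [c] along [u] and is back at its initial value or above at the
    end of the arc, by the counting condition; so it is taken again, and the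
    second alternative holds. *)
Lemma normal_to_unrolled : normal_compat b ceil S c T -> unrolled_compat a p b c T S.
Proof.
move=> H u v uv hu hv Tu Sv.
have ub := hor_in_block hu.
have [Sj Hk] := H _ _ ub Tu.
set x := xcoord a p u in ub Tu Hk *; set j := ycoord a p u in ub Sj Hk *.
set k := ycoord a p v in Sv *.
have jk : j <= k by apply: ycoord_mono => //; lia.
have uv1 : u + 1 <= v.
  have [E|] := eqVneq u v; last by lia.
  by rewrite E (negbTE hv) in hu.
have Wj : level b S x j < W (j + 1) by exact: walk_block_free ub Sj.
have hu1 : height (u + 1) = level b S x j + 1.
  by rewrite xcoord_hor // ycoord_hor // -/x -/j /level; clear; lia.
have hv1 := height_ver hv Sv; rewrite -/k in hv1.
have [Wk|Wk] := leP (W (k + 1)) (level b S x j); last first.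
  have hv2 : height (v + 1) = W (k + 1).
    have [_ _ xv] := vposP k.
    by rewrite xcoord_ver // ycoord_ver // -/k {1}(ver_vpos hv) -/k xv.
  have [E|E] := eqVneq (height (u + 1)) (height (v + 1)).
    by exists (u + 1); [clear -uv1; lia|left].
  have [||w w_uv Ew] := @ivt (fun m => height m) (height (v + 1)) (u + 1) v uv1
     (fun z _ => height_step z).
  - by rewrite lt_neqAle E hu1 hv2; clear -Wk; lia.
  - by rewrite hv1; clear; lia.
  by exists w; [clear -w_uv; lia|left].
have [k0 k0k ak0] := arc_exists ub Sj jk Wk.
have k0_le := Hk _ ak0.
have jk0 : j < k0 by case: ak0.
have [vw yw xw] := vposP k0; set w := vpos k0 in vw yw xw.
have w_v : w <= v by rewrite (ver_vpos hv); apply: vpos_mono; lia.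
have uw : u + 1 <= w.
  have := @vpos_mono (j + 1) k0; rewrite -/w /vpos.
  have := @ceil_mono (j + 1) (j + 1 + 1); have := xcoordD_ycoord a p u.
  by rewrite -/x -/j; move: ub; rewrite /in_block; lia.
have du := depth_hor hu Tu.
have [||A A_uw EA] := @ivt (fun m => depth m) (depth u) (u + 1) w uw
     (fun z _ => depth_step z); rewrite /= ?xw ?yw.
- by lia.
- by rewrite -/x -/j; lia.
by exists A; [lia|right].
Qed.

(** The first alternative fails for a selected edge and the vertical edge that
    closes it, as the height stays above the level of the edge until it falls to
    that level or below.  The depth must therefore return to its value at the
    edge. *)
Lemma arc_return (x j k : int) : unrolled_compat a p b c T S -> T x ->
  arc b ceil S x j k ->
  exists2 A : int, x + j < A <= vpos k & depth A = depth (x + j).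
Proof.
move=> H Tx xjk; have [Sj Sk] := arc_ends C_stair xjk.
have near := arc_short C_stair p_gt0 S_period xjk.
case: xjk => xj jk Wk kmin.
have [hu yu xu] := in_blockP xj; have [hv yv xv] := vposP k.
have uv : x + j <= vpos k < x + j + n.
  have := @ceil_mono (k + 1) (j + p%:Z) ltac:(lia); have := ceil_period j.
  have := @ceil_mono (j + 1) (k + 1) ltac:(lia).
  by clear -xj near jk; move: xj; rewrite /vpos /in_block; lia.
have := H _ _ uv hu hv; rewrite yv xu => /(_ Tx Sk) [A A_uv HA].
exists A => //; case: HA => [E|//].
rewrite ycoord_ver // yv xcoord_ver // xv in E.
suff: level b S x j < height A by rewrite E -/(W (k + 1)); lia.
have yA : j <= ycoord a p A <= k.
  have := @ycoord_mono a p n_gt0 (x + j) A ltac:(lia).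
  have := @ycoord_mono a p n_gt0 A (vpos k) ltac:(lia).
  by rewrite yu yv; lia.
have [E'|ne] := eqVneq (ycoord a p A) j.
  by have := xcoordD_ycoord a p A; rewrite E' /level; clear -A_uv; lia.
apply: lt_le_trans (height_walk A); apply: kmin; lia.
Qed.

(** An edge at the foot of a selected vertical edge cannot be selected: between
    the two the depth stays below its initial value and the height, as blocks
    have length at most [b], above its final value.  For the counting condition
    one shows that from any point of the path below an arc to the end of the arc
    there are at least [c] times as many vertical edges as selected horizontal
    ones, by induction from the right end.  At a selected horizontal edge one
    jumps to the point, still below the arc, where the depth has returned to the
    same value ([arc_return]). *)
Lemma unrolled_to_normal : unrolled_compat a p b c T S -> normal_compat b ceil S c T.
Proof.
move=> H.
have free (x j : int) : in_block ceil x j -> T x -> ~~ S j.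
  move=> xj Tx; apply/negP => Sj.
  have [hu yu xu] := in_blockP xj; have [hv yv xv] := vposP j.
  have uv : x + j <= vpos j < x + j + n.
    have := @ceil_mono (j + 1) (j + p%:Z) ltac:(lia); have := ceil_period j.
    by move: xj; rewrite /vpos /in_block; lia.
  have := H _ _ uv hu hv; rewrite xu yv => /(_ Tx Sj) [A A_uv].
  have yA : ycoord a p A = j.
    have := @ycoord_mono a p n_gt0 (x + j) A ltac:(lia).
    have := @ycoord_mono a p n_gt0 A (vpos j) ltac:(lia).
    by rewrite yu yv; lia.
  have xA : x < xcoord a p A by have := xcoordD_ycoord a p A; lia.
  rewrite ycoord_ver // yv xcoord_ver // xv yA yu scount_true //.
  case=> E; first by have := ceil_step j abp; move: xj; rewrite /in_block; nia.
  have := @scount_mono T (x + 1) (xcoord a p A); rewrite scount_true //; nia.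
move=> x j xj Tx; split; first exact: free Tx.
move=> k xjk; have [hv yv xv] := vposP k; have [hu yu xu] := in_blockP xj.
have jk : j < k by case: xjk.
have uv0 : x + j <= vpos k.
  have := @vpos_mono j k ltac:(lia); rewrite {1}/vpos.
  by clear -xj; move: xj; rewrite /in_block; lia.
(* Counting from an arbitrary point [A] below the arc. *)
suff L : forall m (A : int), (`|vpos k - A|%N < m)%N -> x + j <= A <= vpos k ->
    c%:Z * (scount T (ceil (k + 1)) - scount T (xcoord a p A)) <= k - ycoord a p A.
  by have := L _ (x + j) (ltnSn _); rewrite yu xu; apply; rewrite lexx.
elim=> // m IH A Am Auv.
have [E|ne] := eqVneq A (vpos k); first by rewrite E xv yv; lia.
have IH1 := IH (A + 1) ltac:(lia) ltac:(lia).
have [hA|vA] := boolP (hor a p A); last first.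
  by move: IH1; rewrite xcoord_ver // ycoord_ver //; lia.
have [TA|nTA] := boolP (T (xcoord a p A)); last first.
  by move: IH1; rewrite xcoord_hor // ycoord_hor // scount_false.
have bA := hor_in_block hA; have SA := free _ _ bA TA.
have xA : x <= xcoord a p A < ceil (k + 1).
  have := @xcoord_mono a p n_gt0 (x + j) A ltac:(lia).
  have := @xcoord_mono a p n_gt0 (A + 1) (vpos k) ltac:(lia).
  by rewrite xu xv xcoord_hor //; lia.
have [k2 k2k [ak2 _]] := arc_nested C_stair xjk bA SA xA.
have [A'] := arc_return H TA ak2; rewrite xcoordD_ycoord => A'_A E.
have v2v := vpos_mono k2k.
have := IH A' ltac:(lia) ltac:(lia).
by clear -E; lia.
Qed.

End Normal.

(** * Complementing the selection: mates *)

(** The pigeonhole principle for an injective relation in place of a function,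
    as the mate of an edge is only given by a relation. *)
Lemma size_le_rel (A B : eqType) (R : A -> B -> Prop) (s : seq A) (s' : seq B) :
  uniq s -> (forall x, x \in s -> exists2 y, y \in s' & R x y) ->
  (forall x x' y, R x y -> R x' y -> x = x') -> (size s <= size s')%N.
Proof.
move=> us Rs inj; elim: s s' us Rs => //= x s IH s' /andP[xs us] Rs.
have [y ys' Rxy] := Rs x (mem_head _ _).
have -> : size s' = (size (rem y s')).+1.
  by rewrite size_rem // prednK //; case: (s') ys'.
rewrite ltnS; apply: IH => // x' x's.
have [y' y's' Rxy'] := Rs x' (mem_behead (s := x :: s) x's).
exists y' => //; rewrite (perm_mem (perm_to_rem ys')) inE in y's'.
case/orP: y's' => // /eqP E; subst y'.
by rewrite (inj _ _ _ Rxy Rxy') x's in xs.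
Qed.

Section Flip.

Variables (b q q' p : nat) (C C' : int -> int) (S S' : int -> bool).

(** Reading the blocks backwards and replacing each length [l] by [b - l] gives
    the staircase [C'], while [S'] is the reversed complement of [S].  A selected
    block lets the walk fall by [b - l]: this is how much the corresponding block
    of the flipped picture, which is not selected, makes it rise. *)
Definition flip : Prop :=
  (forall j : int, C' j = b%:Z * j + C (- j)) /\
  (forall j : int, S' j = ~~ S (- j - 1)).

(** The closer of the parenthesis opened by [x], as an abscissa of the flipped
    picture.  There block [k] becomes block [- k - 1], and the closer is the edge
    of this block with the same level as [x]. *)
Definition mate (x y : int) : Prop :=
  exists j k : int, arc b C S x j k /\ y = level b S x j + b%:Z * scount S' (- k - 1).

Hypothesis C_stair : staircase b C q p.
Hypothesis CS_flip : flip.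

Lemma flip_scount (z : int) : scount S' z = z + scount S (- z).
Proof.
case: CS_flip => _ hS.
by rewrite (scount_ext z hS) (scount_neg (fun i => S (- i - 1))) scount_opp opprK.
Qed.

(** The flipped walk is the same walk run backwards, so that both pictures have
    the same arcs. *)
Lemma flip_walk (j : int) : walk b C' S' j = walk b C S (- j).
Proof.
case: CS_flip => hC _; rewrite /walk hC flip_scount.
by clear; lia.
Qed.

Lemma mate_arc (x j k : int) : arc b C S x j k ->
  arc b C' S' (level b S x j + b%:Z * scount S' (- k - 1)) (- k - 1) (- j - 1).
Proof.
move=> xjk; have [Sj Sk] := arc_ends C_stair xjk; case: xjk => xj jk Wk kmin.
have Wj := walk_block b S xj.
set y := _ + _; have lev_y : level b S' y (- k - 1) = level b S x j.
  by rewrite /level /y -/(level b S x j); clear; lia.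
have W1 : walk b C' S' (- k - 1) = walk b C S (k + 1).
  by rewrite flip_walk; congr (walk b C S _); clear; lia.
split.
- have W2 : walk b C' S' (- k) = walk b C S k by rewrite flip_walk opprK.
  have Wkk := kmin k ltac:(lia).
  have cS : scount S' (- k) = scount S' (- k - 1).
    rewrite -[- k](subrK 1) scount_false ?subrK //.
    case: CS_flip => _ ->; rewrite negbK.
    by have -> : - (- k - 1) - 1 = k by clear; lia.
  move: W1 W2; rewrite /in_block subrK /walk cS.
  move: Wk Wkk; rewrite /walk /y; move: (level b S x j) => l.
  by clear; lia.
- by clear -jk; lia.
- by rewrite subrK lev_y flip_walk opprK.
- move=> i ik; rewrite lev_y flip_walk; apply: kmin.
  by clear -ik; lia.
Qed.

Lemma mate_fun (x y y' : int) : mate x y -> mate x y' -> y = y'.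
Proof.
move=> [j [k [xjk ->]]] [j' [k' [xjk' ->]]].
by have [-> ->] := arc_uniq C_stair xjk xjk'.
Qed.

Hypothesis qq' : (q + q' = b * p)%N.

Lemma flip_stair : staircase b C' q' p.
Proof.
case: CS_flip => hC _; case: C_stair => C0 Cs Cp; split.
- by rewrite hC oppr0 C0; lia.
- move=> j; rewrite !hC; have := Cs (- (j + 1)).
  have -> : - (j + 1) + 1 = - j by clear; lia.
  by clear; lia.
- move=> j; rewrite !hC.
  have -> : - j = - (j + p%:Z) + p%:Z by clear; lia.
  by rewrite Cp; nia.
Qed.

Hypothesis S_period : forall i : int, S (i + p%:Z) = S i.

Lemma flip_period (i : int) : S' (i + p%:Z) = S' i.
Proof.
case: CS_flip => _ hS; rewrite !hS.
have -> : - i - 1 = - (i + p%:Z) - 1 + p%:Z by clear; lia.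
by rewrite S_period.
Qed.

Hypothesis p_gt0 : (0 < p)%N.

Lemma in_block_shift (x j : int) :
  in_block C (x + q%:Z) (j + p%:Z) = in_block C x j.
Proof.
case: C_stair => _ _ Cp.
have E : j + p%:Z + 1 = j + 1 + p%:Z by clear; lia.
by rewrite /in_block E !Cp lerD2r ltrD2r.
Qed.

Lemma arc_shift (x j k : int) :
  arc b C S (x + q%:Z) (j + p%:Z) (k + p%:Z) <-> arc b C S x j k.
Proof.
have lev : level b S (x + q%:Z) (j + p%:Z) = level b S x j + walk b C S p%:Z.
  case: C_stair => C0 _ Cp; have := Cp 0; rewrite add0r C0.
  by rewrite add0r /level /walk scount_period // => ->; clear; lia.
have E : k + p%:Z + 1 = k + 1 + p%:Z by clear; lia.
rewrite /arc in_block_shift lev E (walk_period C_stair) // lerD2r ltrD2r.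
split=> -[xj jk Wk kmin]; split=> // i ik.
  have ik' : j + p%:Z < i + p%:Z <= k + p%:Z by clear -ik; lia.
  by have := kmin _ ik'; rewrite (walk_period C_stair) // ltrD2r.
rewrite -(subrK p%:Z i) (walk_period C_stair) // ltrD2r; apply: kmin.
by clear -ik; lia.
Qed.

Lemma mate_shift1 (x y : int) : mate x y -> mate (x + q%:Z) (y - q'%:Z).
Proof.
move=> [j [k [xjk ->]]]; exists (j + p%:Z), (k + p%:Z).
split; first by apply/arc_shift.
rewrite !flip_scount /level.
have -> : - (- (k + p%:Z) - 1) = - (- k - 1) + p%:Z by clear; lia.
rewrite !scount_period //; have : q%:Z + q'%:Z = b%:Z * p%:Z by rewrite -PoszD -PoszM qq'.
by clear; lia.
Qed.

End Flip.

Lemma flip_sym b C C' S S' : flip b C C' S S' -> flip b C' C S' S.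
Proof.
case=> hC hS; split=> j.
  by rewrite hC opprK; clear; lia.
rewrite hS negbK; congr (S _); clear; lia.
Qed.

Section Mates.

Variables (b q p : nat) (C C' : int -> int) (S S' : int -> bool).
Hypothesis C_stair : staircase b C q p.
Hypothesis CS_flip : flip b C C' S S'.

Lemma mate_sym (x y : int) : mate b C S S' x y -> mate b C' S' S y x.
Proof.
move=> [j [k [xjk ->]]]; exists (- k - 1), (- j - 1).
split; first exact: (mate_arc C_stair CS_flip xjk).
have -> : - (- j - 1) - 1 = j by clear; lia.
by rewrite /level; clear; lia.
Qed.

End Mates.

Section Matching.

Variables (b q q' p : nat) (C C' : int -> int) (S S' : int -> bool).
Hypothesis p_gt0 : (0 < p)%N.
Hypothesis qq' : (q + q' = b * p)%N.
Hypothesis C_stair : staircase b C q p.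
Hypothesis S_period : forall i : int, S (i + p%:Z) = S i.
Hypothesis CS_flip : flip b C C' S S'.

Let C'_stair := flip_stair C_stair CS_flip qq'.
Let S'_period := flip_period CS_flip S_period.
Let qq'_sym : (q' + q = b * p)%N. Proof. by rewrite addnC. Qed.
Local Notation M := (mate b C S S').

Lemma mate_inj (x x' y : int) : M x y -> M x' y -> x = x'.
Proof.
by move=> /(mate_sym C_stair CS_flip) h /(mate_sym C_stair CS_flip) /(mate_fun C'_stair h).
Qed.

Lemma mate_shift (x y z : int) : M x y -> M (x + z * q%:Z) (y - z * q'%:Z).
Proof.
move=> xy; elim/int_updown_ind: z => [|z IH|z IH]; first by rewrite !mul0r addr0 subr0.
  have := mate_shift1 C_stair CS_flip qq' S_period p_gt0 IH.
  by rewrite !mulrDl !mul1r addrA opprD addrA.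
have := mate_sym C_stair CS_flip IH.
move/(mate_shift1 C'_stair (flip_sym CS_flip) qq'_sym S'_period p_gt0).
move/(mate_sym C'_stair (flip_sym CS_flip)).
by rewrite !mulrDl !mul1r addrA addrK opprD addrA addrNK.
Qed.

(** Arcs correspond to arcs of the same length, and the selected edges below an
    arc are matched by arcs nested in it.  Their mates lie below the mate arc,
    where the count is therefore at least as large.  Used with a selection of
    matched edges and the set of its mates, in both directions. *)
Lemma normal_compat_mate c (T T' : int -> bool) :
  (forall x : int, T x -> exists j k : int, arc b C S x j k) ->
  (forall x y : int, T x -> M x y -> T' y) ->
  normal_compat b C' S' c T' -> normal_compat b C S c T.
Proof.
move=> matched TT' H x j xj Tx.
have [j1 [k1 xjk1]] := matched _ Tx.
have j1j : j1 = j.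
  by case: (xjk1) => xj1 _ _ _; exact: in_block_uniq C_stair _ _ _ xj1 xj.
subst j1; split; first by case: (arc_ends C_stair xjk1).
move=> k xjk; have yarc := mate_arc C_stair CS_flip xjk.
set y := level b S x j + _ in yarc.
have Mxy : M x y by exists j, k.
have [yb _ _ _] := yarc; have [_ Hk] := H _ _ yb (TT' _ _ Tx Mxy).
have := Hk _ yarc; rewrite subrK.
suff: scount T (C (k + 1)) - scount T x <= scount T' (C' (- j)) - scount T' y.
  by clear; nia.
have xk : x <= C (k + 1).
  have [_ jk _ _] := xjk; apply: ltW; apply: (in_block_lt C_stair xj).
  by clear -jk; lia.
have yj : y <= C' (- j).
  have [_ kj _ _] := yarc; apply: ltW; apply: (in_block_lt C'_stair yb).
  by clear -kj; lia.
have -> : C (k + 1) = x + (`|C (k + 1) - x|%N)%:Z by clear -xk; lia.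
have -> : C' (- j) = y + (`|C' (- j) - y|%N)%:Z by clear -yj; lia.
rewrite !scount_size lez_nat; apply: (@size_le_rel _ _ M).
- by rewrite filter_uniq // map_inj_uniq ?iota_uniq // => i1 i2; lia.
- move=> x2; rewrite mem_filter => /andP[Tx2 /mapP[i]].
  rewrite mem_iota => i_lt Ex2.
  have x2_b : x <= x2 < C (k + 1) by rewrite Ex2; clear -xk i_lt; lia.
  have [j2 [k2 xjk2]] := matched _ Tx2.
  have [Sj2 Sk2] := arc_ends C_stair xjk2; have [x2b _ _ _] := xjk2.
  have [k2' k2'k [xjk2' lev2]] := arc_nested C_stair xjk x2b Sj2 x2_b.
  have [_ E2] := arc_uniq C_stair xjk2' xjk2; subst k2'.
  have yarc2 := mate_arc C_stair CS_flip xjk2.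
  exists (level b S x2 j2 + b%:Z * scount S' (- k2 - 1)); last by exists j2, k2.
  set y2 := _ + _ in yarc2 *.
  rewrite mem_filter (TT' x2) //=; last by exists j2, k2.
  have y2_b : y <= y2 < C' (- j).
    have j2j : j <= j2.
      have [//|lt] := leP j j2; have := in_block_lt C_stair x2b lt.
      by move: xj; rewrite /in_block; clear -x2_b; lia.
    have [y2b jk2' _ _] := yarc2; apply/andP; split; last first.
      by apply: (in_block_lt C'_stair y2b); clear -j2j jk2'; lia.
    have [E|ne] := eqVneq k2 k; first by rewrite /y2 /y E lerD2r.
    apply: ltW; apply: lt_le_trans (in_block_ge C'_stair y2b (lexx _)).
    by apply: (in_block_lt C'_stair yb); clear -k2'k ne; lia.
  apply/mapP; exists (`|y2 - y|%N); last by clear -y2_b; lia.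
  by rewrite mem_iota; clear -y2_b; lia.
- exact: mate_inj.
Qed.

End Matching.

(** * Blocked, free and matched edges *)

(** A selection of edges within one period, repeated periodically. *)
Definition periodic (q : nat) (T : {set 'I_q}) (x : int) : bool :=
  [exists i in T, (x %% q%:Z)%Z == i%:Z].

Lemma periodicP q (T : {set 'I_q}) (x : int) :
  reflect (exists i z, i \in T /\ x = (i : nat)%:Z + z * q%:Z) (periodic T x).
Proof.
apply: (iffP exists_inP) => [[i iT /eqP E]|[i [z [iT ->]]]].
  by exists i, (x %/ q%:Z)%Z; split=> //; rewrite addrC -E -divz_eq.
exists i => //; rewrite addrC modzMDl modz_small //.
by have := ltn_ord i; lia.
Qed.

Lemma periodic_shift q (T : {set 'I_q}) (x : int) : periodic T (x + q%:Z) = periodic T x.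
Proof. by rewrite /periodic -[x + _]addrC -{1}[q%:Z]mul1r modzMDl. Qed.

Lemma periodic_ord q (T : {set 'I_q}) (i : 'I_q) : periodic T i%:Z = (i \in T).
Proof.
apply/exists_inP/idP => [[j jT]|iT].
  rewrite modz_small; last by have := ltn_ord i; lia.
  by move=> /eqP [/val_inj ->].
by exists i; rewrite ?modz_small //; have := ltn_ord i; lia.
Qed.

Lemma periodic_mul q (f : int -> bool) (x z : int) :
  (forall i : int, f (i + q%:Z) = f i) -> f (x + z * q%:Z) = f x.
Proof.
move=> fq; elim/int_updown_ind: z => [|z IH|z IH]; first by rewrite mul0r addr0.
  by rewrite mulrDl mul1r addrA fq.
by rewrite -IH mulrDl mul1r addrA fq.
Qed.

Lemma scount_card q (f : int -> bool) : scount f q%:Z = #|[set i : 'I_q | f i%:Z]|%:Z.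
Proof.
rewrite /scount -sum1_card -(big_morph _ PoszD (erefl 0%:Z)) [in RHS]big_mkcond /=.
by congr (_%:Z); apply: eq_bigr => i _; rewrite inE; case: (f _).
Qed.

Lemma scount_periodic q (T : {set 'I_q}) : scount (periodic T) q%:Z = #|T|%:Z.
Proof.
rewrite scount_card; congr (Posz #|pred_of_set _|).
by apply/setP=> i; rewrite inE periodic_ord.
Qed.

Lemma sum_subset_exp (R : comPzRingType) (I : finType) (U : {set I}) (t : R) :
  \sum_(T : {set I} | T \subset U) t ^+ #|T| = (1 + t) ^+ #|U|.
Proof.
rewrite -prodr_const big_mkcond /=.
have -> : \prod_(i in U) (1 + t) = \prod_i ((i \in U)%:R * t + 1).
  rewrite big_mkcond; apply: eq_bigr => i _.
  by case: (i \in U); rewrite ?mul1r ?mul0r ?add0r // addrC.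
rewrite bigA_distr; apply: eq_bigr => T _.
rewrite -big_mkcond /=; case: ifP => [/subsetP TU|/negbT /subsetPn [i iT iU]].
  rewrite -prodr_const; apply: eq_bigr => i iT.
  by rewrite TU // mul1r.
by rewrite (bigD1 i iT) /= (negbTE iU) !mul0r.
Qed.

(** A condition that depends only on [T :&: M] leaves the elements of [U] at
    will, and each of them contributes a factor [1 + t]. *)
Lemma sum_free (R : comPzRingType) (I : finType) (M U : {set I})
    (P : pred {set I}) (t : R) : [disjoint M & U] ->
  \sum_(T : {set I} | (T \subset M :|: U) && P (T :&: M)) t ^+ #|T| =
  (1 + t) ^+ #|U| * \sum_(T : {set I} | (T \subset M) && P T) t ^+ #|T|.
Proof.
move=> MU; rewrite -sum_subset_exp big_distrlr pair_big /=.
have UM0 : U :&: M = set0 by apply/eqP; rewrite setI_eq0 disjoint_sym.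
have capU (A B : {set I}) : A \subset U -> B \subset M -> (A :|: B) :&: U = A.
  move=> AU BM; rewrite setIUl (setIidPl AU); apply/setUidPl.
  by apply: subset_trans (setSI U BM) _; rewrite setIC UM0 sub0set.
have capM (A B : {set I}) : A \subset U -> B \subset M -> (A :|: B) :&: M = B.
  move=> AU BM; rewrite setIUl (setIidPl BM); apply/setUidPr.
  by apply: subset_trans (setSI M AU) _; rewrite UM0 sub0set.
rewrite (reindex_onto (fun X : {set I} * {set I} => X.1 :|: X.2)
                      (fun T => (T :&: U, T :&: M))) /=; last first.
  by move=> T /andP[TMU _]; rewrite -setIUr setUC; apply/setIidPl.
apply: eq_big => [[A B] /=|[A B] /= /andP[_ /eqP[EA EB]]].
  apply/andP/and3P => [[/andP[AB PM] /eqP[EA EB]]|[AU BM PB]].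
    split; first by rewrite -EA subsetIr.
      by rewrite -EB subsetIr.
    by rewrite -EB.
  rewrite capM // capU // eqxx PB andbT setUC; split=> //.
  exact: setUSS.
rewrite -exprD -cardsUI; have -> : A :&: B = set0; last by rewrite cards0 addn0.
apply/eqP; rewrite -subset0 -UM0 -EA -EB.
by apply: setISS; apply: subsetIr.
Qed.

Section SetLevel.

Variables (b q p c : nat) (C : int -> int) (S : int -> bool).
Hypothesis p_gt0 : (0 < p)%N.
Hypothesis C_stair : staircase b C q p.
Hypothesis S_period : forall i : int, S (i + p%:Z) = S i.

Definition normal_compatb (T : {set 'I_q}) : bool := `[< normal_compat b C S c (periodic T) >].
Definition matched (x : int) : bool := `[< exists j k : int, arc b C S x j k >].
Definition blocked (x : int) : bool := `[< exists2 j : int, in_block C x j & S j >].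
Definition matched_set : {set 'I_q} := [set x : 'I_q | matched x%:Z].
Definition blocked_set : {set 'I_q} := [set x : 'I_q | blocked x%:Z].
Definition free_set : {set 'I_q} := ~: (matched_set :|: blocked_set).

Lemma matched_shift (x : int) : matched (x + q%:Z) = matched x.
Proof.
apply/asboolP/asboolP => [[j [k xjk]]|[j [k xjk]]].
  exists (j - p%:Z), (k - p%:Z); apply/(arc_shift C_stair S_period p_gt0).
  by rewrite !subrK.
by exists (j + p%:Z), (k + p%:Z); apply/(arc_shift C_stair S_period p_gt0).
Qed.

Lemma blocked_shift (x : int) : blocked (x + q%:Z) = blocked x.
Proof.
apply/asboolP/asboolP => [[j xj Sj]|[j xj Sj]].
  exists (j - p%:Z); last by rewrite -S_period subrK.
  by rewrite -(in_block_shift C_stair) subrK.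
by exists (j + p%:Z); rewrite ?S_period // (in_block_shift C_stair).
Qed.

Lemma matched_not_blocked (x : int) : matched x -> ~~ blocked x.
Proof.
move=> /asboolP[j [k xjk]]; apply/asboolP => -[j' xj' Sj'].
have [Sj _] := arc_ends C_stair xjk; have [xj _ _ _] := xjk.
by rewrite (in_block_uniq C_stair xj xj') Sj' in Sj.
Qed.

Lemma periodic_setI (T : {set 'I_q}) (f : int -> bool) (x : int) :
  (forall i : int, f (i + q%:Z) = f i) ->
  periodic (T :&: [set i : 'I_q | f i%:Z]) x = periodic T x && f x.
Proof.
move=> fq; apply/periodicP/andP => [[i [z [+ ->]]]|[/periodicP[i [z [iT ->]]]]].
  rewrite !inE => /andP[iT fi]; split; last by rewrite periodic_mul.
  by apply/periodicP; exists i, z.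
by rewrite periodic_mul // => fi; exists i, z; rewrite !inE iT.
Qed.

(** Selected edges below an arc have an arc themselves, so that the counting
    condition concerns the matched edges only. *)
Lemma normal_compatbE (T : {set 'I_q}) :
  normal_compatb T = (T \subset ~: blocked_set) && normal_compatb (T :&: matched_set).
Proof.
have perM x := periodic_setI T x matched_shift.
apply/asboolP/andP => [H|[TB /asboolP H]].
  split.
    apply/subsetP => i iT; rewrite !inE; apply/asboolP => -[j xj Sj].
    by have [] := H _ _ xj; rewrite ?periodic_ord ?Sj.
  apply/asboolP => x j xj; rewrite perM => /andP[Tx Mx].
  have [Sj Hk] := H _ _ xj Tx; split=> // k xjk.
  apply: le_trans (Hk _ xjk); rewrite ler_wpM2l //.
  have xk : x <= C (k + 1).
    by have [_ jk _ _] := xjk; apply: ltW; apply: (in_block_lt C_stair xj); clear -jk; lia.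
  have -> : C (k + 1) = x + (`|C (k + 1) - x|%N)%:Z by clear -xk; lia.
  rewrite !scount_size lez_nat !size_filter; apply: sub_count => y.
  by rewrite /= perM => /andP[].
move=> x j xj Tx.
have nb y : periodic T y -> ~~ blocked y.
  move=> /periodicP[i [z [iT ->]]].
  by rewrite (periodic_mul _ _ blocked_shift); have /subsetP/(_ _ iT) := TB; rewrite !inE.
have free y i : periodic T y -> in_block C y i -> ~~ S i.
  by move=> /nb Ty yi; apply: contra Ty => Si; apply/asboolP; exists i.
split; first exact: free xj.
move=> k xjk.
have Mx : matched x by apply/asboolP; exists j, k.
have TMx : periodic (T :&: matched_set) x by rewrite perM Tx.
have [_ /(_ _ xjk)] := H _ _ xj TMx; apply: le_trans; rewrite ler_wpM2l //.
have xk : x <= C (k + 1).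
  have [_ jk _ _] := xjk; apply: ltW; apply: (in_block_lt C_stair xj).
  by clear -jk; lia.
rewrite le_eqVlt; apply/orP; left; apply/eqP.
apply: scount_eq => // y y_xk; rewrite perM.
have [Ty|//] := boolP (periodic T y); symmetry.
have [i yi] : exists i : int, in_block C y i.
  by apply: (in_block_exists C_stair); case: xjk => /(in_block_gt0 C_stair p_gt0).
have [k' _ [yik _]] := arc_nested C_stair xjk yi (free _ _ Ty yi) y_xk.
by apply/asboolP; exists i, k'.
Qed.

Lemma disjoint_matched_free : [disjoint matched_set & free_set].
Proof. by rewrite disjoints_subset setCK subsetUl. Qed.

Lemma matchedU_free : matched_set :|: free_set = ~: blocked_set.
Proof.
apply/setP=> x; rewrite !inE; have := @matched_not_blocked x%:Z.
by case: (matched _) => [/(_ isT)->|_].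
Qed.

Lemma card_parts : (#|matched_set| + #|free_set| + #|blocked_set| = q)%N.
Proof.
have := cardsUI matched_set free_set.
rewrite (disjoint_setI0 disjoint_matched_free) cards0 addn0 matchedU_free => <-.
by rewrite addnC cardsC card_ord.
Qed.

Lemma sum_normal_compat (R : comPzRingType) (t : R) :
  \sum_(T : {set 'I_q} | normal_compatb T) t ^+ #|T| =
  (1 + t) ^+ #|free_set| *
    \sum_(T : {set 'I_q} | (T \subset matched_set) && normal_compatb T) t ^+ #|T|.
Proof.
rewrite -(sum_free normal_compatb t disjoint_matched_free) matchedU_free.
by apply: eq_bigl => T; rewrite normal_compatbE.
Qed.

Lemma scount_blocked (j : int) : scount blocked (C (j + 1)) - scount blocked (C j) =
  if S j then C (j + 1) - C j else 0.
Proof.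
have le_C : C j <= C (j + 1) by case: C_stair => _ /(_ j) /andP[].
rewrite (@scount_eq _ (fun _ => S j)) //.
  have cT (z : int) : scount (fun _ => true) z = z.
    elim/int_updown_ind: z => [|z IH|z]; first exact: scount0.
      by rewrite scountS IH.
    by rewrite scountS => /addIr.
  have cF (z : int) : scount (fun _ => false) z = 0.
    by have := scount_neg (fun _ => true) z; rewrite /= cT subrr.
  by case: (S j); rewrite ?cT ?cF ?subrr.
move=> i i_j; have ij : in_block C i j by rewrite /in_block.
by apply/asboolP/idP => [[j' ij' Sj']|Sj]; [rewrite (in_block_uniq C_stair ij ij')|exists j].
Qed.

End SetLevel.

Section FlipSets.

Variables (b q q' p c : nat) (C C' : int -> int) (S S' : int -> bool).
Hypothesis p_gt0 : (0 < p)%N.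
Hypothesis qq' : (q + q' = b * p)%N.
Hypothesis C_stair : staircase b C q p.
Hypothesis S_period : forall i : int, S (i + p%:Z) = S i.
Hypothesis CS_flip : flip b C C' S S'.

Let C'_stair := flip_stair C_stair CS_flip qq'.
Local Notation M := (mate b C S S').
Local Notation MM := (matched_set b q C S).
Local Notation MM' := (matched_set b q' C' S').

(** Taking mates commutes with the shift by one period, of size [q] on one side
    and [q'] on the other, hence defines a map between selections within one
    period. *)
Definition mates (T : {set 'I_q}) : {set 'I_q'} :=
  [set y : 'I_q' | `[< exists2 x : int, periodic T x & M x y%:Z >]].

Lemma mate_q'_gt0 (x y : int) : M x y -> (0 < q')%N.
Proof.
move=> /(mate_sym C_stair CS_flip) [j [k [[yj _ _ _] _]]].
exact: (in_block_gt0 C'_stair p_gt0 yj).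
Qed.

Lemma periodic_mates (T : {set 'I_q}) (y : int) :
  periodic (mates T) y <-> exists2 x : int, periodic T x & M x y.
Proof.
have sh := mate_shift p_gt0 qq' C_stair S_period CS_flip.
split=> [/periodicP[i [z [+ ->]]]|[x Tx xy]].
  rewrite inE => /asboolP[x Tx xi]; exists (x + (- z) * q%:Z).
    by rewrite (periodic_mul _ _ (periodic_shift T)).
  by have := sh _ _ (- z) xi; rewrite [- z * q'%:Z]mulNr opprK.
have q'_gt0 := mate_q'_gt0 xy.
have y_lt : (`|(y %% q'%:Z)%Z|%N < q')%N.
  have := @ltz_pmod y q'%:Z; have := @modz_ge0 y q'%:Z.
  by move: (modz _ _) => r; lia.
apply/periodicP; exists (Ordinal y_lt), (y %/ q'%:Z)%Z.
have Ey : (`|(y %% q'%:Z)%Z|%N)%:Z = (y %% q'%:Z)%Z.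
  by rewrite gez0_abs // modz_ge0 //; lia.
rewrite inE /= Ey; split; last by rewrite addrC -divz_eq.
apply/asboolP; exists (x + (y %/ q'%:Z)%Z * q%:Z).
  by rewrite (periodic_mul _ _ (periodic_shift T)).
have -> : (y %% q'%:Z)%Z = y - (y %/ q'%:Z)%Z * q'%:Z.
  by apply/eqP; rewrite eq_sym subr_eq addrC -divz_eq.
exact: sh.
Qed.

Lemma mates_matched (T : {set 'I_q}) : mates T \subset MM'.
Proof.
apply/subsetP => y; rewrite !inE => /asboolP[x _ /(mate_sym C_stair CS_flip)].
by move=> [j [k [yjk _]]]; apply/asboolP; exists j, k.
Qed.

Lemma matched_mate (x : int) : matched b C S x -> exists y : int, M x y.
Proof. by move=> /asboolP[j [k xjk]]; eexists; exists j, k. Qed.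

Lemma periodic_matched (T : {set 'I_q}) (x : int) :
  T \subset MM -> periodic T x -> matched b C S x.
Proof.
move=> /subsetP TM /periodicP[i [z [/TM + ->]]].
by rewrite inE (periodic_mul _ _ (matched_shift p_gt0 C_stair S_period)).
Qed.

(** Two edges of one period cannot have mates that differ by a multiple of the
    period, since they would then themselves differ by one. *)
Lemma card_mates (T : {set 'I_q}) : T \subset MM -> (#|T| <= #|mates T|)%N.
Proof.
move=> TM; rewrite !cardE.
have sh := mate_shift p_gt0 qq' C_stair S_period CS_flip.
apply: (@size_le_rel _ _ (fun (x : 'I_q) (y : 'I_q') =>
   exists z : int, M x%:Z (y%:Z + z * q'%:Z))); first exact: enum_uniq.
- move=> x; rewrite mem_enum => xT.
  have [y xy] : exists y : int, M x%:Z y.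
    by apply: matched_mate; have /subsetP/(_ _ xT) := TM; rewrite inE.
  have : periodic (mates T) y.
    by apply/periodic_mates; exists x%:Z => //; rewrite periodic_ord.
  move=> /periodicP[i [z [iT Ey]]]; exists i; rewrite ?mem_enum //.
  by exists z; rewrite -Ey.
- move=> x x' y [z xy] [z' xy'].
  have := sh _ _ (z' - z) xy'.
  have -> : y%:Z + z' * q'%:Z - (z' - z) * q'%:Z = y%:Z + z * q'%:Z.
    by clear; lia.
  move=> /(mate_inj qq' C_stair CS_flip xy).
  move: (z' - z) => w E; apply: val_inj => /=; apply/eqP; rewrite -eqz_nat.
  have := ltn_ord x; have := ltn_ord x'; move: E.
  move: (nat_of_ord x) (nat_of_ord x') => m m'; clear.
  by have [w_neg|w_pos|->] := ltgtP w 0; [nia|nia|rewrite mul0r addr0 => ->].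
Qed.

Lemma normal_compatb_mates (T : {set 'I_q}) : T \subset MM ->
  normal_compatb b c C' S' (mates T) -> normal_compatb b c C S T.
Proof.
move=> TM /asboolP H; apply/asboolP.
refine (normal_compat_mate p_gt0 qq' C_stair CS_flip _ _ H).
  by move=> x /(periodic_matched TM) /asboolP.
by move=> x y Tx xy; apply/periodic_mates; exists x.
Qed.

End FlipSets.

Section MateInvolution.

Variables (b q q' p : nat) (C C' : int -> int) (S S' : int -> bool).
Hypothesis p_gt0 : (0 < p)%N.
Hypothesis qq' : (q + q' = b * p)%N.
Hypothesis C_stair : staircase b C q p.
Hypothesis S_period : forall i : int, S (i + p%:Z) = S i.
Hypothesis CS_flip : flip b C C' S S'.

Let C'_stair := flip_stair C_stair CS_flip qq'.
Let CS_flop := flip_sym CS_flip.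
Local Notation MM := (matched_set b q C S).
Local Notation mt := (mates b q' C S S').
Local Notation mt' := (mates b q C' S' S).

Lemma matesK (T : {set 'I_q}) : T \subset MM -> mt' (mt T) = T.
Proof.
move=> TM; apply/setP=> x; rewrite inE -[RHS]periodic_ord; apply/asboolP/idP.
  case=> y /(periodic_mates p_gt0 qq' C_stair S_period CS_flip) [x' Tx' x'y].
  by move=> /(mate_sym C'_stair CS_flop) /(mate_inj qq' C_stair CS_flip x'y) <-.
move=> Tx; have [y xy] := matched_mate S' (periodic_matched p_gt0 C_stair S_period TM Tx).
exists y; last exact: (mate_sym C_stair CS_flip).
by apply/(periodic_mates p_gt0 qq' C_stair S_period CS_flip); exists x%:Z.
Qed.

End MateInvolution.

Section MateCardinality.

Variables (b q q' p c : nat) (C C' : int -> int) (S S' : int -> bool).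
Hypothesis p_gt0 : (0 < p)%N.
Hypothesis qq' : (q + q' = b * p)%N.
Hypothesis C_stair : staircase b C q p.
Hypothesis S_period : forall i : int, S (i + p%:Z) = S i.
Hypothesis CS_flip : flip b C C' S S'.

Let C'_stair := flip_stair C_stair CS_flip qq'.
Let S'_period := flip_period CS_flip S_period.
Let q'q : (q' + q = b * p)%N. Proof. by rewrite addnC. Qed.
Let CS_flop := flip_sym CS_flip.
Local Notation MM := (matched_set b q C S).
Local Notation mt := (mates b q' C S S').

Lemma card_matesE (T : {set 'I_q}) : T \subset MM -> #|mt T| = #|T|.
Proof.
move=> TM; apply/eqP; rewrite eqn_leq (card_mates p_gt0 qq' C_stair S_period CS_flip) // andbT.
rewrite -[in leqRHS](matesK p_gt0 qq' C_stair S_period CS_flip TM).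
apply: (card_mates p_gt0 q'q C'_stair S'_period CS_flop).
exact: (mates_matched _ C_stair CS_flip).
Qed.

Lemma normal_compatb_matesE (T : {set 'I_q}) : T \subset MM ->
  normal_compatb b c C' S' (mt T) = normal_compatb b c C S T.
Proof.
move=> TM; apply/idP/idP; first exact: (normal_compatb_mates p_gt0 qq' C_stair S_period CS_flip).
rewrite -{1}(matesK p_gt0 qq' C_stair S_period CS_flip TM).
apply: (normal_compatb_mates p_gt0 q'q C'_stair S'_period CS_flop).
exact: (mates_matched _ C_stair CS_flip).
Qed.

End MateCardinality.

Section MateSums.

Variables (b q q' p c : nat) (C C' : int -> int) (S S' : int -> bool).
Hypothesis p_gt0 : (0 < p)%N.
Hypothesis qq' : (q + q' = b * p)%N.
Hypothesis C_stair : staircase b C q p.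
Hypothesis S_period : forall i : int, S (i + p%:Z) = S i.
Hypothesis CS_flip : flip b C C' S S'.

Let C'_stair := flip_stair C_stair CS_flip qq'.
Let S'_period := flip_period CS_flip S_period.
Let q'q : (q' + q = b * p)%N. Proof. by rewrite addnC. Qed.
Let CS_flop := flip_sym CS_flip.
Local Notation MM := (matched_set b q C S).
Local Notation MM' := (matched_set b q' C' S').
Local Notation mt := (mates b q' C S S').
Local Notation mt' := (mates b q C' S' S).

Lemma sum_matched (R : comPzRingType) (t : R) :
  \sum_(T : {set 'I_q} | (T \subset MM) && normal_compatb b c C S T) t ^+ #|T| =
  \sum_(T : {set 'I_q'} | (T \subset MM') && normal_compatb b c C' S' T) t ^+ #|T|.
Proof.
rewrite [RHS](reindex_onto (fun T : {set 'I_q} => mt T) (fun T => mt' T)) /=; last first.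
  by move=> T /andP[TM _]; apply: (matesK p_gt0 q'q C'_stair S'_period CS_flop).
apply: eq_big => [T|T /andP[TM _]]; last first.
  by rewrite (card_matesE p_gt0 qq' C_stair S_period CS_flip).
rewrite (mates_matched _ C_stair CS_flip) /=.
have [TM|nTM] := boolP (T \subset MM).
  rewrite (normal_compatb_matesE c p_gt0 qq' C_stair S_period CS_flip) //.
  by rewrite (matesK p_gt0 qq' C_stair S_period CS_flip) // eqxx andbT.
symmetry; apply/negP => /andP[_ /eqP E]; case/negP: nTM; rewrite -E.
exact: (mates_matched _ C'_stair CS_flop).
Qed.

Lemma card_matched : #|MM| = #|MM'|.
Proof.
apply/eqP; rewrite eqn_leq; apply/andP; split.
  rewrite -(card_matesE p_gt0 qq' C_stair S_period CS_flip (subxx MM)).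
  by apply: subset_leq_card; exact: (mates_matched _ C_stair CS_flip).
rewrite -(card_matesE p_gt0 q'q C'_stair S'_period CS_flop (subxx MM')).
by apply: subset_leq_card; exact: (mates_matched _ C'_stair CS_flop).
Qed.

Local Notation bl := (blocked C S).
Local Notation bl' := (blocked C' S').

Lemma scount_blocked_flip (j : int) :
  scount bl' (C' j) = b%:Z * scount S' j + C (- j) - scount bl (C (- j)).
Proof.
case: (CS_flip) => hC hS; case: (C_stair) => C0 _ _.
(* Block [z] of the flipped picture is block [- z - 1] of the original one, and
   exactly one of the two is blocked. *)
have st (z : int) : scount bl' (C' (z + 1)) - scount bl' (C' z) =
    (b%:Z * scount S' (z + 1) + C (- (z + 1)) - scount bl (C (- (z + 1)))) -
    (b%:Z * scount S' z + C (- z) - scount bl (C (- z))).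
  have := scount_blocked S' C'_stair z; have := scount_blocked S C_stair (- z - 1).
  rewrite subrK scountS hS.
  have -> : - (z + 1) = - z - 1 by clear; lia.
  have -> : C' (z + 1) = C' z + b%:Z + C (- z - 1) - C (- z).
    rewrite !hC; have -> : - (z + 1) = - z - 1 by clear; lia.
    by clear; lia.
  by case: (S _) => /=; clear; lia.
elim/int_updown_ind: j => [|z IH|z IH].
- by case: C'_stair => -> _ _; rewrite oppr0 C0 !scount0; clear; lia.
- by have := st z; clear -IH; lia.
- by have := st z; clear -IH; lia.
Qed.

(** Per period, the blocked edges of both pictures are the [l] edges of each
    selected block and the [b - l] edges of the flip of each unselected one; with
    [s] selected blocks and [q] edges altogether this adds up as stated. *)
Lemma card_blocked (s : nat) : scount S p%:Z = s%:Z ->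
  (#|blocked_set q' C' S'| + q + b * s = b * p + #|blocked_set q C S|)%N.
Proof.
move=> Ss; have := scount_blocked_flip p%:Z.
have Cp (D : int -> int) (r : nat) : staircase b D r p -> D p%:Z = r%:Z.
  by case=> D0 _ /(_ 0); rewrite D0 !add0r.
have Cn : C (- p%:Z) = - q%:Z.
  by case: C_stair => C0 _ /(_ (- p%:Z)); rewrite addNr C0; clear; lia.
have Gn : scount bl (- q%:Z) = - scount bl q%:Z.
  have := scount_period (- q%:Z) (blocked_shift C_stair S_period).
  by rewrite addNr scount0; clear; lia.
have Sn : scount S (- p%:Z) = - s%:Z.
  by have := scount_period (- p%:Z) S_period; rewrite addNr scount0 Ss; clear; lia.
rewrite (Cp _ _ C'_stair) Cn Gn (flip_scount CS_flip) Sn !scount_card.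
rewrite -/(blocked_set q' C' S') -/(blocked_set q C S) => E.
apply/eqP; rewrite -eqz_nat !PoszD !PoszM E; apply/eqP; clear.
by rewrite mulrBr opprK; ring.
Qed.

(** Both pictures have the same compatible selections of matched edges
    ([sum_matched]); the powers of [1 + t] compare the free edges, whose numbers
    follow from those of the matched and blocked ones. *)
Lemma flip_sum (R : comPzRingType) (t : R) (s : nat) : scount S p%:Z = s%:Z ->
  (1 + t) ^+ (b * s) * \sum_(T : {set 'I_q} | normal_compatb b c C S T) t ^+ #|T| =
  (1 + t) ^+ q * \sum_(T : {set 'I_q'} | normal_compatb b c C' S' T) t ^+ #|T|.
Proof.
move=> Ss; rewrite (sum_normal_compat c p_gt0 C_stair S_period).
rewrite (sum_normal_compat c p_gt0 C'_stair S'_period) sum_matched !mulrA -!exprD.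
congr (_ ^+ _ * _); have := card_parts S C_stair.
have := card_parts S' C'_stair; have := card_blocked Ss.
rewrite card_matched; move: qq'; clear.
lia.
Qed.

End MateSums.

(** * From cyclic subpaths to the unrolled path *)
Lemma mulz_between (z d : int) : - d < z * d < d -> z = 0.
Proof. by have [z_neg|z_pos|//] := ltgtP z 0; nia. Qed.

Section MaximalPath.

Variables a p : nat.
Local Notation n := (a + p)%N.

Lemma path_xDy (D : lattice_path a p) k : (k <= n)%N -> (path_x D k + path_y D k = k)%N.
Proof.
move=> kn; rewrite /path_x /path_y.
by have := count_predC id (take k D); rewrite size_takel ?size_tuple.
Qed.

Lemma path_xS (D : lattice_path a p) (e : 'I_n) :
  path_x D e.+1 = (path_x D e + tnth D e)%N.
Proof.
rewrite /path_x (take_nth true) ?size_tuple // -cats1 count_cat /= addn0.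
by rewrite (tnth_nth true).
Qed.

Lemma path_x_mono (D : lattice_path a p) k l : (k <= l <= n)%N -> (path_x D k <= path_x D l)%N.
Proof.
case/andP=> kl ln; elim: l kl ln => [|l IH] kl ln; first by move: kl; rewrite leqn0 => /eqP->.
move: kl; rewrite leq_eqVlt => /predU1P[->//|]; rewrite ltnS => kl.
apply: leq_trans (IH kl (ltnW ln)) _.
by rewrite (path_xS D (Ordinal ln)) leq_addr.
Qed.

Hypothesis n_gt0 : (0 < n)%N.

Lemma ycoord_bounds (m : int) : 0 <= m <= n%:Z -> 0 <= ycoord a p m <= p%:Z.
Proof.
move=> mn; have := ycoord_mono n_gt0 (m := 0) (m' := m) ltac:(lia).
have := ycoord_mono n_gt0 (m := m) (m' := n%:Z) ltac:(lia).
have := ycoord_period n_gt0 0; have -> : ycoord a p 0 = 0 by rewrite /ycoord mul0r div0z.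
by rewrite !add0r => -> ? ?; apply/andP.
Qed.

Lemma xcoord_bounds (m : int) : 0 <= m <= n%:Z -> 0 <= xcoord a p m <= a%:Z.
Proof.
move=> mn; have := xcoord_mono n_gt0 (m := 0) (m' := m) ltac:(lia).
have := xcoord_mono n_gt0 (m := m) (m' := n%:Z) ltac:(lia).
have := xcoord_period n_gt0 0.
have -> : xcoord a p 0 = 0 by rewrite /xcoord /ycoord mul0r div0z subr0.
by rewrite !add0r => -> ? ?; apply/andP.
Qed.

(** A Dyck path stays below the floor of the diagonal.  If it passed strictly
    below the point of the unrolled path on the line [x + y = k], this point
    would lie strictly above the path but not above the diagonal. *)
Lemma maximal_path_y (D : lattice_path a p) k : maximal_dyck_path D ->
  (k <= n)%N -> (path_y D k)%:Z = ycoord a p k%:Z.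
Proof.
case=> -[xn yn below] above kn.
have le_y l : (l <= n)%N -> (path_y D l)%:Z <= ycoord a p l%:Z.
  move=> ln; have := below l ln; rewrite /above_diagonal -leqNgt => h.
  have := path_xDy D ln => E.
  by rewrite /ycoord lez_divRL; [nia|lia].
apply/eqP; rewrite eq_le le_y //=.
have kb : 0 <= k%:Z <= n%:Z by lia.
have yb := ycoord_bounds kb; have xb := xcoord_bounds kb.
have o := onpath n_gt0 k%:Z; have xy := xcoordD_ycoord a p k%:Z.
move: yb xb o xy; set x := xcoord _ _ _; set y := ycoord _ _ _ => yb xb o xy.
(* The point [(x, y)] of the unrolled path is not above the diagonal, hence not
   strictly above [D]. *)
have [l [ln xl yl]] : exists l, [/\ (l <= n)%N, path_x D l = `|x|%N & (`|y|%N <= path_y D l)%N].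
  apply: contrapT => no.
  have ab : above_path D `|x|%N `|y|%N.
    move=> l ln xl; rewrite ltnNge; apply/negP => yl.
    by apply: no; exists l.
  have := above _ _ _ _ ab; rewrite /above_diagonal.
  by move=> /(_ ltac:(lia) ltac:(lia)); nia.
have kl : (k <= l)%N by have := path_xDy D ln; lia.
have := path_x_mono D (k := k) (l := l) ltac:(lia).
by have := path_xDy D kn; lia.
Qed.

Lemma maximal_tnth (D : lattice_path a p) : maximal_dyck_path D ->
  forall e : 'I_n, tnth D e = hor a p e%:Z.
Proof.
move=> HD e; have en := ltn_ord e.
have h1 := maximal_path_y HD (ltnW en); have h2 := maximal_path_y HD en.
have := path_xDy D en; have := path_xDy D (ltnW en); have := path_xS D e.
have E1 : (e.+1%:Z : int) = e%:Z + 1 by lia.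
rewrite E1 in h2.
have [h|h] := boolP (hor a p e%:Z).
  by rewrite ycoord_hor // in h2; case: (tnth D e) => //=; lia.
by rewrite ycoord_ver // in h2; case: (tnth D e) => //=; lia.
Qed.

(** Edges and points of the closed loop are residues of integers modulo the
    length of the loop. *)
Fact residue_subproof (m : int) : (`|(m %% n%:Z)%Z|%N < n)%N.
Proof.
have := @ltz_pmod m n%:Z; have := @modz_ge0 m n%:Z.
by move: (modz _ _) => r; lia.
Qed.

Definition residue (m : int) : 'I_n := Ordinal (residue_subproof m).

Lemma residueE (m : int) : (residue m : nat)%:Z = (m %% n%:Z)%Z.
Proof. by rewrite /= gez0_abs // modz_ge0 //; lia. Qed.

Lemma residue_divz (m : int) : m = (residue m : nat)%:Z + (m %/ n%:Z)%Z * n%:Z.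
Proof. by rewrite residueE addrC -divz_eq. Qed.

Lemma residue_ord (e : 'I_n) (z : int) : residue (e%:Z + z * n%:Z) = e.
Proof.
apply: val_inj; apply/eqP; rewrite -eqz_nat residueE addrC modzMDl modz_small //.
by have := ltn_ord e; lia.
Qed.

Lemma residueP (m m' : int) : residue m = residue m' -> exists z : int, m = m' + z * n%:Z.
Proof.
move=> E; exists ((m %/ n%:Z)%Z - (m' %/ n%:Z)%Z).
have := residue_divz m; have := residue_divz m'; rewrite E.
move: (nat_of_ord _) (divz m _) (divz m' _) => r z z' -> ->; ring.
Qed.

Lemma residue_shift (m z : int) : residue (m + z * n%:Z) = residue m.
Proof.
by rewrite {1}(residue_divz m) -addrA -mulrDl residue_ord.
Qed.

(** Each residue has a representative in any window of one period, which is how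
    the points of a cyclic subpath are lifted to the unrolled path. *)
Lemma residue_in (u : int) (e : 'I_n) :
  exists2 m : int, u <= m < u + n%:Z & residue m = e.
Proof.
have := divz_eq ((e : nat)%:Z - u) n%:Z.
have := @ltz_pmod ((e : nat)%:Z - u) n%:Z; have := @modz_ge0 ((e : nat)%:Z - u) n%:Z.
move: (divz _ _) (modz _ _) => z r r_ge0 r_lt E.
exists (u + r); first by lia.
have -> : u + r = (e : nat)%:Z + (- z) * n%:Z by move: E; clear; lia.
exact: residue_ord.
Qed.

Lemma offset_residue (u m : int) : u <= m < u + n%:Z ->
  (offset (residue u) (residue m))%:Z = m - u.
Proof.
move=> um; rewrite /offset -modz_nat -subzn; last first.
  by have := ltn_ord (residue u); lia.
rewrite PoszD !residueE.
have -> : (m %% n%:Z)%Z + n%:Z - (u %% n%:Z)%Z =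
   (1 - (m %/ n%:Z)%Z + (u %/ n%:Z)%Z) * n%:Z + (m - u).
  have := divz_eq m n%:Z; have := divz_eq u n%:Z.
  move: (modz m _) (modz u _) (divz m _) (divz u _) => m1 u1 m2 u2 -> ->; ring.
by rewrite modzMDl modz_small //; lia.
Qed.

Lemma ordS_residue (m : int) : ordS (residue m) = residue (m + 1).
Proof.
rewrite {2}(residue_divz m) addrAC residue_shift; move: (residue m) => e.
apply: val_inj; apply/eqP; rewrite -eqz_nat residueE /= -modz_nat.
by have -> : e.+1%:Z = (e : nat)%:Z + 1 by lia.
Qed.

(** The case [m = u + n] is the full loop from a point to itself. *)
Lemma subpath_length_residue (u m : int) : u < m <= u + n%:Z ->
  (subpath_length (residue u) (residue m))%:Z = m - u.
Proof.
move=> um; rewrite /subpath_length; have [E|ne] := eqVneq m (u + n%:Z).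
  by rewrite E -[n%:Z]mul1r residue_shift eqxx mul1r; lia.
case: ifP => [/eqP /esym/residueP[z E]|_].
  have z0 : z = 0 by apply: (@mulz_between z n%:Z); lia.
  by rewrite z0 mul0r addr0 in E; lia.
by rewrite offset_residue //; lia.
Qed.

Lemma card_subpath (Q : {set 'I_n}) (u m : int) : u < m <= u + n%:Z ->
  (#|subpath (residue u) (residue m) :&: Q|)%:Z =
  scount (fun i => residue i \in Q) m - scount (fun i => residue i \in Q) u.
Proof.
move=> um.
suff H : forall m : int, u <= m -> m <= u + n%:Z ->
    (#|[set e : 'I_n | (offset (residue u) e)%:Z < m - u] :&: Q|)%:Z =
    scount (fun i => residue i \in Q) m - scount (fun i => residue i \in Q) u.
  rewrite -H; [|lia|lia]; congr (Posz #|pred_of_set (_ :&: Q)|); apply/setP=> e.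
  by rewrite !inE -(subpath_length_residue um) ltz_nat.
apply: int_le_ind => [_|k uk IH kn].
  rewrite !subrr; have -> : [set e : 'I_n | (offset (residue u) e)%:Z < 0] = set0.
    by apply/setP=> e; rewrite !inE; lia.
  by rewrite set0I cards0.
have {}IH := IH ltac:(lia); rewrite scountS [RHS]addrAC -IH.
have -> : [set e : 'I_n | (offset (residue u) e)%:Z < k + 1 - u] =
    residue k |: [set e : 'I_n | (offset (residue u) e)%:Z < k - u].
  apply/setP=> e; rewrite !inE; have [m0 um0 <-] := residue_in u e.
  rewrite offset_residue //; have [->|ne] := eqVneq m0 k; first by rewrite eqxx; lia.
  case: eqP => [/residueP[z E]|_] /=; last first.
    by apply/idP/idP; lia.
  have z0 : z = 0 by apply: (@mulz_between z n%:Z); lia.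
  by rewrite E z0 mul0r addr0 eqxx in ne.
have nin : residue k \notin [set e : 'I_n | (offset (residue u) e)%:Z < k - u].
  by rewrite inE offset_residue ?ltxx //; lia.
rewrite setIUl; case: (boolP (residue k \in Q)) => kQ /=.
  rewrite (setIidPl _) ?sub1set // cardsU1 !inE kQ andbT.
  by rewrite inE in nin; rewrite nin add1n -addn1 PoszD.
rewrite (_ : [set residue k] :&: Q = set0) ?set0U ?addr0 //.
by apply/setP=> e; rewrite !inE; case: eqP => // ->; rewrite (negbTE kQ).
Qed.

End MaximalPath.

(** Number, along the path, of the left end of the horizontal edge of abscissa
    [x]; on the path its height is the floor of [x * p / a]. *)
Definition hpos (a p : nat) (x : int) : int := x + (x * p%:Z %/ a%:Z)%Z.
Section Positions.

Variables a p : nat.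
Hypothesis n_gt0 : (0 < a + p)%N.
Local Notation n := (a + p)%N.

Lemma hor_hpos (m : int) : hor a p m -> m = hpos a p (xcoord a p m).
Proof.
rewrite /hor => h; have := onpath n_gt0 m; have := xcoordD_ycoord a p m.
move: (xcoord a p m) (ycoord a p m) h => x y h <- o.
rewrite /hpos; congr (_ + _); symmetry.
apply: (@divz_uniq _ _ _ (x * p%:Z - y * a%:Z)); first by clear; lia.
by rewrite h andbT; case/andP: o.
Qed.

Lemma hpos_hor (x : int) : (0 < a)%N ->
  hor a p (hpos a p x) /\ xcoord a p (hpos a p x) = x.
Proof.
move=> a_gt0; have := divz_eq (x * p%:Z) a%:Z.
have := @ltz_pmod (x * p%:Z) a%:Z; have := @modz_ge0 (x * p%:Z) a%:Z.
rewrite /hor /hpos; move: (divz _ _) (modz _ _) => y r r_ge0 r_lt E.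
have o : 0 <= x * p%:Z - y * a%:Z < n%:Z by lia.
have ycE := ycoord_uniq n_gt0 o; rewrite ycE /xcoord ycE addrK; split=> //.
by lia.
Qed.

Lemma hpos_shift (x z : int) : (0 < a)%N -> hpos a p (x + z * a%:Z) = hpos a p x + z * n%:Z.
Proof.
move=> a_gt0; rewrite /hpos.
have -> : (x + z * a%:Z) * p%:Z = (z * p%:Z) * a%:Z + x * p%:Z by ring.
rewrite divzMDl; last by lia.
rewrite PoszD; ring.
Qed.

End Positions.

Lemma vpos_shift (a p : nat) (y z : int) : (0 < p)%N ->
  vpos a p (y + z * p%:Z) = vpos a p y + z * (a + p)%N%:Z.
Proof.
move=> p_gt0; have ceil_shift (j : int) : ceil a p (j + z * p%:Z) = ceil a p j + z * a%:Z.
  elim/int_updown_ind: z => [|z IH|z IH]; first by rewrite !mul0r !addr0.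
    by rewrite !mulrDl !mul1r !addrA ceil_period // IH.
  by move: IH; rewrite !mulrDl !mul1r !addrA ceil_period // => /addIr.
rewrite /vpos; have -> : y + z * p%:Z + 1 = y + 1 + z * p%:Z by clear; lia.
by rewrite ceil_shift PoszD; ring.
Qed.

Lemma periodic_setT (q : nat) (x : int) : (0 < q)%N -> periodic [set: 'I_q] x.
Proof.
move=> q_gt0; have x_lt : (`|(x %% q%:Z)%Z|%N < q)%N.
  have := @ltz_pmod x q%:Z; have := @modz_ge0 x q%:Z.
  by move: (modz _ _) => r; lia.
apply/exists_inP; exists (Ordinal x_lt); rewrite ?inE //=.
by rewrite gez0_abs // modz_ge0 //; lia.
Qed.

Section Edges.

Variables a p : nat.
Hypothesis n_gt0 : (0 < a + p)%N.
Local Notation n := (a + p)%N.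
Local Notation rd := (residue n_gt0).

Definition hedge (x : 'I_a) : 'I_n := rd (hpos a p (x : nat)%:Z).
Definition vedge (y : 'I_p) : 'I_n := rd (vpos a p (y : nat)%:Z).

Lemma mem_hedge (T : {set 'I_a}) (m : int) :
  (rd m \in hedge @: T) = hor a p m && periodic T (xcoord a p m).
Proof.
have hsh (i z : int) : hor a p (i + z * n%:Z) = hor a p i.
  by apply: periodic_mul => j; exact: hor_period.
have xsh (i z : int) : xcoord a p (i + z * n%:Z) = xcoord a p i + z * a%:Z.
  elim/int_updown_ind: z => [|z IH|z]; first by rewrite !mul0r !addr0.
    by rewrite !mulrDl !mul1r !addrA xcoord_period // IH.
  by rewrite !mulrDl !mul1r !addrA xcoord_period // => /addIr.
apply/imsetP/andP => [[x xT /residueP[z ->]]|[hm /periodicP[x [z [xT E]]]]].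
  have a_gt0 : (0 < a)%N := leq_ltn_trans (leq0n _) (ltn_ord x).
  have [h e] := hpos_hor n_gt0 x%:Z a_gt0.
  by rewrite hsh xsh h e; split=> //; apply/periodicP; exists x, z.
have a_gt0 : (0 < a)%N := leq_ltn_trans (leq0n _) (ltn_ord x).
exists x => //; rewrite (hor_hpos n_gt0 hm) E hpos_shift //.
exact: residue_shift.
Qed.

Lemma mem_vedge (S : {set 'I_p}) (m : int) :
  (rd m \in vedge @: S) = ~~ hor a p m && periodic S (ycoord a p m).
Proof.
have hsh (i z : int) : hor a p (i + z * n%:Z) = hor a p i.
  by apply: periodic_mul => j; exact: hor_period.
have ysh (i z : int) : ycoord a p (i + z * n%:Z) = ycoord a p i + z * p%:Z.
  elim/int_updown_ind: z => [|z IH|z]; first by rewrite !mul0r !addr0.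
    by rewrite !mulrDl !mul1r !addrA ycoord_period // IH.
  by rewrite !mulrDl !mul1r !addrA ycoord_period // => /addIr.
apply/imsetP/andP => [[y yS /residueP[z ->]]|[vm /periodicP[y [z [yS E]]]]].
  have p_gt0 : (0 < p)%N := leq_ltn_trans (leq0n _) (ltn_ord y).
  have [h e _] := vposP a p_gt0 y%:Z.
  by rewrite hsh ysh h e; split=> //; apply/periodicP; exists y, z.
have p_gt0 : (0 < p)%N := leq_ltn_trans (leq0n _) (ltn_ord y).
exists y => //; rewrite (ver_vpos p_gt0 vm) E vpos_shift //.
exact: residue_shift.
Qed.

Lemma hedge_inj : injective hedge.
Proof.
move=> x x' /residueP[z E].
have a_gt0 : (0 < a)%N := leq_ltn_trans (leq0n _) (ltn_ord x).
rewrite -hpos_shift // in E; have := congr1 (xcoord a p) E.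
have [_ ->] := hpos_hor n_gt0 x%:Z a_gt0.
have [_ ->] := hpos_hor n_gt0 (x'%:Z + z * a%:Z) a_gt0 => Ex.
apply/eqP; rewrite -(inj_eq val_inj) -eqz_nat.
have := ltn_ord x; have := ltn_ord x' => lx' lx.
by have z0 : z = 0 by [apply: (@mulz_between z a%:Z); lia]; rewrite Ex z0 mul0r addr0.
Qed.

Lemma vedge_inj : injective vedge.
Proof.
move=> y y' /residueP[z E].
have p_gt0 : (0 < p)%N := leq_ltn_trans (leq0n _) (ltn_ord y).
rewrite -vpos_shift // in E; have := congr1 (ycoord a p) E.
have [_ -> _] := vposP a p_gt0 y%:Z.
have [_ -> _] := vposP a p_gt0 (y'%:Z + z * p%:Z) => Ey.
apply/eqP; rewrite -(inj_eq val_inj) -eqz_nat.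
have := ltn_ord y; have := ltn_ord y' => ly' ly.
by have z0 : z = 0 by [apply: (@mulz_between z p%:Z); lia]; rewrite Ey z0 mul0r addr0.
Qed.

Variable D : lattice_path a p.
Hypothesis D_hor : forall e : 'I_n, tnth D e = hor a p (e : nat)%:Z.

Lemma tnth_residue (m : int) : tnth D (rd m) = hor a p m.
Proof.
rewrite D_hor [in RHS](residue_divz n_gt0 m).
by rewrite (periodic_mul (f := hor a p)) // => j; exact: hor_period.
Qed.

Lemma hedge_imset : hedge @: setT = horizontal D.
Proof.
apply/setP=> e; have [m _ <-] := residue_in n_gt0 0 e.
rewrite mem_hedge inE tnth_residue; apply: andb_idr => hm.
by apply: periodic_setT; move: hm; rewrite /hor; have := onpath n_gt0 m; lia.
Qed.

Lemma vedge_imset : vedge @: setT = vertical D.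
Proof.
apply/setP=> e; have [m _ <-] := residue_in n_gt0 0 e.
rewrite mem_vedge inE tnth_residue; apply: andb_idr => hm.
by apply: periodic_setT; move: hm; rewrite /hor; have := onpath n_gt0 m; lia.
Qed.

(** Each cardinality in the definition of compatibility is a difference of two
    values of a potential along the unrolled path. *)
Lemma compatible_residue b c (T : {set 'I_a}) (S : {set 'I_p}) :
  compatible b c D (hedge @: T) (vedge @: S) <->
  unrolled_compat a p b c (periodic T) (periodic S).
Proof.
have cntX (u m : int) : u <= m ->
    scount (fun i => rd i \in horizontal D) m - scount (fun i => rd i \in horizontal D) u =
    xcoord a p m - xcoord a p u.
  move: m; apply: int_le_ind => [|m um IH]; first by rewrite !subrr.
  rewrite scountS inE tnth_residue; have [h|h] := boolP (hor a p m).
    by rewrite xcoord_hor //= addrAC IH addrAC.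
  by rewrite xcoord_ver //= addr0.
have cntY (u m : int) : u <= m ->
    scount (fun i => rd i \in vertical D) m - scount (fun i => rd i \in vertical D) u =
    ycoord a p m - ycoord a p u.
  move: m; apply: int_le_ind => [|m um IH]; first by rewrite !subrr.
  rewrite scountS inE tnth_residue; have [h|h] := boolP (hor a p m).
    by rewrite ycoord_hor //= addr0.
  by rewrite ycoord_ver //= addrAC IH addrAC.
have cntT (u m : int) : u <= m ->
    scount (fun i => rd i \in horizontal D :&: hedge @: T) m -
    scount (fun i => rd i \in horizontal D :&: hedge @: T) u =
    scount (periodic T) (xcoord a p m) - scount (periodic T) (xcoord a p u).
  move: m; apply: int_le_ind => [|m um IH]; first by rewrite !subrr.
  rewrite scountS inE [rd m \in horizontal D]inE tnth_residue mem_hedge.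
  have [h|h] := boolP (hor a p m); last by rewrite xcoord_ver //= addr0.
  by rewrite xcoord_hor //= scountS addrAC IH addrAC.
have cntS' (u m : int) : u <= m ->
    scount (fun i => rd i \in vertical D :&: vedge @: S) m -
    scount (fun i => rd i \in vertical D :&: vedge @: S) u =
    scount (periodic S) (ycoord a p m) - scount (periodic S) (ycoord a p u).
  move: m; apply: int_le_ind => [|m um IH]; first by rewrite !subrr.
  rewrite scountS inE [rd m \in vertical D]inE tnth_residue mem_vedge.
  have [h|h] := boolP (hor a p m); first by rewrite ycoord_hor //= addr0.
  by rewrite ycoord_ver //= scountS addrAC IH addrAC.
have eq_cond (u v A : int) : u < A <= v -> v < u + n%:Z ->
  (#|subpath (rd A) (rd (v + 1)) :&: horizontal D| ==
     b * #|subpath (rd A) (rd (v + 1)) :&: vertical D :&: vedge @: S|)%N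
  || (#|subpath (rd u) (rd A) :&: vertical D| ==
     c * #|subpath (rd u) (rd A) :&: horizontal D :&: hedge @: T|)%N <->
  (xcoord a p A - b%:Z * scount (periodic S) (ycoord a p A) =
     xcoord a p (v + 1) - b%:Z * scount (periodic S) (ycoord a p (v + 1))
   \/ ycoord a p A - c%:Z * scount (periodic T) (xcoord a p A) =
      ycoord a p u - c%:Z * scount (periodic T) (xcoord a p u)).
  move=> uAv vu.
  have E1 := card_subpath n_gt0 (horizontal D) (u := A) (m := v + 1) ltac:(lia).
  have E2 := card_subpath n_gt0 (vertical D :&: vedge @: S) (u := A) (m := v + 1) ltac:(lia).
  have E3 := card_subpath n_gt0 (vertical D) (u := u) (m := A) ltac:(lia).
  have E4 := card_subpath n_gt0 (horizontal D :&: hedge @: T) (u := u) (m := A) ltac:(lia).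
  rewrite cntX ?cntY ?cntT ?cntS' in E1 E2 E3 E4; try lia.
  rewrite -!setIA -!eqz_nat !PoszM E1 E2 E3 E4.
  split=> [/orP[/eqP h|/eqP h]|[h|h]]; [left|right|apply/orP; left|apply/orP; right];
    rewrite ?(rwP eqP); move: h; clear; lia.
split=> H.
  move=> u v uv hu hv Tu Sv.
  have uS1 : rd u \in hedge @: T by rewrite mem_hedge hu.
  have vS2 : rd v \in vedge @: S by rewrite mem_vedge hv.
  move: H => /forall_inP/(_ _ uS1)/forall_inP/(_ _ vS2) /= /exists_inP[A].
  rewrite ordS_residue => A_in.
  have [m um Em] := residue_in n_gt0 u A; subst A.
  have [u_m m_v] : u < m /\ m <= v.
    move: A_in; rewrite inE => /and3P[le_m ne1 ne2].
    move: le_m; rewrite -lez_nat offset_residue // subpath_length_residue; last by lia.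
    have : m != u by apply: contra ne1 => /eqP->.
    have : m != v + 1 by apply: contra ne2 => /eqP->.
    by move: um; clear; lia.
  have uv2 : v < u + n%:Z by case/andP: uv.
  have umv : u < m <= v by rewrite u_m m_v.
  by move/(eq_cond u v m umv uv2); exists m.
apply/forall_inP => u uS1; apply/forall_inP => v vS2 /=.
have [u0 _ Eu] := residue_in n_gt0 0 u; subst u.
have [v0 uv Ev] := residue_in n_gt0 u0 v; subst v.
move: uS1 vS2; rewrite mem_hedge mem_vedge => /andP[hu Tu] /andP[hv Sv].
have [A uA HA] := H _ _ uv hu hv Tu Sv.
apply/exists_inP; exists (rd A); last first.
  by rewrite ordS_residue; apply/(eq_cond u0 v0 A uA); first by lia.
rewrite ordS_residue inE -lez_nat offset_residue ?subpath_length_residue; try lia.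
apply/and3P; split; first by lia.
  apply/eqP => /residueP[z E].
  have z0 : z = 0 by apply: (@mulz_between z n%:Z); lia.
  by rewrite E z0 mul0r addr0 ltxx in uA.
apply/eqP => /residueP[z E].
have z0 : z = 0 by apply: (@mulz_between z n%:Z); lia.
by rewrite E z0 mul0r addr0 in uA; lia.
Qed.

Lemma sum_compatible (R : nmodType) (b c : nat) (F : nat -> nat -> R) :
  \sum_(X : {set 'I_n} * {set 'I_n} | [&& X.1 \subset horizontal D,
      X.2 \subset vertical D & compatible b c D X.1 X.2]) F #|X.1| #|X.2| =
  \sum_(S : {set 'I_p}) \sum_(T : {set 'I_a} |
      `[< unrolled_compat a p b c (periodic T) (periodic S) >]) F #|T| #|S|.
Proof.
rewrite [RHS](exchange_big_dep predT) //= [RHS]pair_big_dep /=.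
have pre (k : nat) (g : 'I_k -> 'I_n) (Y : {set 'I_n}) :
    Y \subset g @: setT -> g @: (g @^-1: Y) = Y.
  move=> /subsetP Yg; apply/setP=> e; apply/imsetP/idP => [[x + ->]|eY].
    by rewrite inE.
  by have /imsetP[x _ E] := Yg _ eY; exists x; rewrite ?inE -?E.
rewrite (reindex_onto (fun X : {set 'I_a} * {set 'I_p} => (hedge @: X.1, vedge @: X.2))
   (fun X => (hedge @^-1: X.1, vedge @^-1: X.2))) /=; last first.
  move=> [Y Z] /= /and3P[YH ZV _].
  by rewrite !pre ?hedge_imset ?vedge_imset.
apply: eq_big => [[T S] /=|[T S] _ /=]; last first.
  by rewrite !card_imset //; [exact: vedge_inj|exact: hedge_inj].
have pk (k : nat) (g : 'I_k -> 'I_n) (Y : {set 'I_k}) : injective g -> g @^-1: (g @: Y) = Y.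
  by move=> gi; apply/setP=> x; rewrite inE mem_imset.
rewrite !pk; [|exact: vedge_inj|exact: hedge_inj].
rewrite eqxx andbT -hedge_imset -vedge_imset !imsetS ?subsetT //=.
by apply/idP/asboolP => /compatible_residue.
Qed.

End Edges.

(** * The generating polynomial of compatible pairs *)

(** At [w1 = x1 ^ b * y2] and [w2 = x2 ^ c / y1], and for the [a] and [p] of a
    d-vector, its value is a cluster variable up to a Laurent monomial. *)
Definition greedy (R : comPzRingType) (a p b c : nat) (w1 w2 : R) : R :=
  \sum_(S : {set 'I_p}) \sum_(T : {set 'I_a} |
    `[< unrolled_compat a p b c (periodic T) (periodic S) >]) w1 ^+ #|S| * w2 ^+ #|T|.

Lemma periodic0 (T : {set 'I_0}) (x : int) : periodic T x = false.
Proof. by apply/exists_inP => -[[]]. Qed.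

Lemma ord0_set (T : {set 'I_0}) : T = set0.
Proof. by apply/setP=> -[]. Qed.

Lemma sum_set_exp (R : comPzRingType) (I : finType) (t : R) :
  \sum_(T : {set I}) t ^+ #|T| = (1 + t) ^+ #|I|.
Proof.
rewrite -cardsT -(sum_subset_exp setT).
by apply: eq_bigl => T; rewrite subsetT.
Qed.

Lemma big_set_ord0 (R : nmodType) (F : {set 'I_0} -> R) : \sum_(T : {set 'I_0}) F T = F set0.
Proof.
rewrite (bigD1 set0) //= big1 ?addr0 // => T.
by rewrite [T]ord0_set eqxx.
Qed.

Lemma greedy_0l (R : comPzRingType) (p b c : nat) (w1 w2 : R) :
  greedy 0 p b c w1 w2 = (1 + w1) ^+ p.
Proof.
rewrite /greedy -[in RHS](card_ord p) -sum_set_exp; apply: eq_bigr => S _.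
rewrite (eq_bigl predT) ?big_set_ord0 ?cards0 ?mulr1 // => T.
by apply/asboolP => u v _ _ _; rewrite periodic0.
Qed.

Lemma periodic_rev (q : nat) (T : {set 'I_q}) (x : int) :
  periodic (@rev_ord q @^-1: T) x = periodic T (- x - 1).
Proof.
apply/periodicP/periodicP => -[i [z [iT E]]].
  exists (rev_ord i), (- z - 1); rewrite inE in iT; split=> //.
  by rewrite E /=; have := ltn_ord i; move: (nat_of_ord i) => k; nia.
exists (rev_ord i), (- z - 1); rewrite inE rev_ordK; split=> //.
have -> : x = - (- x - 1) - 1 by clear; lia.
by rewrite E /=; have := ltn_ord i; move: (nat_of_ord i) => k; nia.
Qed.

Lemma periodic_setC (q : nat) (T : {set 'I_q}) (x : int) : (0 < q)%N ->
  periodic (~: T) x = ~~ periodic T x.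
Proof.
move=> q_gt0.
have [i [z ->]] : exists (i : 'I_q) (z : int), x = (i : nat)%:Z + z * q%:Z.
  have x_lt : (`|(x %% q%:Z)%Z|%N < q)%N.
    have := @ltz_pmod x q%:Z; have := @modz_ge0 x q%:Z.
    by move: (modz _ _) => r; lia.
  exists (Ordinal x_lt), (x %/ q%:Z)%Z.
  by rewrite /= gez0_abs ?modz_ge0 //; [rewrite addrC -divz_eq|lia].
by rewrite !(periodic_mul _ _ (periodic_shift _)) !periodic_ord inE.
Qed.

Lemma rev_setK (q : nat) : involutive (fun T : {set 'I_q} => @rev_ord q @^-1: T).
Proof. by move=> T; apply/setP=> x; rewrite !inE rev_ordK. Qed.

Lemma card_rev (q : nat) (T : {set 'I_q}) : #|@rev_ord q @^-1: T| = #|T|.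
Proof. by rewrite on_card_preimset //; exists (@rev_ord q) => x _; rewrite rev_ordK. Qed.

Lemma unrolled_compat_rev (a p b c : nat) (T : {set 'I_a}) (S : {set 'I_p}) :
  unrolled_compat a p b c (periodic T) (periodic S) ->
  unrolled_compat p a c b (periodic (@rev_ord p @^-1: S)) (periodic (@rev_ord a @^-1: T)).
Proof.
case: (posnP (a + p)) => [n0 _ u v|n_gt0 H]; first by rewrite addnC n0; lia.
have := unrolled_compat_mirror n_gt0 H.
have -> : periodic (@rev_ord p @^-1: S) = (fun i => periodic S (- i - 1)).
  by apply/funext => x; rewrite periodic_rev.
have -> // : periodic (@rev_ord a @^-1: T) = (fun i => periodic T (- i - 1)).
by apply/funext => x; rewrite periodic_rev.
Qed.

Lemma greedy_sym (R : comPzRingType) (a p b c : nat) (w1 w2 : R) :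
  greedy a p b c w1 w2 = greedy p a c b w2 w1.
Proof.
rewrite /greedy (exchange_big_dep predT) //=.
rewrite (reindex_inj (inv_inj (@rev_setK a))) /=; apply: eq_bigr => T _.
rewrite (reindex_inj (inv_inj (@rev_setK p))) /=; apply: eq_big => [S|S _]; last first.
  by rewrite !card_rev mulrC.
by apply/asboolP/asboolP => /unrolled_compat_rev; rewrite ?rev_setK.
Qed.

Lemma greedy_0r (R : comPzRingType) (a b c : nat) (w1 w2 : R) :
  greedy a 0 b c w1 w2 = (1 + w2) ^+ a.
Proof. by rewrite greedy_sym greedy_0l. Qed.

(** The maximal Dyck path of type [q' * p] is the flip of the one of type
    [q * p]. *)
Lemma ceil_flip (b q q' p : nat) (j : int) : (0 < p)%N -> (q + q' = b * p)%N ->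
  ceil q' p j = b%:Z * j + ceil q p (- j).
Proof.
move=> p_gt0 qq'; rewrite /ceil.
have -> : - (j * q'%:Z) = (- (b%:Z * j)) * p%:Z + - (- j * q%:Z).
  have : q%:Z + q'%:Z = b%:Z * p%:Z by rewrite -PoszD -PoszM qq'.
  by move=> /(canRL (addKr _)) ->; ring.
by rewrite divzMDl ?opprD ?opprK //; lia.
Qed.

Definition flip_set (p : nat) (S : {set 'I_p}) : {set 'I_p} := ~: (@rev_ord p @^-1: S).

Lemma flip_setK (p : nat) : involutive (@flip_set p).
Proof. by move=> S; apply/setP=> x; rewrite !inE rev_ordK negbK. Qed.

(** For each vertical selection [S] the left-hand term of [S] equals the
    right-hand term of its reversed complement: [flip_sum] compares the sums over
    the horizontal selections, and the [#|S|] factors [1 + w2] to the power [b]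
    that it produces are absorbed by [w1 * w3]. *)
Lemma greedy_mutation (R : comPzRingType) (b c p q q' : nat) (w1 w2 w3 : R) :
  (0 < p)%N -> (q + q' = b * p)%N -> ((0 < b) ==> (0 < c))%N ->
  w1 * w3 = (1 + w2) ^+ b ->
  w1 ^+ p * greedy q p b c w3 w2 = (1 + w2) ^+ q * greedy q' p b c w1 w2.
Proof.
move=> p_gt0 qq' bc w13; have [b0|b_gt0] := posnP b.
  subst b; rewrite mul0n in qq'; move/eqP: qq'; rewrite addn_eq0 => /andP[/eqP-> /eqP->].
  rewrite !greedy_0l expr0 mul1r -exprMn mulrDr mulr1 w13 expr0 addrC //.
have c_gt0 : (0 < c)%N by rewrite b_gt0 in bc.
rewrite /greedy !mulr_sumr [RHS](reindex_inj (inv_inj (@flip_setK p))) /=.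
apply: eq_bigr => S _.
have qbp : (q <= b * p)%N by rewrite -qq' leq_addr.
have q'bp : (q' <= b * p)%N by rewrite -qq' leq_addl.
have stair : staircase b (ceil q p) q p by exact: ceil_staircase.
have CSf : flip b (ceil q p) (ceil q' p) (periodic S) (periodic (flip_set S)).
  split=> j; first exact: ceil_flip.
  by rewrite periodic_setC // periodic_rev.
have := flip_sum c p_gt0 qq' stair (periodic_shift S) CSf w2 (scount_periodic S).
have normal (r : nat) (T : {set 'I_r}) (S0 : {set 'I_p}) : (r <= b * p)%N ->
    `[< unrolled_compat r p b c (periodic T) (periodic S0) >] =
    normal_compatb b c (ceil r p) (periodic S0) T.
  move=> rbp; apply/asboolP/asboolP.
    exact: (unrolled_to_normal p_gt0 b_gt0 c_gt0 rbp (periodic_shift S0)).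
  exact: (normal_to_unrolled p_gt0 b_gt0 c_gt0 rbp).
rewrite (eq_bigl _ _ (fun T => normal q T S qbp)).
rewrite (eq_bigl _ _ (fun T => normal q' T (flip_set S) q'bp)).
rewrite -!mulr_sumr; move: (\sum_(_ | _) _) (\sum_(_ | _) _) => G G' GG'.
have -> : w1 ^+ p = w1 ^+ #|flip_set S| * w1 ^+ #|S|.
  rewrite -exprD; congr (w1 ^+ _); have := cardsC (@rev_ord p @^-1: S).
  by rewrite card_rev card_ord addnC => ->.
by rewrite mulrA -[_ * _ * w3 ^+ _]mulrA -exprMn w13 -exprM -mulrA GG' mulrCA.
Qed.

(** * Expansion in the initial cluster *)

(** The d-vector of the variable reached after [m.+1] mutations, the first one
    at index 1.  The recursion moves the initial seed instead of the final
    variable: seen from the next seed, the exponents [b] and [c] are exchanged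
    and [m] mutations remain. *)
Fixpoint dvec (m b c : nat) : nat * nat :=
  if m is m'.+1 then let v := dvec m' c b in ((b * v.1 - v.2)%N, v.1) else (1%N, 0%N).

(** No truncation occurs in the subtractions of [dvec].  The positivity of [v.1]
    says that the path to which [greedy_mutation] is applied has a vertical
    edge. *)
Fixpoint dvec_exact (m b c : nat) : bool :=
  if m is m'.+1 then
    let v := dvec m' c b in [&& dvec_exact m' c b, (0 < v.1)%N & (v.2 <= b * v.1)%N]
  else true.

Definition tail_seq (A : Type) (f : nat -> A) (i : nat) : A := f i.+1.

(** The monomial in the coefficients that accumulates when the initial seed is
    moved through the pattern, for the exchange relations of
    [cluster_formula]. *)
Fixpoint norm_factor (K : fieldType) (m b c : nat) (beta delta : nat -> K) : K :=
  if m is m'.+1 then let v := dvec m' c b in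
    norm_factor m' c b (tail_seq beta) (tail_seq delta) * beta 0%N ^+ v.1 / delta 1%N ^+ v.2
  else delta 1%N.

Definition exponent (b c i : nat) : nat := if odd i then c else b.

Lemma exponentS b c i : exponent c b i.+1 = exponent b c i.
Proof. by rewrite /exponent /=; case: (odd i). Qed.

(** By induction the formula holds in the cluster [(x 1, x 2)], for the shifted
    sequences.  Eliminating [x 2] by its exchange relation with [x 0] and
    applying [greedy_mutation] gives the formula in the cluster [(x 0, x 1)].
    The sequence [w] satisfies the recursion of the mutation of the ratios of the
    two monomials of an exchange relation, [beta] relates it to the cluster
    variables and [delta] is the coefficient of one of the two monomials. *)
Lemma cluster_formula (K : fieldType) (m b c : nat) (x w beta delta : nat -> K) :
  (forall i, x i != 0) -> (forall i, w i != 0) -> (forall i, delta i != 0) ->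
  (forall i, (i <= m)%N -> x i.+2 * x i = delta i.+1 * (1 + w i.+1)) ->
  (forall i, (i < m)%N -> w i.+2 * w i = (1 + w i.+1) ^+ exponent b c i) ->
  (forall i, (i < m)%N -> x i ^+ exponent b c i = w i * beta i) ->
  (0 < b)%N = (0 < c)%N -> dvec_exact m b c ->
  x m.+2 = norm_factor m b c beta delta
    * greedy (dvec m b c).1 (dvec m b c).2 b c (w 0%N) (w 1%N)
    / (x 0%N ^+ (dvec m b c).1 * x 1%N ^+ (dvec m b c).2).
Proof.
move=> xn0 wn0 dn0 xrec wrec xw bc.
elim: m b c x w beta delta xn0 wn0 dn0 xrec wrec xw bc
  => [|m IH] b c x w beta delta xn0 wn0 dn0 xrec wrec xw bc.
  move=> _ /=; rewrite greedy_0r expr0 mulr1 !expr1 -xrec //.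
  by rewrite mulfK.
rewrite [dvec_exact _ _ _]/= => /and3P[good p_gt0 qbp].
have := IH c b (tail_seq x) (tail_seq w) (tail_seq beta) (tail_seq delta)
  (fun i => xn0 i.+1) (fun i => wn0 i.+1) (fun i => dn0 i.+1).
have xrec' i : (i <= m)%N ->
    tail_seq x i.+2 * tail_seq x i = tail_seq delta i.+1 * (1 + tail_seq w i.+1).
  by move=> im; apply: xrec.
have wrec' i : (i < m)%N ->
    tail_seq w i.+2 * tail_seq w i = (1 + tail_seq w i.+1) ^+ exponent c b i.
  by move=> im; rewrite -exponentS; apply: wrec.
have xw' i : (i < m)%N -> tail_seq x i ^+ exponent c b i = tail_seq w i * tail_seq beta i.
  by move=> im; rewrite -exponentS; apply: xw.
move=> /(_ xrec' wrec' xw' (esym bc) good).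
rewrite {IH xrec' wrec' xw' good} [dvec m.+1 b c]/= [norm_factor m.+1 b c _ _]/=.
case: (dvec m c b) p_gt0 qbp => p q /= p_gt0 qbp.
rewrite /tail_seq => ->; rewrite greedy_sym.
have qq' : (q + (b * p - q) = b * p)%N by rewrite subnKC.
have bc' : ((0 < b) ==> (0 < c))%N by rewrite bc implybb.
have w02 := wrec 0%N isT; rewrite /exponent /= mulrC in w02.
have := greedy_mutation p_gt0 qq' bc' w02.
have U0 : 1 + w 1%N != 0.
  apply: contra (xn0 2%N) => /eqP u0; have /eqP := xrec 0%N isT.
  by rewrite u0 mulr0 mulf_eq0 (negbTE (xn0 0%N)) orbF.
have b0 : beta 0%N != 0.
  have := xw 0%N isT; rewrite /exponent /= => E.
  by apply: contra (expf_neq0 b (xn0 0%N)) => /eqP z; rewrite E z mulr0.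
(* The two ways of expressing powers of [x 0] that remain after eliminating
   [x 2]: by [w 0] and by the exchange relation. *)
have E1 : x 0%N ^+ (b * p - q) * x 0%N ^+ q = w 0%N ^+ p * beta 0%N ^+ p.
  by rewrite -exprD subnK // exprM (xw 0%N isT) exprMn.
have E2 : x 2%N ^+ q * x 0%N ^+ q = delta 1%N ^+ q * (1 + w 1%N) ^+ q.
  by rewrite -!exprMn xrec.
move: (greedy _ _ _ _ _ _) (greedy _ _ _ _ _ _) (norm_factor _ _ _ _ _) => G' G M.
move: E1 E2 (expf_neq0 q (xn0 2%N)) (expf_neq0 q (xn0 0%N)) (expf_neq0 q U0)
  (expf_neq0 p (wn0 0%N)) (expf_neq0 p b0) (expf_neq0 q (dn0 1%N))
  (expf_neq0 p (xn0 1%N)) (expf_neq0 (b * p - q) (xn0 0%N)).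
move: (x 2%N ^+ q) (x 0%N ^+ q) ((1 + w 1%N) ^+ q) (w 0%N ^+ p) (beta 0%N ^+ p)
  (delta 1%N ^+ q) (x 1%N ^+ p) (x 0%N ^+ (b * p - q)).
move=> X2 X0 U W B Dq X1 A E1 E2 X2n X0n Un Wn Bn Dn X1n An E3.
have -> : G = U * G' / W by apply: (canRL (mulfK _)) => //; rewrite mulrC.
have -> : X2 = Dq * U / X0 by apply: (canRL (mulfK _)).
have -> : A = W * B / X0 by apply: (canRL (mulfK _)).
by field; do ?(apply/andP; split).
Qed.

(** If both coefficient sequences agree and obey the recursion of the d-vectors,
    written multiplicatively, the accumulated monomial collapses. *)
Lemma norm_factor_regular (K : fieldType) (m b c : nat) (beta delta : nat -> K) :
  (forall i, beta i != 0) -> (forall i, delta i.+1 = beta i.+1) ->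
  (forall i, (i < m)%N -> beta i.+2 * beta i = beta i.+1 ^+ exponent b c i) ->
  dvec_exact m b c -> norm_factor m b c beta delta = beta 1%N ^+ (dvec m b c).1.
Proof.
move=> bn0; elim: m b c beta delta bn0 => [|m IH] b c beta delta bn0 db brec.
  by rewrite /= expr1 db.
rewrite [dvec_exact _ _ _]/= => /and3P[good p_gt0 qbp].
rewrite [norm_factor _ _ _ _ _]/= (IH c b (tail_seq beta) (tail_seq delta)) //.
- rewrite [dvec m.+1 b c]/=; case: (dvec m c b) p_gt0 qbp => p q /= p_gt0 qbp.
  rewrite /tail_seq db -exprMn (brec 0%N) // /exponent /= -exprM.
  by apply: (canLR (mulfK (expf_neq0 q (bn0 1%N)))); rewrite -exprD subnK.
- by move=> i; apply: bn0.
- by move=> i; apply: db.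
- by move=> i im; rewrite -exponentS; apply: brec.
Qed.

Lemma dvecS (m b c : nat) : dvec m.+1 b c =
  ((b * (dvec m c b).1 - (dvec m c b).2)%N, (dvec m c b).1).
Proof. by []. Qed.

Definition dvec_exact_upto (m b c : nat) : Prop :=
  forall i, (i <= m)%N -> dvec_exact i b c && dvec_exact i c b.

Lemma dvec_exact_upto_sym m b c : dvec_exact_upto m b c -> dvec_exact_upto m c b.
Proof. by move=> H i im; rewrite andbC H. Qed.

Lemma dvec_exact_le m b c : dvec_exact_upto m.+1 b c ->
  [/\ (0 < (dvec m c b).1)%N, ((dvec m c b).2 <= b * (dvec m c b).1)%N & dvec_exact_upto m b c].
Proof.
move=> H; split; try by have /andP[/= /and3P[]] := H m.+1 (leqnn _).
by move=> i im; apply: H; apply: leqW.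
Qed.

(** The d-vectors also obey the recursion that comes from mutating the final
    cluster, which is the one seen by the coefficients. *)
Lemma dvec_rec (m b c : nat) : dvec_exact_upto m.+2 b c ->
  ((dvec m.+2 b c).1 + (dvec m b c).1 = exponent b c m.+1 * (dvec m.+1 b c).1)%N /\
  ((dvec m.+2 b c).2 + (dvec m b c).2 = exponent b c m.+1 * (dvec m.+1 b c).2)%N.
Proof.
elim: m b c => [|m IH] b c H.
  have [_ le _] := dvec_exact_le H; rewrite /= in le.
  rewrite /= muln1 subn0 in le.
  by rewrite /exponent /= !muln1 !subn0 addn0; split=> //; rewrite subnK // mulnC.
have [_ le2 H2] := dvec_exact_le H; have [_ le1 H1] := dvec_exact_le H2.
have [_ le0 _] := dvec_exact_le H1.
have [E1 E2] := IH c b (dvec_exact_upto_sym H2).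
rewrite [exponent b c _]exponentS -/(exponent c b m.+1) in E1 E2 *.
rewrite !(dvecS _ b c).
move: E1 E2 le2 le1 le0; move: (exponent _ _ _) => e.
move: (dvec m.+2 c b) (dvec m.+1 c b) (dvec m c b) => [p2 q2] [p1 q1] [p0 q0] /=.
move=> E1 E2 le2 le1 le0; split=> //.
have : (b * p2 + b * p0 = e * (b * p1))%N by rewrite -mulnDr E1 mulnCA.
have : (e * q1 <= e * (b * p1))%N by rewrite leq_mul2l le1 orbT.
rewrite mulnBr; move: (e * (b * p1))%N (e * q1)%N (b * p2)%N (b * p0)%N E2 le2 le0.
by move=> u1 u2 u3 u4; clear; lia.
Qed.

(** The invariant [b * v.2 <= 2 * v.1] is inherited if [b * c >= 4]: for the
    d-vector [(p, q)] seen from the next seed, [c * q <= 2 * p] gives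
    [4 * q <= b * c * q <= 2 * b * p], hence [b * p <= 2 * (b * p - q)]. *)
Lemma dvec_exact_infinite (b c : nat) : (4 <= b * c)%N -> forall m, dvec_exact_upto m b c.
Proof.
move=> bc4 m; suff H n b' c' : (4 <= b' * c')%N ->
    [/\ dvec_exact n b' c', (0 < (dvec n b' c').1)%N
      & (b' * (dvec n b' c').2 <= 2 * (dvec n b' c').1)%N].
  by move=> i _; have [->] := H i _ _ bc4; rewrite mulnC in bc4; have [->] := H i _ _ bc4.
elim: n b' c' => [|n IH] b' c' bc; first by rewrite /= muln0.
have := IH c' b'; rewrite mulnC => /(_ bc) [good].
rewrite [dvec_exact n.+1 _ _]/= [dvec n.+1 _ _]/= good.
case: (dvec n c' b') => p q /= p_gt0 le.
have le' : (2 * q <= b' * p)%N by nia.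
by split; [rewrite p_gt0 /=; lia|nia|lia].
Qed.

(** The weights are the ratios of the two monomials of the exchange relations;
    their recursion follows from the exchange relation itself. *)
Lemma cluster_formula_exchange (K : fieldType) (m b c : nat) (x beta delta : nat -> K) :
  (forall i, x i != 0) -> (forall i, beta i != 0) -> (forall i, delta i != 0) ->
  (forall i, (i <= m)%N ->
     x i.+2 * x i = delta i.+1 * (1 + x i.+1 ^+ exponent b c i.+1 / beta i.+1)) ->
  (forall i, (i < m)%N -> beta i.+2 * beta i = delta i.+1 ^+ exponent b c i) ->
  (0 < b)%N = (0 < c)%N -> dvec_exact m b c ->
  x m.+2 = norm_factor m b c beta delta
    * greedy (dvec m b c).1 (dvec m b c).2 b c (x 0%N ^+ b / beta 0%N) (x 1%N ^+ c / beta 1%N)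
    / (x 0%N ^+ (dvec m b c).1 * x 1%N ^+ (dvec m b c).2).
Proof.
move=> xn0 bn0 dn0 xrec brec bc good.
pose w i := x i ^+ exponent b c i / beta i.
have wn0 i : w i != 0 by rewrite mulf_neq0 ?invr_neq0 ?expf_neq0.
apply: (cluster_formula (w := w) xn0 wn0 dn0 xrec _ _ bc good) => i im.
  have D0 : delta i.+1 ^+ exponent b c i != 0 by rewrite expf_neq0.
  apply: (mulfI D0); rewrite -exprMn -xrec ?(ltnW im) // exprMn -brec // /w /exponent /=.
  rewrite negbK; move: (x _ ^+ _) (x _ ^+ _) => u v.
  by field; rewrite !bn0.
by rewrite /w mulfVK.
Qed.

Lemma factor_out (K : fieldType) (u v : K) : u != 0 -> u + v = u * (1 + v / u).
Proof. by move=> u0; rewrite mulrDr mulr1 mulrCA divff ?mulr1. Qed.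

Lemma exchange_clear (K : fieldType) (u v w : K) : u != 0 -> w != 0 ->
  (u^-1 * v + 1) / (u^-1 * w) * w = u + v.
Proof. by move=> u0 w0; field; rewrite u0 w0. Qed.

(** If [b * c < 4], the recursion soon comes to [(1, c)] and [(0, 1)], the
    d-vectors of the variables obtained by the first two mutations in the other
    direction.  The resulting period [k.+4] is 4, 5, 6, 8 for [b * c] equal to
    0, 1, 2, 3; if it is odd, the indices come back exchanged, which the symmetry
    [b = c] allows. *)
Lemma finite_types (b c : nat) : (b * c < 4)%N -> (0 < b)%N = (0 < c)%N ->
  exists k, [/\ dvec_exact_upto k.+1 b c, dvec k b c = (1, c)%N, dvec k.+1 b c = (0, 1)%N
    & odd k -> b = c].
Proof.
have all_le (P : pred nat) (n : nat) : all P (iota 0 n.+1) -> forall i, (i <= n)%N -> P i.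
  by move=> /allP H i ni; apply: H; rewrite mem_iota.
case: b => [|[|[|[|b]]]]; case: c => [|[|[|[|c]]]] // bc4 _.
- by exists 0%N; split=> //; apply: all_le.
- by exists 1%N; split=> //; apply: all_le.
- by exists 2%N; split=> //; apply: all_le.
- by exists 4%N; split=> //; apply: all_le.
- by exists 2%N; split=> //; apply: all_le.
- by exists 4%N; split=> //; apply: all_le.
Qed.

(** * The cluster pattern as a sequence of states *)
Definition other (k : 'I_2) : 'I_2 := if k == ix1 then ix2 else ix1.

Lemma otherK : involutive other.
Proof. by case=> [[|[|//]] i]; apply/val_inj. Qed.

Lemma ord2P (k j : 'I_2) : j = k \/ j = other k.
Proof.
by case: k j => [[|[|//]] ki] [[|[|//]] ji]; [left|right|right|left]; apply/val_inj.
Qed.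

Lemma other_neq (k : 'I_2) : (other k == k) = false.
Proof. by case: k => [[|[|//]] i]. Qed.

Lemma prod2 (R : comPzRingType) (F : 'I_2 -> R) (k : 'I_2) :
  \prod_(i < 2) F i = F k * F (other k).
Proof.
rewrite big_ord_recl big_ord1 /=.
have -> : lift ord0 ord0 = ix2 by apply/val_inj.
by case: (ord2P ix1 k) => ->; rewrite ?[F (other (other _))]f_equal ?otherK // mulrC.
Qed.

(** A seed with its two indices ordered by the direction of travel: the first one
    is the next to be mutated.  Along the tree the two indices alternate, and so
    all mutations become one and the same map [step]. *)
Record state := State {
  var1 : FF; var2 : FF; coef1 : trop; coef2 : trop; ent1 : int; ent2 : int }.

Definition seed_state (s : seed) (k : 'I_2) : state :=
  State (cluster s k) (cluster s (other k)) (coeffs s k) (coeffs s (other k))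
        (exchange s (other k) k) (exchange s k (other k)).

Definition rev_state (s : state) : state :=
  State (var2 s) (var1 s) (coef2 s) (coef1 s) (ent2 s) (ent1 s).

Definition step (s : state) : state :=
  State (var2 s)
    ((trop_FF (coef1 s) * var2 s ^ pos_part (ent1 s) + var2 s ^ pos_part (- ent1 s))
       / (trop_FF (trop_oplus (coef1 s) trop_one) * var1 s))
    (trop_mul (trop_mul (coef2 s) (trop_exp (coef1 s) (pos_part (ent2 s))))
       (trop_exp (trop_oplus (coef1 s) trop_one) (- ent2 s)))
    (trop_exp (coef1 s) (- 1)) (- ent2 s) (- ent1 s).

Lemma rev_stateK : involutive rev_state. Proof. by case. Qed.

Lemma seed_state_other (s : seed) (k : 'I_2) :
  seed_state s (other k) = rev_state (seed_state s k).
Proof. by rewrite /seed_state /rev_state otherK. Qed.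

Lemma skew_diag (B : 'M[int]_2) (k : 'I_2) : skew_symmetrizable B -> B k k = 0.
Proof.
case=> s [s_gt0 /matrixP/(_ k k)]; rewrite !mxE.
have -> : \sum_j diag_mx s k j * B j k = s 0 k * B k k.
  rewrite (bigD1 k) //= big1 ?addr0 => [|j /negbTE jk]; first by rewrite mxE eqxx mulr1n.
  by rewrite mxE eq_sym jk mulr0n mul0r.
by have := s_gt0 k; nia.
Qed.

Lemma step_mutate (s : seed) (k : 'I_2) : skew_symmetrizable (exchange s) ->
  seed_state (mutate k s) (other k) = step (seed_state s k).
Proof.
move=> sk; rewrite /seed_state /step otherK /= !mxE !ffunE.
rewrite !eqxx other_neq !orbT /= !(prod2 _ k).
by rewrite (skew_diag k sk) oppr0 /pos_part maxxx expr0z !mul1r.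
Qed.

HB.instance Definition _ := GRing.RMorphism.copy QP_FF
  (@tofrac {mpoly QP[2]} \o @mpolyC 2 QP).

Lemma free_generating_neq0 (x : {ffun 'I_2 -> FF}) (i : 'I_2) : free_generating x -> x i != 0.
Proof.
case=> inj _; apply/eqP => xi0.
have : mpoly_eval x ('X_i : {mpoly QP[2]}) = 0.
  by rewrite /mpoly_eval mmapX mmap1U.
move=> /inj /(congr1 (fun p => p@_U_(i))); rewrite mcoeffX eqxx mcoeff0.
by apply/eqP; rewrite oner_eq0.
Qed.

Lemma T2_labelS (t : int) : T2_label (t + 1) = other (T2_label t).
Proof.
rewrite /T2_label; have -> : odd `|(t + 1)%R|%N = ~~ odd `|t|%N by lia.
by case: odd.
Qed.

Definition init_state (b c : nat) : state :=
  State (xvar ix1) (xvar ix2) (trop_gen ix1) (trop_gen ix2) (- c%:Z) b%:Z.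

(** The third clause is the mutation along the same edges in the opposite
    direction.  Both make the sequence determined by any one of its terms, which
    gives periodicity as soon as two terms agree. *)
Definition state_sequence (b c : nat) (a : int -> state) : Prop :=
  [/\ a 0 = init_state b c,
      forall n : int, a (n + 1) = step (a n),
      forall n : int, rev_state (a n) = step (rev_state (a (n + 1)))
    & forall n : int, var1 (a n) != 0].

(** The label of the edge that leaves [t0] upwards depends on the parity of [t0];
    the sequence is oriented so that index 1 is mutated first. *)
Lemma pattern_states (b c : nat) (t0 : int) (Sigma : int -> seed) :
  principal_cluster_pattern (exchange_matrix b c) t0 Sigma ->
  exists2 a : int -> state, state_sequence b c a
    & forall z, cluster_variable Sigma z -> exists n : int, z = var1 (a n).
Proof.
case=> lab init edge.
have sk t : skew_symmetrizable (exchange (Sigma t)) by case: (lab t).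
have nz t i : cluster (Sigma t) i != 0.
  by apply: free_generating_neq0; case: (lab t).
have up (t : int) : seed_state (Sigma (t + 1)) (T2_label (t + 1)) =
    step (seed_state (Sigma t) (T2_label t)).
  rewrite (edge (T2_label t) t (t + 1)); last by left.
  by rewrite T2_labelS step_mutate.
have down (t : int) : rev_state (seed_state (Sigma t) (T2_label t)) =
    step (rev_state (seed_state (Sigma (t + 1)) (T2_label (t + 1)))).
  rewrite T2_labelS -!seed_state_other otherK.
  rewrite [in LHS](edge (T2_label t) (t + 1) t); last by right.
  exact: step_mutate.
have diag i j : exchange_matrix b c i j =
   if (i == ix1) && (j == ix2) then b%:Z
    else if (i == ix2) && (j == ix1) then - c%:Z else 0 by rewrite mxE.
have E0 : seed_state (Sigma t0) ix1 = init_state b c.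
  rewrite init /init_state /seed_state /= !ffunE !diag /=.
  by have -> : other ix1 = ix2 by [].
have onto (t : int) (i : 'I_2) :
    cluster (Sigma t) i = var1 (seed_state (Sigma t) (T2_label t)) \/
    cluster (Sigma t) i = var2 (seed_state (Sigma t) (T2_label t)).
  by have [->|->] := ord2P (T2_label t) i; [left|right].
have [t0_odd|t0_even] := boolP (odd `|t0|%N).
  exists (fun n : int => rev_state (seed_state (Sigma (t0 - n)) (T2_label (t0 - n)))).
    split=> [|n|n|n].
    - rewrite subr0 -seed_state_other -E0; congr seed_state.
      by rewrite /T2_label t0_odd.
    - have -> : t0 - n = t0 - (n + 1) + 1 by clear; lia.
      exact: down.
    - rewrite !rev_stateK.
      have -> : t0 - n = t0 - (n + 1) + 1 by clear; lia.
      exact: up.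
    - exact: nz.
  move=> z [t [i ->]]; have [->|->] := onto t i; last first.
    by exists (t0 - t); rewrite subKr.
  exists (t0 - t + 1); have -> : t0 - (t0 - t + 1) = t - 1 by clear; lia.
  by rewrite -[t in LHS](subrK 1) up.
exists (fun n : int => seed_state (Sigma (t0 + n)) (T2_label (t0 + n))).
  split=> [|n|n|n].
  - by rewrite addr0 -E0; congr seed_state; rewrite /T2_label (negbTE t0_even).
  - by rewrite addrA up.
  - by rewrite addrA down.
  - exact: nz.
move=> z [t [i ->]]; have [->|->] := onto t i.
  by exists (t - t0); rewrite addrC subrK.
exists (t + 1 - t0); have -> : t0 + (t + 1 - t0) = t + 1 by clear; lia.
by rewrite up.
Qed.

(** * Tropical coefficients and the expansion in both directions *)
Definition trop_pair (u v : int) : trop := [ffun j => if j == ix1 then u else v].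

Lemma trop_mulE (u v u' v' : int) :
  trop_mul (trop_pair u v) (trop_pair u' v') = trop_pair (u + u') (v + v').
Proof. by apply/ffunP => j; rewrite !ffunE; case: ifP. Qed.

Lemma trop_expE (u v n : int) : trop_exp (trop_pair u v) n = trop_pair (u * n) (v * n).
Proof. by apply/ffunP => j; rewrite !ffunE; case: ifP. Qed.

Lemma trop_oplus1E (u v : int) :
  trop_oplus (trop_pair u v) trop_one = trop_pair (Num.min u 0) (Num.min v 0).
Proof. by apply/ffunP => j; rewrite !ffunE; case: ifP. Qed.

Lemma trop_gen1E : trop_gen ix1 = trop_pair 1 0.
Proof. by apply/ffunP => -[[|[|//]] i]; rewrite !ffunE. Qed.

Lemma trop_gen2E : trop_gen ix2 = trop_pair 0 1.
Proof. by apply/ffunP => -[[|[|//]] i]; rewrite !ffunE. Qed.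

Lemma trop_FFE (p : trop) : trop_FF p = yvar ix1 ^ (p ix1) * yvar ix2 ^ (p ix2).
Proof.
pose X (j : 'I_2) : FF := QP_FF (tofrac ('X_j : {mpoly int[2]}) : QP).
have E (r : trop) : trop_FF r = X ix1 ^ (r ix1) * X ix2 ^ (r ix2).
  rewrite /trop_FF /trop_QP rmorph_prod (prod2 _ ix1) /=.
  have -> : other ix1 = ix2 by [].
  by rewrite !fmorphXz.
rewrite E /yvar !E trop_gen1E trop_gen2E !ffunE /=.
by rewrite !expr0z !expr1z mulr1 mul1r.
Qed.

Lemma trop_FF_pair (u v : int) : trop_FF (trop_pair u v) = yvar ix1 ^ u * yvar ix2 ^ v.
Proof. by rewrite trop_FFE !ffunE. Qed.

Lemma xvar_neq0 i : xvar i != 0.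
Proof.
rewrite /xvar tofrac_eq0; apply/eqP => /(congr1 (fun p => p@_U_(i))).
by rewrite mcoeffX eqxx mcoeff0; apply/eqP; rewrite oner_eq0.
Qed.

Lemma yvar_neq0 i : yvar i != 0.
Proof.
rewrite /yvar /trop_FF fmorph_eq0 /trop_QP; apply/prodf_neq0 => j _.
rewrite expfz_neq0 // tofrac_eq0; apply/eqP => /(congr1 (fun p => p@_U_(j))).
by rewrite mcoeffX eqxx mcoeff0; apply/eqP; rewrite oner_eq0.
Qed.

Section Formulas.

Local Notation x1 := (xvar ix1).
Local Notation x2 := (xvar ix2).
Local Notation y1 := (yvar ix1).
Local Notation y2 := (yvar ix2).

Definition ymon (d : nat * nat) : FF := y1 ^+ d.1 * y2 ^+ d.2.

Lemma ymonE (u v : nat) : ymon (u, v) = y1 ^+ u * y2 ^+ v.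
Proof. by []. Qed.

Lemma ymon_neq0 d : ymon d != 0.
Proof. by rewrite mulf_neq0 // expf_neq0 // yvar_neq0. Qed.

Lemma pos_part_nat (n : nat) : pos_part n%:Z = n%:Z.
Proof. by rewrite /pos_part; lia. Qed.

Lemma pos_part_opp_nat (n : nat) : pos_part (- n%:Z) = 0.
Proof. by rewrite /pos_part; lia. Qed.

(** The right-hand side of the theorem for nonnegative [d1] and [d2], with its
    sum over compatible pairs rewritten by [greedy]. *)
Definition greedy_form (b c d1 d2 : nat) : FF :=
  y1 ^+ d1 * greedy d1 d2 b c (x1 ^+ b * y2) (x2 ^+ c / y1) / (x1 ^+ d1 * x2 ^+ d2).

Section Sequence.

Variables (b c : nat) (a : int -> state).
Hypothesis a_seq : state_sequence b c a.
Hypothesis bc_gt0 : (0 < b)%N = (0 < c)%N.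

(** When index 1 is mutated first, the coefficient about to be mutated always has
    nonnegative exponents, so that the tropical sums are trivial and the
    exponents follow the recursion of [dvec_rec]. *)
Lemma right_state (m : nat) : dvec_exact_upto m b c ->
  [/\ ent1 (a m%:Z) = - (exponent c b m)%:Z, ent2 (a m%:Z) = (exponent b c m)%:Z,
      coef1 (a m%:Z) = trop_pair (dvec m b c).1 (dvec m b c).2
    & coef2 (a m%:Z) =
        if m is m'.+1 then trop_pair (- (dvec m' b c).1%:Z) (- (dvec m' b c).2%:Z)
        else trop_pair 0 1].
Proof.
case: a_seq => a0 aS _ _; elim: m => [|m IH] good.
  by rewrite a0 /= trop_gen1E trop_gen2E.
have [_ _ good'] := dvec_exact_le good.
have [f g y y'] := IH good'.
have -> : m.+1%:Z = m%:Z + 1 by lia.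
rewrite aS /step /= f g y y' !exponentS opprK.
rewrite pos_part_nat trop_oplus1E !trop_expE; split=> //; last first.
  by rewrite !mulrN1.
have -> : Num.min (dvec m b c).1%:Z 0 = 0 by lia.
have -> : Num.min (dvec m b c).2%:Z 0 = 0 by lia.
rewrite !mul0r; case: m IH good good' f g y y' => [|m] _ good _ _ _ _ _.
  by rewrite !trop_mulE /= /exponent /=; congr trop_pair; lia.
have [E1 E2] := dvec_rec good.
rewrite !trop_mulE; congr trop_pair.
  by rewrite addr0 addrC -PoszM mulnC -E1 PoszD addrK.
by rewrite addr0 addrC -PoszM mulnC -E2 PoszD addrK.
Qed.

Lemma right_exchange (m : nat) : dvec_exact_upto m b c ->
  var1 (a m.+2%:Z) * var1 (a m%:Z) = ymon (dvec m b c) + var1 (a m.+1%:Z) ^+ exponent b c m.+1.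
Proof.
move=> good; have [f _ y _] := right_state good; case: a_seq => _ aS _ nz.
have E1 : var1 (a m.+1%:Z) = var2 (a m%:Z).
  have -> : m.+1%:Z = m%:Z + 1 by lia.
  by rewrite aS.
have -> : m.+2%:Z = m%:Z + 1 + 1 by lia.
rewrite aS /= aS E1 /= f y trop_oplus1E opprK pos_part_nat pos_part_opp_nat.
have -> : Num.min (dvec m b c).1%:Z 0 = 0 by lia.
have -> : Num.min (dvec m b c).2%:Z 0 = 0 by lia.
rewrite !trop_FF_pair !expr0z !mul1r mulr1 exponentS mulfVK //.
Qed.

Lemma right_form (m : nat) : dvec_exact_upto m b c ->
  var1 (a m.+2%:Z) = greedy_form b c (dvec m b c).1 (dvec m b c).2.
Proof.
move=> good; case: (a_seq) => a0 aS _ nz.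
have goodS i : (i <= m)%N -> dvec_exact_upto i b c.
  by move=> im j ji; apply: good; apply: leq_trans ji im.
pose x (i : nat) := var1 (a i%:Z).
(* The recursion of [beta], continued backwards from the first two d-vectors,
   gives [1 / y2] at 0. *)
pose beta (i : nat) := if i is i'.+1 then ymon (dvec i' b c) else y2^-1.
pose delta (i : nat) := if i is i'.+1 then ymon (dvec i' b c) else 1.
have bn0 i : beta i != 0 by case: i => [|i]; rewrite /beta ?invr_neq0 ?yvar_neq0 ?ymon_neq0.
have dn0 i : delta i != 0 by case: i => [|i]; rewrite /delta ?oner_neq0 ?ymon_neq0.
have brec i : (i < m)%N -> beta i.+2 * beta i = delta i.+1 ^+ exponent b c i.
  case: i => [|i] im.
    rewrite /= /ymon /exponent /= muln1 subn0 !expr1 expr0 mulr1.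
    by rewrite mulfK ?yvar_neq0.
  have [E1 E2] := dvec_rec (goodS _ im).
  by rewrite /beta /delta /ymon mulrACA -!exprD E1 E2 exprMn -!exprM !(mulnC (exponent _ _ _)).
have := cluster_formula_exchange (x := x) (beta := beta) (delta := delta) (m := m) (b := b) (c := c)
  (fun i => nz i%:Z) bn0 dn0 _ brec bc_gt0 (proj1 (andP (good m (leqnn m)))).
rewrite /x => -> //; last first.
 move=> i im; rewrite right_exchange; [exact/factor_out/ymon_neq0|exact: goodS].
have goodm : dvec_exact m b c by have /andP[] := good m (leqnn m).
have -> : norm_factor m b c beta delta = beta 1%N ^+ (dvec m b c).1.
  have db i : delta i.+1 = beta i.+1 by [].
  exact: norm_factor_regular bn0 db brec goodm.
have -> : a 1 = step (a 0) by rewrite -aS.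
rewrite a0 /= /greedy_form /ymon /= expr1 expr0 mulr1 invrK.
done.
Qed.

End Sequence.

Lemma step_pair (x x' : FF) (u v u' v' f g : int) :
  step (State x x' (trop_pair u v) (trop_pair u' v') f g) =
  State x' ((y1 ^ u * y2 ^ v * x' ^ pos_part f + x' ^ pos_part (- f))
            / (y1 ^ Num.min u 0 * y2 ^ Num.min v 0 * x))
    (trop_pair (u' + u * pos_part g + Num.min u 0 * - g)
               (v' + v * pos_part g + Num.min v 0 * - g))
    (trop_pair (- u) (- v)) (- g) (- f).
Proof. by rewrite /step /= trop_oplus1E !trop_expE !trop_mulE !trop_FF_pair !mulrN1. Qed.

Section Left.

Variables (b c : nat) (a : int -> state).
Hypothesis a_seq : state_sequence b c a.
Hypothesis bc_gt0 : (0 < b)%N = (0 < c)%N.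

(** The other half of the tree, where index 2 is mutated first. *)
Definition left_seq (n : nat) : state := rev_state (a (- n%:Z)).
Arguments left_seq : simpl never.
Local Notation s := left_seq.
Local Notation ymon' d := (ymon (d.2, d.1)).

Lemma left_seqS (n : nat) : s n.+1 = step (s n).
Proof.
case: a_seq => _ _ aP _; rewrite /left_seq aP.
by have -> : - n.+1%:Z + 1 = - n%:Z by lia.
Qed.

Lemma left_neq0 (n : nat) : var1 (s n) != 0.
Proof.
case: a_seq => _ aS _ nz; have := nz (- n%:Z + 1).
by rewrite aS.
Qed.

Lemma left_var1S (n : nat) : var1 (s n.+1) = var2 (s n).
Proof. by rewrite left_seqS. Qed.

Lemma left_init : s 0 = State x2 x1 (trop_pair 0 1) (trop_pair 1 0) b%:Z (- c%:Z).
Proof.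
by case: a_seq => a0 _ _ _; rewrite /left_seq oppr0 a0 /= -trop_gen1E -trop_gen2E.
Qed.

(** The first two mutations happen at the initial coefficients [y2] and [y1].
    After them the coefficients to be mutated have nonpositive exponents, and a
    regular pattern starts ([left_state]). *)
Lemma left_one : s 1 = State x1 ((y2 * x1 ^+ b + 1) / x2)
  (trop_pair 1 0) (trop_pair 0 (-1)) c%:Z (- b%:Z).
Proof.
rewrite left_seqS left_init step_pair.
congr State; try (congr trop_pair; clear); rewrite /pos_part; try lia.
have -> : Num.max b%:Z 0 = b%:Z by lia.
have -> : Num.max (- b%:Z) 0 = 0 by lia.
have -> : Num.min (0 : int) 0 = 0 by [].
have -> : Num.min (1 : int) 0 = 0 by [].
by rewrite !expr0z !expr1z !mul1r.
Qed.

Lemma left_two : s 2 = State ((y2 * x1 ^+ b + 1) / x2)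
  ((y1 * ((y2 * x1 ^+ b + 1) / x2) ^+ c + 1) / x1)
  (trop_pair 0 (-1)) (trop_pair (-1) 0) b%:Z (- c%:Z).
Proof.
rewrite left_seqS left_one; move: ((y2 * x1 ^+ b + 1) / x2) => x3.
rewrite step_pair; congr State; try (congr trop_pair; clear); rewrite /pos_part; try lia.
have -> : Num.max c%:Z 0 = c%:Z by lia.
have -> : Num.max (- c%:Z) 0 = 0 by lia.
have -> : Num.min (0 : int) 0 = 0 by [].
have -> : Num.min (1 : int) 0 = 0 by [].
by rewrite !expr0z !expr1z !mul1r mulr1.
Qed.

Lemma left_state (m : nat) : dvec_exact_upto m c b ->
  [/\ ent1 (s m.+2) = (exponent b c m)%:Z, ent2 (s m.+2) = - (exponent c b m)%:Z,
      coef1 (s m.+2) = trop_pair (- (dvec m c b).2%:Z) (- (dvec m c b).1%:Z)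
    & coef2 (s m.+2) = if m is m'.+1 then trop_pair (dvec m' c b).2 (dvec m' c b).1
                       else trop_pair (-1) 0].
Proof.
elim: m => [|m IH] good; first by rewrite left_two.
have [_ _ good'] := dvec_exact_le good; have [f g y y'] := IH good'.
rewrite left_seqS; case: (s m.+2) f g y y' => X X' C1 C2 F G /= f g y y'.
rewrite /step /= f g y y' !exponentS opprK.
rewrite pos_part_opp_nat trop_oplus1E !trop_expE.
have -> : Num.min (- (dvec m c b).1%:Z) 0 = - (dvec m c b).1%:Z by lia.
have -> : Num.min (- (dvec m c b).2%:Z) 0 = - (dvec m c b).2%:Z by lia.
rewrite !mulr0; split=> //; last by rewrite !mulrN1 !opprK.
case: m IH good good' f g y y' => [|m] _ good _ _ _ _ _.
  by rewrite !trop_mulE /= /exponent /=; congr trop_pair; lia.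
have [E1 E2] := dvec_rec good; rewrite !trop_mulE; congr trop_pair.
  by rewrite addr0 mulNr -PoszM mulnC -E2 PoszD opprD addrCA subrr addr0.
by rewrite addr0 mulNr -PoszM mulnC -E1 PoszD opprD addrCA subrr addr0.
Qed.

Lemma left_exchange (m : nat) : dvec_exact_upto m c b ->
  var1 (s m.+4) * var1 (s m.+2) =
  ymon' (dvec m c b) + var1 (s m.+3) ^+ exponent b c m.
Proof.
move=> good; have [f _ y _] := left_state good.
have E4 : var1 (s m.+4) = var2 (step (s m.+2)) by rewrite left_var1S left_seqS.
rewrite E4 (left_var1S m.+2); move: f y (left_neq0 m.+2).
case: (s m.+2) => X X' C1 C2 F G /= -> -> X0.
rewrite trop_oplus1E pos_part_nat pos_part_opp_nat.
have -> : Num.min (- (dvec m c b).1%:Z) 0 = - (dvec m c b).1%:Z by lia.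
have -> : Num.min (- (dvec m c b).2%:Z) 0 = - (dvec m c b).2%:Z by lia.
have -> : trop_FF (trop_pair (- (dvec m c b).2%:Z) (- (dvec m c b).1%:Z)) =
    (ymon' (dvec m c b))^-1.
  by rewrite trop_FF_pair /ymon /= invfM -!exprnN.
by rewrite expr0z exchange_clear ?ymon_neq0.
Qed.

Lemma left_form (m : nat) : dvec_exact_upto m c b ->
  var1 (s m.+2) = greedy_form b c (dvec m c b).2 (dvec m c b).1.
Proof.
move=> good.
have goodS i : (i <= m)%N -> dvec_exact_upto i c b.
  by move=> im j ji; apply: good; apply: leq_trans ji im.
have goodm i : (i <= m)%N -> dvec_exact i c b by move=> im; have /andP[] := good i im.
(* The first three values of [beta] and [delta] come from the two irregular
   exchange relations; from index 2 on they obey the recursion of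
   [norm_factor_regular]. *)
pose beta (i : nat) := match i with
  | 0 => y1 | 1 => y2^-1 | 2 => y1^-1 | i'.+3 => ymon' (dvec i' c b) end.
pose delta (i : nat) := if i is i'.+3 then ymon' (dvec i' c b) else 1.
have bn0 i : beta i != 0.
  by case: i => [|[|[|i]]]; rewrite /beta ?invr_neq0 ?yvar_neq0 ?ymon_neq0.
have dn0 i : delta i != 0.
  by case: i => [|[|[|i]]]; rewrite /delta ?oner_neq0 ?ymon_neq0.
have exp2 i : exponent c b i.+2 = exponent c b i by rewrite /exponent /= negbK.
have brec i : (i < m)%N -> beta i.+2 * beta i = delta i.+1 ^+ exponent c b i.
  case: i => [|[|[|i]]] im; rewrite /beta /delta.
  - by rewrite expr1n mulVf ?yvar_neq0.
  - by rewrite expr1n /ymon /= expr0 mul1r expr1 divff ?yvar_neq0.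
  - rewrite /ymon /exponent /= muln1 subn0 expr0 mul1r !expr1 mulrAC.
    by rewrite divff ?yvar_neq0 // mul1r.
  have [E1 E2] := dvec_rec (goodS i.+2 (ltnW (ltnW im))).
  by rewrite !ymonE mulrACA -!exprD E1 E2 exprMn -!exprM exp2 !(mulnC (exponent _ _ _)).
have v0 : var1 (s 0) = x2 by rewrite left_init.
have v1 : var1 (s 1) = x1 by rewrite left_one.
have xrec i : (i <= m)%N -> var1 (s i.+2) * var1 (s i) =
    delta i.+1 * (1 + var1 (s i.+1) ^+ exponent c b i.+1 / beta i.+1).
  case: i => [|[|i]] im; rewrite /beta /delta /exponent.
  - rewrite v0 v1 left_two /= mul1r invrK mulfVK ?xvar_neq0 // addrC; congr (_ + _).
    exact: mulrC.
  - rewrite v1 (left_var1S 2) left_two /= mul1r invrK mulfVK ?xvar_neq0 // addrC; congr (_ + _).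
    exact: mulrC.
  rewrite left_exchange; last by apply: goodS; exact: (ltnW (ltnW im)).
  by rewrite -/(exponent c b i.+3) exp2 exponentS; apply: factor_out; apply: ymon_neq0.
have := cluster_formula_exchange (x := fun i => var1 (s i)) left_neq0 bn0 dn0 xrec brec
  (esym bc_gt0) (goodm m (leqnn m)).
move=> ->; rewrite v0 v1 greedy_sym.
have -> : norm_factor m c b beta delta = y1 ^+ (dvec m c b).2.
  move: (m) brec goodm => [|[|k]] brec' good'.
  - by rewrite /= expr0.
  - by rewrite /= expr0 divr1 mul1r.
  rewrite [norm_factor _ _ _ _ _]/= -/(dvec k.+1 b c) [(dvec k.+2 c b).2]/=.
  rewrite (norm_factor_regular (b := c) (c := b)).
  - rewrite !/tail_seq /= !expr1n !divr1.
    by rewrite ymonE expr0 mul1r expr1 -exprMn divff ?yvar_neq0 // expr1n mul1r.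
  - by move=> i; apply: bn0.
  - by [].
  - by move=> i ik; rewrite /tail_seq brec' // exp2.
  - by apply: good'; rewrite -addn2 leq_addr.
rewrite /greedy_form; congr (_ * _ / _); last exact: mulrC.
by congr greedy; rewrite invrK.
Qed.

(** In finite type the variables reached to the right end with those obtained
    from the first two mutations to the left, and coefficients and exchange
    entries agree there as well. *)
Lemma state_wrap (k : nat) : dvec_exact_upto k.+1 b c -> dvec k b c = (1, c)%N ->
  dvec k.+1 b c = (0, 1)%N -> (odd k -> b = c) -> a k.+2%:Z = a (- 2).
Proof.
move=> good dk dk1 odd_bc; have [_ _ good0] := dvec_exact_le good.
have [f g y y'] := right_state a_seq bc_gt0 good.
have vk := right_form a_seq bc_gt0 good0; have vk1 := right_form a_seq bc_gt0 good.
have good1 : dvec_exact_upto 1 c b.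
  by move=> i i1; rewrite andbC; apply: good; apply: leq_trans i1 _.
have good00 : dvec_exact_upto 0 c b by move=> i i0; apply: good1; apply: leqW.
have w0 := left_form good00; have w1 := left_form good1.
rewrite dk in vk; rewrite dk1 in vk1 y; rewrite dk in y'.
have -> : a (- 2) = rev_state (s 2) by rewrite /left_seq rev_stateK.
have ES : a k.+2%:Z = step (a k.+1%:Z).
  have -> : k.+2%:Z = k.+1%:Z + 1 by lia.
  by case: a_seq.
have V2 : var2 (a k.+2%:Z) = var1 (s 2).
  have -> : var2 (a k.+2%:Z) = var1 (a k.+3%:Z).
    have -> : k.+3%:Z = k.+2%:Z + 1 by lia.
    by case: a_seq => _ -> _ _.
  by rewrite vk1 w0.
have V1 : var1 (a k.+2%:Z) = var2 (s 2).
  by rewrite vk -left_var1S w1 /= muln1 subn0.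
have e1 : exponent b c k.+1 = c.
  by rewrite /exponent /=; case: (odd k) odd_bc => // /(_ isT).
have e2 : exponent c b k.+1 = b.
  by rewrite /exponent /=; case: (odd k) odd_bc => // /(_ isT).
have [C1 C2 G1 G2] : [/\ coef1 (a k.+2%:Z) = trop_pair (- 1) 0,
    coef2 (a k.+2%:Z) = trop_pair 0 (- 1),
    ent1 (a k.+2%:Z) = - c%:Z & ent2 (a k.+2%:Z) = b%:Z].
  rewrite ES; case: (a k.+1%:Z) f g y y' => X X' C1 C2 G1 G2 /= -> -> -> ->.
  rewrite e1 e2 trop_oplus1E !trop_expE !trop_mulE opprK.
  by split=> //; congr trop_pair; rewrite /pos_part; lia.
rewrite left_two in V1 V2 *; move: V1 V2 C1 C2 G1 G2.
by case: (a k.+2%:Z) => X X' C1 C2 G1 G2 /= -> -> -> -> -> ->.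
Qed.

(** Each state determines its two neighbours. *)
Lemma state_periodic (N : nat) (n0 : int) : a (n0 + N%:Z) = a n0 ->
  forall n : int, a (n + N%:Z) = a n.
Proof.
case: a_seq => _ aS aP _ E n.
have up (m : int) : a (m + N%:Z) = a m -> a (m + 1 + N%:Z) = a (m + 1).
  have -> : m + 1 + N%:Z = m + N%:Z + 1 by clear; lia.
  by move=> Em; rewrite (aS m) (aS (m + N%:Z)) Em.
have down (m : int) : a (m + 1 + N%:Z) = a (m + 1) -> a (m + N%:Z) = a m.
  have -> : m + 1 + N%:Z = m + N%:Z + 1 by clear; lia.
  by move=> Em; apply: (inv_inj rev_stateK); rewrite (aP m) (aP (m + N%:Z)) Em.
have -> : n = n0 + (n - n0) by clear; lia.
elim/int_updown_ind: (n - n0) => [|z IH|z IH]; first by rewrite addr0.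
  by rewrite addrA; apply: up.
by apply: down; rewrite -[n0 + z + 1]addrA.
Qed.

Definition greedy_or_initial (z : FF) : Prop :=
  [\/ z = x1, z = x2 | exists d1 d2 : nat, z = greedy_form b c d1 d2].

Lemma initial_vars : var1 (a 0) = x1 /\ var1 (a 1) = x2.
Proof.
case: a_seq => a0 aS _ _; split; first by rewrite a0.
by have := aS 0; rewrite add0r => ->; rewrite a0.
Qed.

Lemma infinite_forms (n : int) : (forall m, dvec_exact_upto m b c) ->
  greedy_or_initial (var1 (a n)).
Proof.
move=> good; have [v0 v1] := initial_vars.
case: n => [[|[|m]]|m]; [by constructor 1|by constructor 2|constructor 3|constructor 3].
  by do 2!eexists; apply: right_form.
exists (dvec m c b).2, (dvec m c b).1.
rewrite -(left_form (m := m)); last exact: dvec_exact_upto_sym.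
rewrite left_var1S /left_seq /=; congr (var1 (a _)); lia.
Qed.

Lemma finite_forms (n : int) (k : nat) : dvec_exact_upto k.+1 b c -> dvec k b c = (1, c)%N ->
  dvec k.+1 b c = (0, 1)%N -> (odd k -> b = c) -> greedy_or_initial (var1 (a n)).
Proof.
move=> good dk dk1 odd_bc; have [v0 v1] := initial_vars.
have W := state_wrap good dk dk1 odd_bc.
have per : forall m : int, a (m + k.+4%:Z) = a m.
  by apply: (state_periodic (n0 := - 2)); rewrite -W; congr a; lia.
have [r [z [r_lt ->]]] : exists (r : nat) (z : int), (r < k.+4)%N /\ n = r%:Z + z * k.+4%:Z.
  have := divz_eq n k.+4%:Z; have := @ltz_pmod n k.+4%:Z; have := @modz_ge0 n k.+4%:Z.
  move: (divz _ _) (modz _ _) => z r r_ge0 r_lt En.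
  by exists `|r|%N, z; split; lia.
have -> : a (r%:Z + z * k.+4%:Z) = a r%:Z.
  elim/int_updown_ind: z => [|z IH|z IH]; first by rewrite mul0r addr0.
    by rewrite mulrDl mul1r addrA per.
  by rewrite -IH mulrDl mul1r addrA per.
case: r r_lt => [|[|r]] r_lt; [by constructor 1|by constructor 2|constructor 3].
do 2!eexists; apply: (right_form a_seq bc_gt0) => i ir; apply: good.
by apply: leq_trans ir _; rewrite -ltnS.
Qed.

Lemma all_forms (n : int) : greedy_or_initial (var1 (a n)).
Proof.
have [bc4|bc4] := leqP 4 (b * c); first by apply: infinite_forms; apply: dvec_exact_infinite.
have [k [good dk dk1 odd_bc]] := finite_types bc4 bc_gt0.
exact: finite_forms good dk dk1 odd_bc.
Qed.

End Left.

(** * The d-vector of an expansion *)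

(** Divisibility by neither variable, expressed by coefficients: for each
    variable there is a monomial without it. *)
Definition x_reduced (N : {mpoly QP[2]}) : Prop :=
  forall i : 'I_2, exists2 m : 'X_{1..2}, m i = 0%N & N@_m != 0.

(** If every monomial of [N] contains the variable, the quotient has the same
    coefficients, hence lies over the same ring. *)
Lemma not_x_divides (N : {mpoly QP[2]}) : over_ZP N -> (forall i, ~ x_divides i N) ->
  x_reduced N.
Proof.
move=> NZ ndiv i; apply: contrapT => no; apply: (ndiv i).
have zero (m : 'X_{1..2}) : m i = 0%N -> N@_m = 0.
  by move=> mi; apply/eqP/negPn/negP => Nm; apply: no; exists m.
pose M : {mpoly QP[2]} := \sum_(m <- msupp N) N@_m *: 'X_[m - U_(i)].
have NM : N = 'X_i * M.
  rewrite {1}(mpolyE N) mulr_sumr; apply: eq_big_seq => m.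
  rewrite mcoeff_msupp => Nm; rewrite -scalerAr -mpolyXD; congr (_ *: 'X_[_]).
  rewrite addmC submK // lep1mP; apply: contra Nm => /eqP mi.
  by apply/eqP/zero.
exists M; split=> // k.
have -> : M@_k = N@_(U_(i) + k) by rewrite [in RHS]NM mulrC mcoeffMX.
exact: NZ.
Qed.

Lemma mcoeffMX_neq0 (R : nzRingType) (n : nat) (p : {mpoly R[n]}) (m k : 'X_{1..n}) :
  (p * 'X_[m])@_k != 0 -> (m <= k)%MM.
Proof.
move=> pk; apply/negPn/negP => mk; case/negP: pk.
rewrite {1}(mpolyE p) mulr_suml raddf_sum /= big1 // => j _.
rewrite -scalerAl -mpolyXD mcoeffZ mcoeffX; case: eqP => [E|_]; last by rewrite mulr0.
by case/negP: mk; rewrite -E lem_addl.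
Qed.

(** After multiplication by a common monomial, the largest monomial dividing
    either side can be read off. *)
Lemma dvector_unique (N N' : {mpoly QP[2]}) (d1 d2 e1 e2 : int) :
  x_reduced N -> x_reduced N' ->
  tofrac N / (x1 ^ d1 * x2 ^ d2) = tofrac N' / (x1 ^ e1 * x2 ^ e2) :> FF ->
  d1 = e1 /\ d2 = e2.
Proof.
move=> redN redN' E.
(* A shift that makes all exponents nonnegative, so that both sides become
   polynomials. *)
have [K [K1 K2 K3 K4]] : exists K : nat,
    [/\ 0 <= d1 + K%:Z, 0 <= d2 + K%:Z, 0 <= e1 + K%:Z & 0 <= e2 + K%:Z].
  by exists (`|d1| + `|d2| + `|e1| + `|e2|)%N; split; lia.
pose mon (u v : int) : 'X_{1..2} :=
  (U_(ix1) *+ `|(u + K%:Z)%R|%N + U_(ix2) *+ `|(v + K%:Z)%R|%N)%MM.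
have monE (u v : int) : 0 <= u + K%:Z -> 0 <= v + K%:Z ->
    tofrac ('X_[mon u v] : {mpoly QP[2]}) = x1 ^ u * x2 ^ v * (x1 ^+ K * x2 ^+ K) :> FF.
  move=> u0 v0; rewrite mpolyXD -!mpolyXn rmorphM !rmorphXn /= -/(xvar ix1) -/(xvar ix2).
  rewrite mulrACA !exprnP -!expfzDr ?xvar_neq0 //.
  by rewrite !gez0_abs.
have xd0 (u v : int) : x1 ^ u * x2 ^ v != 0 by rewrite mulf_neq0 ?expfz_neq0 ?xvar_neq0.
have EP : N * 'X_[mon e1 e2] = N' * 'X_[mon d1 d2].
  apply/eqP; rewrite -tofrac_eq !tofracM !monE // !mulrA; apply/eqP.
  congr (_ * _ * _).
  move/eqP: E; rewrite eqr_div ?xd0 // => /eqP E.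
  by rewrite -[LHS]mulrA -[RHS]mulrA.
have mon1 u v : mon u v ix1 = `|(u + K%:Z)%R|%N.
  by rewrite /mon mnmDE !mulmnE !mnm1E /= mul1n mul0n addn0.
have mon2 u v : mon u v ix2 = `|(v + K%:Z)%R|%N.
  by rewrite /mon mnmDE !mulmnE !mnm1E /= mul1n mul0n add0n.
have le (P P' : {mpoly QP[2]}) (m m' : 'X_{1..2}) : x_reduced P ->
    P * 'X_[m] = P' * 'X_[m'] -> forall i, (m' i <= m i)%N.
  move=> redP EPP i; have [k ki Pk] := redP i.
  have : (P' * 'X_[m'])@_(m + k) != 0 by rewrite -EPP mcoeffMX.
  by move=> /mcoeffMX_neq0/mnm_lepP/(_ i); rewrite mnmDE ki addn0.
have l1 := le _ _ _ _ redN EP ix1; have l2 := le _ _ _ _ redN EP ix2.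
have l3 := le _ _ _ _ redN' (esym EP) ix1; have l4 := le _ _ _ _ redN' (esym EP) ix2.
rewrite !mon1 in l1 l3; rewrite !mon2 in l2 l4.
by split; [clear -l1 l3 K1 K3|clear -l2 l4 K2 K4]; lia.
Qed.

Definition numerator (b c d1 d2 : nat) : {mpoly QP[2]} :=
  \sum_(S : {set 'I_d2}) \sum_(T : {set 'I_d1} |
      `[< unrolled_compat d1 d2 b c (periodic T) (periodic S) >])
    (trop_QP (trop_gen ix1) ^+ (d1 - #|T|) * trop_QP (trop_gen ix2) ^+ #|S|)%:MP
      * 'X_ix1 ^+ (b * #|S|) * 'X_ix2 ^+ (c * #|T|).

Lemma greedy_term (K : fieldType) (X1 X2 Y1 Y2 : K) (b c d s t : nat) :
  Y1 != 0 -> (t <= d)%N ->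
  Y1 ^+ d * ((X1 ^+ b * Y2) ^+ s * (X2 ^+ c / Y1) ^+ t) =
  Y1 ^+ (d - t) * Y2 ^+ s * X1 ^+ (b * s) * X2 ^+ (c * t).
Proof.
move=> Y0 td; rewrite -{1}(subnK td) exprD !exprMn exprVn -!exprM.
have := expf_neq0 t Y0; move: (Y1 ^+ t) (Y1 ^+ (d - t)) (Y2 ^+ s) (X1 ^+ _) (X2 ^+ _).
by move=> u v w x y u0; field.
Qed.

Lemma numeratorE (b c d1 d2 : nat) :
  greedy_form b c d1 d2 = tofrac (numerator b c d1 d2) / (x1 ^ d1%:Z * x2 ^ d2%:Z).
Proof.
rewrite /greedy_form -!exprnP; congr (_ / _).
rewrite /numerator rmorph_sum mulr_sumr; apply: eq_bigr => S _.
rewrite rmorph_sum mulr_sumr; apply: eq_bigr => T _.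
rewrite greedy_term ?yvar_neq0 //; last by rewrite -[leqRHS](card_ord d1) max_card.
by rewrite !rmorphM !rmorphXn.
Qed.

Lemma reduced_const (N : {mpoly QP[2]}) : N@_0 != 0 -> x_reduced N.
Proof. by move=> N0 i; exists 0%MM; rewrite ?mnm0E. Qed.

(** If [b] and [c] are positive, only the empty pair contributes to the constant
    term, with coefficient a power of [y1].  If both vanish, the numerator is a
    constant. *)
Lemma numerator_reduced (b c d1 d2 : nat) : (0 < b)%N = (0 < c)%N ->
  greedy_form b c d1 d2 != 0 -> x_reduced (numerator b c d1 d2).
Proof.
move=> bc; rewrite numeratorE mulf_eq0 negb_or tofrac_eq0 => /andP[N0 _].
apply: reduced_const; have [b0|b_gt0] := posnP b.
  have c0 : c = 0%N by move: bc; rewrite b0; case: (c).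
  have [k Ek] : exists k : QP, numerator b c d1 d2 = k%:MP.
    eexists; rewrite /numerator b0 c0.
    under eq_bigr => S _ do under eq_bigr => T _ do rewrite !mul0n !expr0 !mulr1.
    under eq_bigr => S _ do rewrite -rmorph_sum.
    by rewrite -rmorph_sum.
  move: N0; rewrite Ek mcoeffC eqxx mulr1; apply: contra => /eqP->.
  by rewrite mpolyC0.
have c_gt0 : (0 < c)%N by rewrite -bc.
have M0 (f g : {mpoly QP[2]}) : (f * g)@_0 = f@_0 * g@_0 by exact: (rmorphM (mcoeff 0%MM)).
have xz (i : 'I_2) (e k : nat) : (0 < e)%N ->
    ('X_i ^+ (e * k) : {mpoly QP[2]})@_0 = (k == 0%N)%:R.
  move=> e_gt0; rewrite rmorphXn /= mcoeffX mnm1_eq0 expr0n muln_eq0.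
  by rewrite eqn0Ngt e_gt0.
have -> : (numerator b c d1 d2)@_0 =
    \sum_(S : {set 'I_d2}) \sum_(T : {set 'I_d1} |
        `[< unrolled_compat d1 d2 b c (periodic T) (periodic S) >])
      trop_QP (trop_gen ix1) ^+ (d1 - #|T|) * trop_QP (trop_gen ix2) ^+ #|S|
        * (S == set0)%:R * (T == set0)%:R.
  rewrite /numerator raddf_sum; apply: eq_bigr => S _.
  rewrite raddf_sum; apply: eq_bigr => T _.
  by rewrite /= !M0 !xz // !cards_eq0 mcoeffC eqxx mulr1.
have ok0 : `[< unrolled_compat d1 d2 b c
    (periodic (set0 : {set 'I_d1})) (periodic (set0 : {set 'I_d2})) >].
  by apply/asboolP => u v _ _ _ /exists_inP[i]; rewrite inE.
rewrite (bigD1 (set0 : {set 'I_d2})) //= [X in _ + X]big1 ?addr0 => [|S S0]; last first.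
  by rewrite big1 // => T _; rewrite (negbTE S0) mulr0 mul0r.
rewrite (bigD1 (set0 : {set 'I_d1})) //= big1 ?addr0 => [|T /andP[_ T0]]; last first.
  by rewrite (negbTE T0) mulr0.
rewrite !eqxx !cards0 subn0 expr0 !mulr1 expf_neq0 //.
by have := yvar_neq0 ix1; rewrite /yvar /trop_FF fmorph_eq0.
Qed.

Lemma sum_maximal_dyck_path (b c d1 d2 : nat) (D : lattice_path d1 d2) : maximal_dyck_path D ->
  \sum_(S : {set 'I_(d1 + d2)} * {set 'I_(d1 + d2)}
         | [&& S.1 \subset horizontal D, S.2 \subset vertical D
             & compatible b c D S.1 S.2])
      y1 ^ (d1%:Z - #|S.1|%:Z) * y2 ^ (#|S.2|%:Z)
        * x1 ^ (b * #|S.2|)%N * x2 ^ (c * #|S.1|)%N =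
  y1 ^+ d1 * greedy d1 d2 b c (x1 ^+ b * y2) (x2 ^+ c / y1).
Proof.
have [n0|n_gt0] := posnP (d1 + d2).
  have [d10 d20] : d1 = 0%N /\ d2 = 0%N by lia.
  subst d1 d2 => _; rewrite greedy_0l expr0 expr0 mul1r.
  rewrite (bigD1 (set0, set0)) /=; last first.
    by rewrite !sub0set; apply/forall_inP => u; rewrite inE.
  rewrite big1 ?addr0 => [|[A B] /andP[_]]; last first.
    have E (Y : {set 'I_(0 + 0)}) : Y = set0 by apply/setP => -[].
    by rewrite (E A) (E B) eqxx.
  by rewrite !cards0 !muln0 !expr0z !mulr1.
move=> HD; have := sum_compatible n_gt0 (maximal_tnth n_gt0 HD) b c
  (fun t s => y1 ^ (d1%:Z - t%:Z) * y2 ^ (s%:Z) * x1 ^ (b * s)%N * x2 ^ (c * t)%N).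
move=> ->; rewrite /greedy mulr_sumr; apply: eq_bigr => S _.
rewrite mulr_sumr; apply: eq_bigr => T _.
have td : (#|T| <= d1)%N by rewrite -[leqRHS](card_ord d1) max_card.
by rewrite greedy_term ?yvar_neq0 // subzn.
Qed.

End Formulas.

Lemma exchange_matrix_pos (b c : nat) : skew_symmetrizable (exchange_matrix b c) ->
  (0 < b)%N = (0 < c)%N.
Proof.
case=> s [s_gt0]; rewrite mul_diag_mx => /matrixP/(_ ix1 ix2).
rewrite !mxE /=; have := s_gt0 ix1; have := s_gt0 ix2.
by move: (s 0 ix1) (s 0 ix2) => u v; nia.
Qed.

Theorem theorem5p6 (b c : nat) (t0 : int) (Sigma : int -> seed)
    (HSigma : principal_cluster_pattern (exchange_matrix b c) t0 Sigma)
    (d1 d2 : int) (xd : FF)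
    (Hxd : cluster_variable Sigma xd) (Hd : has_dvector xd d1 d2)
    (D : lattice_path `|pos_part d1|%N `|pos_part d2|%N)
    (HD : maximal_dyck_path D) :
  xd = xvar ix1 ^ (- d1) * xvar ix2 ^ (- d2) *
    \sum_(S : {set 'I_(`|pos_part d1|%N + `|pos_part d2|%N)}
            * {set 'I_(`|pos_part d1|%N + `|pos_part d2|%N)}
         | [&& S.1 \subset horizontal D, S.2 \subset vertical D
             & compatible b c D S.1 S.2])
      yvar ix1 ^ (pos_part d1 - #|S.1|%:Z) * yvar ix2 ^ (#|S.2|%:Z)
        * xvar ix1 ^ (b * #|S.2|)%N * xvar ix2 ^ (c * #|S.1|)%N.
Proof.
have bc : (0 < b)%N = (0 < c)%N.
  apply: exchange_matrix_pos; case: HSigma => /(_ t0) [_] + init _.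
  by rewrite init.
have [a a_seq cov] := pattern_states HSigma.
have [n En] := cov _ Hxd; have nz : xd != 0 by rewrite En; case: a_seq.
have forms : greedy_or_initial b c xd by rewrite En; exact: all_forms.
transitivity (xvar ix1 ^ (- d1) * xvar ix2 ^ (- d2) *
    (yvar ix1 ^+ `|pos_part d1| * greedy `|pos_part d1| `|pos_part d2| b c
      (xvar ix1 ^+ b * yvar ix2) (xvar ix2 ^+ c / yvar ix1))); last first.
  rewrite -(sum_maximal_dyck_path b c HD); congr (_ * _); apply: eq_bigr => S _.
  by rewrite gez0_abs // /pos_part; lia.
clear D HD; case: Hd => N [NZ ndiv EN]; have redN := not_x_divides NZ ndiv.
have red1 : x_reduced 1.
  by apply: reduced_const; rewrite mcoeff1 eqxx oner_neq0.
case: forms => [E|E|[e1 [e2 E]]].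
- have E1 : tofrac N / (xvar ix1 ^ d1 * xvar ix2 ^ d2)
      = tofrac 1 / (xvar ix1 ^ (- 1) * xvar ix2 ^ 0) :> FF.
    by rewrite -EN E rmorph1 expr0z mulr1 exprN1 div1r invrK.
  have [d1E d2E] := dvector_unique redN red1 E1.
  have a1 : `|pos_part d1|%N = 0%N by rewrite d1E.
  have a2 : `|pos_part d2|%N = 0%N by rewrite d2E.
  have p1 : xvar ix1 ^ (- d1) = xvar ix1 by rewrite d1E.
  have p2 : xvar ix2 ^ (- d2) = 1 by rewrite d2E.
  by rewrite a1 a2 p1 p2 greedy_0l !expr0 !mulr1.
- have E1 : tofrac N / (xvar ix1 ^ d1 * xvar ix2 ^ d2)
      = tofrac 1 / (xvar ix1 ^ 0 * xvar ix2 ^ (- 1)) :> FF.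
    by rewrite -EN E rmorph1 expr0z mul1r exprN1 div1r invrK.
  have [d1E d2E] := dvector_unique redN red1 E1.
  have a1 : `|pos_part d1|%N = 0%N by rewrite d1E.
  have a2 : `|pos_part d2|%N = 0%N by rewrite d2E.
  have p1 : xvar ix1 ^ (- d1) = 1 by rewrite d1E.
  have p2 : xvar ix2 ^ (- d2) = xvar ix2 by rewrite d2E.
  by rewrite a1 a2 p1 p2 greedy_0l !expr0 !mulr1 mul1r.
have redE : x_reduced (numerator b c e1 e2).
  by apply: (numerator_reduced bc); rewrite -E; exact: nz.
have E1 : tofrac N / (xvar ix1 ^ d1 * xvar ix2 ^ d2)
    = tofrac (numerator b c e1 e2) / (xvar ix1 ^ e1%:Z * xvar ix2 ^ e2%:Z) :> FF.
  by rewrite -EN E numeratorE.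
have [-> ->] := dvector_unique redN redE E1.
rewrite !pos_part_nat E /greedy_form !absz_nat.
by rewrite mulrC invfM !exprnN.
Qed.
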